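(* Let $V$ be a symplectic space of dimension $2n$, $n\geq 2$, over a field $\mathbb{K}$. Then: (1) $\mathcal{F}(V)$ is connected if and only if $n\geq 3$. (2) If $n=2$, $\mathcal{F}(V)$ is homotopy equivalent to a discrete space with $|\mathbb{K}|^2(|\mathbb{K}|^2+1)/2$ connected components (infinitely many if $\mathbb{K}$ is infinite). (3) If $n=3$, $\mathcal{G}(V)$ has diameter $3$ and $\mathcal{F}(V)$ is homotopy equivalent to a wedge of $1$-spheres; for $\mathbb{K}=\mathbb{F}_q$ the number of spheres is $-\tilde\chi(\mathcal{F}(V))=\frac{1}{3}\left(q^{12}+2q^{10}-q^8-2q^6-3q^4+3\right)$. (4) If $n\geq 4$, $\mathcal{G}(V)$ has diameter $2$. Moreover, if $r\ge 0$ and $V'$ is an $r$-degenerate symplectic space of dimension $2n+r$ (with $n\ge 2$), then $\mathcal{F}(V')$ is connected if and only if $n\geq 3$.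
   Context: An $r$-degenerate symplectic space is a vector space with an alternating bilinear form $\Psi$ ($\Psi(v,v)=0$ for all $v$) whose radical has dimension $r$; a symplectic space is a $0$-degenerate one. For such a space $V$, the orthogonality graph $\mathcal{G}(V)$ has as vertices the $2$-dimensional non-degenerate subspaces of $V$, adjacent iff orthogonal; the frame complex $\mathcal{F}(V)$ is the clique complex of $\mathcal{G}(V)$. $\tilde\chi$ denotes reduced Euler characteristic. *)

(* Defs.v *)
From HB Require Import structures.
From mathcomp Require Import all_boot all_order all_algebra finmap.
From mathcomp Require Import all_classical all_reals all_analysis.
From mathcomp Require Import homotopy.

Set Implicit Arguments.
Unset Strict Implicit.
Unset Printing Implicit Defensive.

Import Order.TTheory GRing.Theory Num.Theory.
Import numFieldNormedType.Exports.

Local Open Scope classical_set_scope.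
Local Open Scope ring_scope.

Section SymplecticSpaces.
Context {K : fieldType} {V : vectType K}.

Definition alternating (Psi : V -> V -> K) := forall v, Psi v v = 0.

(* An alternating form is skew-symmetric, so starting from the library's      *)
(* {skew_symmetric V} (in order to use its orthov) excludes no                *)
(* alternating bilinear form; in characteristic 2 skew-symmetric forms need   *)
(* not be alternating, whence the separate condition.                         *)
Definition degenerate_symplectic (r : nat) (Psi : {skew_symmetric V}) :=
  alternating Psi /\ \dim (orthov Psi fullv) = r.

Definition symplectic (Psi : {skew_symmetric V}) :=
  degenerate_symplectic 0 Psi.

Definition nondegenerate_on (Psi : {skew_symmetric V}) (U : {vspace V}) :=
  (U :&: orthov Psi U == 0)%VS.

Definition frame_vertex (Psi : {skew_symmetric V}) :=
  {U : {vspace V} | (\dim U == 2) && nondegenerate_on Psi U}.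

Definition orthogonality_graph (Psi : {skew_symmetric V}) :
    rel (frame_vertex Psi) :=
  fun U W => (val U <= orthov Psi (val W))%VS.

End SymplecticSpaces.
Arguments orthogonality_graph {K V} Psi.

Section GraphDistance.
Context {T : eqType} (e : rel T).

Definition walk (x y : T) (k : nat) :=
  exists p : seq T, [/\ path e x p, last x p = y & size p = k].

Definition graph_distance (x y : T) (d : nat) :=
  walk x y d /\ forall k, walk x y k -> (d <= k)%N.

Definition has_diameter (d : nat) :=
  (forall x y, exists2 k, graph_distance x y k & (k <= d)%N) /\
  (exists x y, graph_distance x y d).

End GraphDistance.

Section SimplicialComplexes.
Context {T : choiceType}.
Local Open Scope fset_scope.

Record simplicial_complex := SimplicialComplex {
  simplices : set {fset T};
  simplices_neq0 : forall s, simplices s -> s != fset0;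
  simplices_sub : forall s t : {fset T},
    simplices s -> t `<=` s -> t != fset0 -> simplices t
}.

Definition clique (e : rel T) (s : {fset T}) : Prop :=
  s != fset0 /\ forall x y, x \in s -> y \in s -> x != y -> e x y.

Lemma clique_neq0 (e : rel T) s : clique e s -> s != fset0.
Proof. by case. Qed.

Lemma clique_sub (e : rel T) (s t : {fset T}) :
  clique e s -> t `<=` s -> t != fset0 -> clique e t.
Proof. by move=> [_ es] /fsubsetP ts t0; split=> // x y /ts ? /ts ?; exact: es. Qed.

Definition clique_complex (e : rel T) : simplicial_complex :=
  SimplicialComplex (@clique_neq0 e) (@clique_sub e).

(* The empty face, of dimension -1, contributes -1. The finitely supported    *)
(* sum is meaningful for finite complexes only.                               *)
Definition reduced_euler (X : simplicial_complex) : int :=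
  \sum_(s \in [set s : {fset T} | s = fset0 \/ simplices X s]) (-1 : int) ^+ #|` s|.+1.

End SimplicialComplexes.
Arguments simplicial_complex : clear implicits.

Section GeometricRealization.
Context (R : realType) {T : choiceType}.

(* Barycentric coordinates. *)
Definition closed_simplex (s : {fset T}) : set (T -> R) :=
  [set a | [/\ forall x, 0 <= a x,
               forall x, x \notin s -> a x = 0 &
               \sum_(x <- s) a x = 1]].

Definition realization (X : simplicial_complex T) : Type :=
  {a : T -> R | a \in \bigcup_(s in simplices X) closed_simplex s}.

Context (X : simplicial_complex T).

HB.instance Definition _ := Choice.on (realization X).

Definition coordinates (a : realization X) : prod_topology (fun _ : T => R) :=
  val a.

(* The weak (coherent) topology; each closed simplex carries its Euclidean    *)
(* topology, induced by the topology of pointwise convergence on T -> R.      *)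
Definition realization_open (U : set (realization X)) :=
  forall s, simplices X s -> exists2 W : set (prod_topology (fun _ : T => R)),
    open W &
    U `&` coordinates @^-1` closed_simplex s =
    coordinates @^-1` (W `&` closed_simplex s).

Let realization_openT : realization_open [set: realization X].
Proof.
by move=> s _; exists setT; [exact: openT | rewrite !setTI].
Qed.

Let realization_openI (A B : set (realization X)) :
  realization_open A -> realization_open B -> realization_open (A `&` B).
Proof.
move=> oA oB s Xs; have [WA oWA eA] := oA _ Xs; have [WB oWB eB] := oB _ Xs.
exists (WA `&` WB); first exact: openI.
by rewrite setIIl eA eB -preimage_setI -setIIl.
Qed.

Let realization_open_bigcup (I : Type) (A : I -> set (realization X)) :
  (forall i, realization_open (A i)) -> realization_open (\bigcup_i A i).
Proof.
move=> oA s Xs.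
have /choice[W /all_and2[oW eW]] : forall i,
    exists W : set (prod_topology (fun _ : T => R)), open W /\
    A i `&` coordinates @^-1` closed_simplex s =
    coordinates @^-1` (W `&` closed_simplex s).
  by move=> i; have [W] := oA i _ Xs; exists W.
exists (\bigcup_i W i); first exact: bigcup_open.
by rewrite !setI_bigcupl preimage_bigcup; apply: eq_bigcupr => i _; exact: eW.
Qed.

HB.instance Definition _ := isOpenTopological.Build (realization X)
  realization_openT realization_openI realization_open_bigcup.

End GeometricRealization.

Section HomotopyEquivalence.
Context (R : realType).

Definition homotopic {X Y : topologicalType} (f g : X -> Y) :=
  exists H : X * R -> Y,
    [/\ {within [set: X] `*` `[0, 1], continuous H},
        forall x, H (x, 0) = f x & forall x, H (x, 1) = g x].

Definition homotopy_equivalent (X Y : topologicalType) :=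
  exists (f : X -> Y) (g : Y -> X),
    [/\ continuous f, continuous g,
        homotopic (g \o f) idfun & homotopic (f \o g) idfun].

Definition circle_set : set (R * R) := [set z | z.1 ^+ 2 + z.2 ^+ 2 = 1].

Definition circle : topologicalType := circle_set.

Lemma circle_base_subproof : circle_set (1, 0).
Proof. by rewrite /circle_set /= expr1n expr0n addr0. Qed.

Definition circle_base : circle := SigSub (mem_set circle_base_subproof).

(* The topology is the quotient topology of the disjoint union. For empty I   *)
(* this is the empty space, whereas a wedge of no circles usually means a     *)
(* point.                                                                     *)
Definition wedge_of_circles (I : choiceType) : topologicalType :=
  wedge (fun _ : I => circle_base).

End HomotopyEquivalence.

Definition frame_complex {K : fieldType} {V : vectType K}
    (Psi : {skew_symmetric V}) : simplicial_complex (frame_vertex Psi) :=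
  clique_complex (orthogonality_graph Psi).

(* Main.v *)
(* For n = 2 the only neighbour of a vertex U is its orthogonal, so the       *)
(* complex is a disjoint union of edges. For n = 3 every edge U, W lies in    *)
(* exactly one triangle, with third vertex (U + W)^perp: folding every        *)
(* triangle onto two of its edges turns the complex into a graph, and         *)
(* collapsing a spanning tree leaves one circle for each remaining edge.      *)
(* Two vertices U, W of a space of rank at least 6 are joined by a path       *)
(* U, U', X, W: take a nonradical u orthogonal to U + W, hyperbolic planes    *)
(* U' in U^perp and W' in W^perp containing u with U' inside W + W', and X    *)
(* orthogonal to W + W'. Splitting off a hyperbolic pair e, f with orthogonal *)
(* Y, the planes not orthogonal to e are parametrized by Y x Y, and the other *)
(* ones by the pairs of a plane of Y with a lift of its basis modulo e, that  *)
(* is, an element of K x K; this counts vertices, flags and triangles.        *)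

Require Import Defs.
From HB Require Import structures.
From mathcomp Require Import all_boot all_order all_algebra finmap.
From mathcomp Require Import all_classical all_reals all_analysis.
From mathcomp Require Import homotopy.
From mathcomp Require Import ring lra zify.

Set Implicit Arguments.
Unset Strict Implicit.
Unset Printing Implicit Defensive.

Import Order.TTheory GRing.Theory Num.Theory.
Import numFieldNormedType.Exports.

Local Open Scope classical_set_scope.
Local Open Scope card_scope.
Local Open Scope ring_scope.

(** * Homotopies and geometric realizations *)

(** Everything about the complex is read off the orthogonality graph, and linear algebra controls
    that graph. Hyperbolic planes split off orthogonally ([splits]), so if [Q] is a sum of mutually
    orthogonal ones and its dimension plus that of the radical is less than the dimension of the
    space, a further vertex is orthogonal to [Q] ([orthov_hyperbolic_pair]). With 6 dimensions
    beyond the radical, any two vertices are joined by a walk of length three ([walk3]); in a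
    nondegenerate space of dimension at least 8, one of length two exists ([common_neighbor]); and
    [frame_far] exhibits two vertices at distance three in dimension 6. With 4 dimensions beyond the
    radical, the neighbours of a plane are, modulo the radical, only its orthogonal, and some vertex
    lies outside this pair ([disconnected_rank4]).

    In dimension 4 the complex is a disjoint union of edges, each of which is contracted
    ([disjoint_edges_discrete]). In dimension 6 the orthogonal of an edge is the unique third vertex
    of a triangle ([third_vertex]); hence every clique lies in a triangle, and distinct triangles
    share at most a vertex. Fix a root, and call a corner of a triangle closest to the root its
    apex. Each triangle can be folded onto its two legs, the edges at the apex. This leaves a graph
    on the same vertices. Every vertex other than the root selects a leg that ends at it and has an
    apex closer to the root: these legs form a spanning tree, and each remaining leg yields a circle
    ([triangle_complex_wedge]). With v vertices and k triangles this makes 2k - (v - 1) circles,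
    which is minus the reduced Euler characteristic v - 3k + k - 1.

    The homotopies are given by formulas on single triangles. They glue because the realization
    carries the weak topology, because multiplying by the real line respects it
    ([continuous_prodR]), and because triangles meet only at corners, where alone the formulas must
    agree.

    For the counts, let a space be the orthogonal sum of a hyperbolic plane with basis e, f and of
    Y. Its hyperbolic planes not orthogonal to e correspond to pairs of vectors of Y, the others to
    a plane of Y with two scalars ([card_planes_in]). Over a field with q elements this gives q^4 +
    q^2 vertices in dimension 4 and v = q^8 + q^6 + q^4 in dimension 6, where every vertex has q^4 +
    q^2 neighbours, so that 6k = v(q^4 + q^2). *)

Section Homotopies.
Context {R : realType}.

(** Off the zero set of [h] a single branch applies in a whole neighbourhood; on it both branches
    have the same value, so either one stays near it. *)
Lemma continuous_paste (Z Y : topologicalType) (h : Z -> R) (f g : Z -> Y) :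
  continuous h -> continuous f -> continuous g ->
  (forall z, h z = 0 -> f z = g z) ->
  continuous (fun z => if h z <= 0 then f z else g z).
Proof.
move=> ch cf cg fg z W /= nW.
suff: \forall y \near z, W (if h y <= 0 then f y else g y) by [].
have [hz|hz|hz] := ltgtP (h z) 0.
- move: nW; rewrite ltW// => nW; near=> y.
  have hy : h y < 0 by near: y; exact: (ch z _ (lt_nbhsl hz)).
  by rewrite ltW//; near: y; exact: cf.
- move: nW; rewrite leNgt hz/= => nW; near=> y.
  have hy : 0 < h y by near: y; exact: (ch z _ (lt_nbhsr hz)).
  by rewrite leNgt hy/=; near: y; exact: cg.
- move: nW; rewrite hz lexx => nWf; have nWg := nWf; rewrite (fg _ hz) in nWg.
  near=> y; case: ifP => _; near: y; [exact: cf|exact: cg].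
Unshelve. all: by end_near. Qed.

(** Tube lemma: each [(c, t)] with [t] in [J] has a product neighbourhood sent into [W], and
    compactness of [J] makes finitely many of them suffice. *)
Lemma open_tube (C Y : topologicalType) (F : C * R -> Y) (J : set R) (W : set Y) :
  continuous F -> compact J -> open W ->
  open [set c | forall t, J t -> W (F (c, t))].
Proof.
move=> cF cJ oW; rewrite openE => c Jc; rewrite /interior.
move/compact_near_coveringP : cJ => /(_ C (nbhs c) (fun c t => W (F (c, t)))).
apply => t Jt; have := cF (c, t) W (open_nbhs_nbhs (conj oW (Jc t Jt))).
move=> [[A B] /= [nA nB] AB]; exists (B, A); first by [].
by move=> [t' c'] [/= ? ?]; exact: (AB (c', t')).
Qed.

(* Products with the locally compact space R preserve quotient maps; here for *)
(* quotients of arbitrary families.                                           *)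
Lemma continuous_prodR (X Y : topologicalType) (H : X * R -> Y) :
  (forall x, continuous (fun t => H (x, t))) ->
  (forall J W, compact J -> open W ->
     open [set x | forall t, J t -> W (H (x, t))]) ->
  continuous H.
Proof.
move=> cH oH [x t] W; rewrite nbhsE => -[W' [oW' W'H] W'W].
have /nbhs_ballP[e /= e0 He] := cH x t W' (open_nbhs_nbhs (conj oW' W'H)).
(* Halving the radius gives a compact interval inside the ball. *)
have cJ := @segment_compact R (t - e / 2) (t + e / 2).
have oU := oH _ _ cJ oW'.
apply: (filterS W'W).
exists ([set y | forall t', [set` `[t - e / 2, t + e / 2]] t' -> W' (H (y, t'))],
        [set` `[t - e / 2, t + e / 2]]) => /=.
  split.
    apply: open_nbhs_nbhs; split => //= t'; rewrite in_itv /= => tt'.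
    by apply: He; rewrite /ball /= ltr_norml; lra.
  apply/nbhs_ballP; exists (e / 2) => /=; first by lra.
  by move=> s; rewrite /ball /= in_itv /= ltr_norml; lra.
by move=> [y s] /= [Hy]; exact: Hy.
Qed.

End Homotopies.

Lemma continuous_pair (Z X Y : topologicalType) (f : Z -> X) (g : Z -> Y) :
  continuous f -> continuous g -> continuous (fun z => (f z, g z)).
Proof. by move=> cf cg z; apply: cvg_pair; [exact: cf|exact: cg]. Qed.

Section RealFunctions.
Context {R : realType} {Z : topologicalType} (f g : Z -> R).
Hypotheses (cf : continuous f) (cg : continuous g).

Lemma continuousD_fun : continuous (fun z => f z + g z).
Proof. by move=> z; apply: cvgD; [exact: cf|exact: cg]. Qed.

Lemma continuousB_fun : continuous (fun z => f z - g z).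
Proof. by move=> z; apply: cvgB; [exact: cf|exact: cg]. Qed.

Lemma continuousM_fun : continuous (fun z => f z * g z).
Proof. by move=> z; apply: cvgM; [exact: cf|exact: cg]. Qed.

Lemma continuous_min_fun : continuous (fun z => Num.min (f z) (g z)).
Proof. by move=> z; apply: (@continuous_min _ _ f g); [exact: cf|exact: cg]. Qed.

End RealFunctions.

Lemma continuous_comp_fun (X Y Z : topologicalType) (f : X -> Y) (g : Y -> Z) :
  continuous f -> continuous g -> continuous (fun x => g (f x)).
Proof. by move=> cf cg x; apply: (continuous_comp (cf x)); exact: cg. Qed.

Lemma continuous_fst (X Y : topologicalType) : continuous (fun z : X * Y => z.1).
Proof. by move=> z; exact: cvg_fst. Qed.

Lemma continuous_snd (X Y : topologicalType) : continuous (fun z : X * Y => z.2).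
Proof. by move=> z; exact: cvg_snd. Qed.

Section Clamp.
Context {R : realType}.

(** Retraction of the line onto the unit interval. Clamping parameters lets paths and homotopies be
    total continuous functions on [R], so that no subspace topology on an interval enters. *)
Definition clamp (x : R) : R := Num.min (Num.max 0 x) 1.

Lemma clamp_ge0 x : 0 <= clamp x.
Proof. by rewrite /clamp le_min ler01 le_max lexx. Qed.

Lemma clamp_le1 x : clamp x <= 1.
Proof. by rewrite /clamp ge_min lexx orbT. Qed.

Lemma clamp_id x : 0 <= x <= 1 -> clamp x = x.
Proof. by move=> /andP[x0 x1]; rewrite /clamp max_r// min_l. Qed.

Lemma clamp_le x : x <= 0 -> clamp x = 0.
Proof. by move=> x0; rewrite /clamp max_l// min_l. Qed.

Lemma clamp_ge x : 1 <= x -> clamp x = 1.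
Proof. by move=> x1; rewrite /clamp min_r// le_max x1 orbT. Qed.

Lemma continuous_clamp (Z : topologicalType) (f : Z -> R) :
  continuous f -> continuous (fun z => clamp (f z)).
Proof.
move=> cf z; apply: (@continuous_min _ _ (fun z => Num.max 0 (f z)) (fun=> 1)).
  by apply: (@continuous_max _ _ (fun=> 0) f); [exact: cvg_cst|exact: cf].
exact: cvg_cst.
Qed.

End Clamp.

(** * Continuity of maps from and to a realization; parametrized triangles *)

Section RealizationTheory.
Context {R : realType} {T : choiceType} {X : simplicial_complex T}.
Local Notation "|X|" := (realization R X).
Local Notation PT := (prod_topology (fun _ : T => R)).

Lemma realization_inj (x y : |X|) : (forall v, coordinates x v = coordinates y v) -> x = y.
Proof. by move=> xy; apply: val_inj; apply: funext. Qed.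

Lemma carrier (x : |X|) : exists2 s, simplices X s & closed_simplex s (coordinates x).
Proof. by have := valP x; rewrite inE => -[s Xs xs]; exists s. Qed.

Lemma coordinate_continuous (v : T) : continuous (fun c : PT => c v).
Proof. exact: (@proj_continuous _ (fun=> R) v). Qed.

Lemma realization_open_carrier (U : set |X|) :
  (forall s, simplices X s -> exists2 W : set PT, open W &
    forall x, closed_simplex s (coordinates x) -> U x <-> W (coordinates x)) ->
  open U.
Proof.
move=> oU; suff : realization_open U by [].
move=> s Xs; have [W oW UW] := oU s Xs; exists W => //.
by apply/seteqP; split=> x /= [? xs]; split => //; apply/UW.
Qed.

(** On one closed simplex, the points whose whole track over a compact [J] stays in [W] are cut out
    by the open set that [open_tube] provides for [F]; the weak topology asks for no more. *)
Lemma continuous_realizationR (Y : topologicalType) (H : |X| * R -> Y) :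
  (forall s, simplices X s -> exists2 F : PT * R -> Y, continuous F &
     forall x t, closed_simplex s (coordinates x) -> H (x, t) = F (coordinates x, t)) ->
  continuous H.
Proof.
move=> HF; apply: continuous_prodR => [x|J W cJ oW].
  have [s Xs xs] := carrier x; have [F cF HE] := HF s Xs.
  rewrite (_ : (fun t => _) = (fun t => F (coordinates x, t))); last first.
    by apply/funext => t; rewrite HE.
  move=> t; apply: (@continuous_comp _ _ _ (fun t => (coordinates x, t)) F);
    last exact: cF.
  by apply: continuous_pair => ?; [exact: cvg_cst|exact: cvg_id].
apply: realization_open_carrier => s Xs; have [F cF HE] := HF s Xs.
exists [set c | forall t, J t -> W (F (c, t))]; first exact: (open_tube cF cJ oW).
by move=> x xs; split => /= + t Jt => /(_ t Jt); rewrite HE.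
Qed.

Lemma continuous_realization (Y : topologicalType) (h : |X| -> Y) :
  (forall s, simplices X s -> exists2 F : PT -> Y, continuous F &
     forall x, closed_simplex s (coordinates x) -> h x = F (coordinates x)) ->
  continuous h.
Proof.
move=> hF; apply/continuousP => W oW; apply: realization_open_carrier => s Xs.
have [F cF hE] := hF s Xs; exists (F @^-1` W) => [|x xs /=]; last by rewrite hE.
by move/continuousP : cF; exact.
Qed.

(** On a single closed simplex the weak topology is that of pointwise convergence, so coordinatewise
    continuity is enough there. *)
Lemma continuous_to_realization (Z : topologicalType) (s : {fset T}) (h : Z -> |X|) :
  simplices X s -> (forall z, closed_simplex s (coordinates (h z))) ->
  (forall v, continuous (fun z => coordinates (h z) v)) -> continuous h.
Proof.
move=> Xs hs ch; apply/continuousP => U oU; have [W oW UW] := (oU : realization_open U) s Xs.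
have -> : h @^-1` U = (fun z => coordinates (h z)) @^-1` W.
  apply/seteqP; split=> z /= Uz.
    suff : (@coordinates R T X @^-1` (W `&` closed_simplex s)) (h z) by case.
    by rewrite -UW; split => //=; exact: hs.
  suff : (U `&` @coordinates R T X @^-1` closed_simplex s) (h z) by case.
  by rewrite UW; split => //=; exact: hs.
apply: open_comp => // z _.
apply/cvg_sup => v A; rewrite nbhsE => -[B [[C oC <-] Cz] CA].
apply: (filterS CA); apply: (ch v z C).
exact: open_nbhs_nbhs.
Qed.

(** Repetitions are allowed: [face X x x y] is an edge and [face X x x x] a vertex, so [tri]
    parametrizes those as well. *)
Definition face x y z := simplices X [fset x; y; z]%fset.

(** Weight [a] at [y], weight [b] at [z], the rest at [x]. Truncating [b] at one minus the weight of
    [y] gives barycentric coordinates for all real [a] and [b]. *)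
Definition barycenter (x y z : T) (a b : R) : T -> R := fun v =>
  (1 - clamp a - Num.min (clamp b) (1 - clamp a)) * (v == x)%:R +
  clamp a * (v == y)%:R + Num.min (clamp b) (1 - clamp a) * (v == z)%:R.

Lemma sum_indicator (s : {fset T}) (x : T) :
  x \in s -> \sum_(v <- s) (v == x)%:R = 1 :> R.
Proof.
move=> xs; rewrite (big_fsetD1 x xs) /= eqxx big_seq big1 ?addr0// => v.
by rewrite !inE => /andP[/negPf ->].
Qed.

Lemma barycenter_in x y z a b s : x \in s -> y \in s -> z \in s ->
  closed_simplex s (barycenter x y z a b).
Proof.
move=> xs ys zs; have := clamp_ge0 a; have := clamp_le1 a.
have := clamp_ge0 b; have := clamp_le1 b; rewrite /barycenter.
set a' := clamp a; set b' := clamp b => b1 b0 a1 a0.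
have m0 : 0 <= Num.min b' (1 - a') by rewrite le_min b0 subr_ge0.
have m1 : Num.min b' (1 - a') <= 1 - a' by rewrite ge_min lexx orbT.
split.
- move=> v; rewrite !addr_ge0// mulr_ge0//; lra.
- move=> v vs; have -> : (v == x) = false by apply: contraNF vs => /eqP ->.
  have -> : (v == y) = false by apply: contraNF vs => /eqP ->.
  have -> : (v == z) = false by apply: contraNF vs => /eqP ->.
  by rewrite !mulr0 !addr0.
- rewrite !big_split /= -!mulr_sumr !sum_indicator//; ring.
Qed.

Definition tri x y z (f : face x y z) (ab : R * R) : |X|.
Proof.
exists (barycenter x y z ab.1 ab.2); rewrite inE; exists [fset x; y; z]%fset => //.
by apply: barycenter_in; rewrite !inE eqxx ?orbT.
Defined.

Lemma coordinates_tri x y z (f : face x y z) ab :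
  coordinates (tri f ab) = barycenter x y z ab.1 ab.2.
Proof. by []. Qed.

Lemma tri_in x y z (f : face x y z) ab :
  closed_simplex [fset x; y; z]%fset (coordinates (tri f ab)).
Proof. by apply: barycenter_in; rewrite !inE eqxx ?orbT. Qed.

Lemma continuous_tri x y z (f : face x y z) : continuous (tri f).
Proof.
apply: (continuous_to_realization f); first exact: tri_in.
move=> v; rewrite /= /barycenter => ab.
have c1 : {for ab, continuous (fun ab : R * R => clamp ab.1)}.
  by apply: continuous_clamp => ?; exact: cvg_fst.
have c2 : {for ab, continuous (fun ab : R * R => clamp ab.2)}.
  by apply: continuous_clamp => ?; exact: cvg_snd.
have c3 : {for ab, continuous (fun ab : R * R => 1 - clamp ab.1)}.
  by apply: cvgB => //; exact: cvg_cst.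
have c4 : {for ab, continuous
    (fun ab : R * R => Num.min (clamp ab.2) (1 - clamp ab.1))}.
  exact: (@continuous_min _ _ (fun ab : R * R => clamp ab.2)
    (fun ab => 1 - clamp ab.1)).
apply: cvgD; [apply: cvgD|]; apply: cvgM; try exact: cvg_cst.
- exact: cvgB.
- exact: c1.
- exact: c4.
Qed.

End RealizationTheory.

Arguments face {T} X x y z.

Section TrianglePoints.
Context {R : realType} {T : choiceType} {X : simplicial_complex T}.
Local Notation "|X|" := (realization R X).

Lemma closed_simplex_sum (s t : {fset T}) (c : T -> R) :
  (s `<=` t)%fset -> closed_simplex s c -> \sum_(v <- t) c v = 1.
Proof.
move=> st [_ c0 <-]; rewrite (big_fsetID _ (mem s)) /=.
rewrite [X in _ + X]big1_fset ?addr0; last first.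
  by move=> v; rewrite !inE => /andP[_ /c0].
by apply: eq_fbigl => v; rewrite !inE /= andb_idl// => /(fsubsetP st).
Qed.

Lemma closed_simplexS (s t : {fset T}) (c : T -> R) :
  (s `<=` t)%fset -> closed_simplex s c -> closed_simplex t c.
Proof.
move=> st cs; split; [by case: cs | | exact: closed_simplex_sum cs].
by move=> v vt; case: cs => _ c0 _; apply: c0; apply: contra vt => /(fsubsetP st).
Qed.

Lemma tri_eq x y z (f : face X x y z) (w : |X|) : x != y -> x != z -> y != z ->
  closed_simplex [fset x; y; z]%fset (coordinates w) ->
  tri f (coordinates w y, coordinates w z) = w.
Proof.
move=> xy xz yz ws; have ws' := ws; move: ws' => [w0 wN].
rewrite fsetUC big_fsetU1 ?inE; last by rewrite negb_or eq_sym xz eq_sym yz.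
rewrite big_fsetU1 ?inE// big_seq_fset1 => /= w1.
have [wx wy wz] := And3 (w0 x) (w0 y) (w0 z).
apply: realization_inj => v; rewrite coordinates_tri /barycenter /=.
rewrite !clamp_id; try lra.
rewrite min_l; last lra.
have [->|vx] := eqVneq v x; first by rewrite (negPf xy) (negPf xz) /=; lra.
have [->|vy] := eqVneq v y; first by rewrite (negPf yz) /=; lra.
have [->|vz] := eqVneq v z; first by rewrite /=; lra.
by rewrite [RHS]wN ?inE ?negb_or ?vx ?vy ?vz//=; lra.
Qed.

Lemma seg_eq x y (f : face X x x y) (w : |X|) : x != y ->
  closed_simplex [fset x; x; y]%fset (coordinates w) ->
  tri f (0, coordinates w y) = w.
Proof.
move=> xy ws; have ws' := ws; move: ws' => [w0 wN].
rewrite fsetUid big_fsetU1 ?inE// big_seq_fset1 => /= w1.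
have [wx wy] := (w0 x, w0 y).
apply: realization_inj => v; rewrite coordinates_tri /barycenter /=.
rewrite !clamp_id; try lra.
rewrite min_l; last lra.
have [->|vx] := eqVneq v x; first by rewrite (negPf xy) /=; lra.
have [->|vy] := eqVneq v y; first by rewrite /=; lra.
by rewrite [RHS]wN ?inE ?negb_or ?vx ?vy//=; lra.
Qed.

Lemma tri_vertex x y z (f : face X x y z) y' z' (f' : face X x y' z') :
  tri f (0, 0) = tri f' (0, 0) :> |X|.
Proof.
apply: realization_inj => v; rewrite !coordinates_tri /barycenter /=.
by rewrite !clamp_le// subr0 min_l// !mul0r.
Qed.

Lemma tri_vertex2 x y z (f : face X x y z) y' z' (f' : face X y y' z') :
  tri f (1, 0) = tri f' (0, 0) :> |X|.
Proof.
apply: realization_inj => v; rewrite !coordinates_tri /barycenter /=.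
rewrite (@clamp_le _ 0)// (@clamp_ge _ 1)// subrr subr0 min_l// min_l//; lra.
Qed.

Lemma tri_vertex3 x y z (f : face X x y z) y' z' (f' : face X z y' z') :
  tri f (0, 1) = tri f' (0, 0) :> |X|.
Proof.
apply: realization_inj => v; rewrite !coordinates_tri /barycenter /=.
rewrite (@clamp_le _ 0)// (@clamp_ge _ 1)// !subr0 min_l// min_l//; lra.
Qed.

Lemma carrier_vertex (s : {fset T}) (x : |X|) : closed_simplex s (coordinates x) ->
  exists2 v, v \in s & coordinates x v != 0.
Proof.
move=> [_ _ x1]; apply/not_exists2P => xN.
have : \sum_(v <- s) coordinates x v = 0.
  rewrite big_seq big1// => v vs; apply/eqP; apply: contrapT => /negP xv.
  by case: (xN v).
by rewrite x1 => /eqP; rewrite oner_eq0.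
Qed.

End TrianglePoints.

(** * Connected and disconnected realizations *)

Section Connectedness.
Context {R : realType} {T : choiceType} {X : simplicial_complex T}.
Local Notation "|X|" := (realization R X).

(** Lying in a common connected set suffices for connectedness, and concatenation is just a
    union. *)
Definition joined (x y : |X|) := exists2 C, connected C & C x /\ C y.

Lemma joined_trans y x z : joined x y -> joined y z -> joined x z.
Proof.
move=> [C cC [Cx Cy]] [D cD [Dy Dz]]; exists (C `|` D); last by split; [left|right].
by apply: connectedU => //; exists y.
Qed.

Lemma joined_simplex (s : {fset T}) (x y : |X|) : simplices X s ->
  closed_simplex s (coordinates x) -> closed_simplex s (coordinates y) ->
  joined x y.
Proof.
move=> Xs [x0 xN x1] [y0 yN y1].
pose c (t : R) v := (1 - clamp t) * coordinates x v + clamp t * coordinates y v.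
have cs t : closed_simplex s (c t).
  have [t0 t1] := (clamp_ge0 t, clamp_le1 t); split.
  - by move=> v; rewrite addr_ge0// mulr_ge0// subr_ge0.
  - by move=> v vs; rewrite /c xN// yN// !mulr0 addr0.
  - by rewrite big_split /= -!mulr_sumr x1 y1; ring.
have cX t : c t \in \bigcup_(s in simplices X) closed_simplex s.
  by rewrite inE; exists s.
pose h t : |X| := exist _ (c t) (cX t).
have ch : continuous h.
  apply: (continuous_to_realization Xs) => // v t; apply: cvgD; apply: cvgM.
  - apply: cvgB; first exact: cvg_cst.
    by apply: continuous_clamp => ?; exact: cvg_id.
  - exact: cvg_cst.
  - by apply: continuous_clamp => ?; exact: cvg_id.
  - exact: cvg_cst.
exists (h @` setT).
  apply: connected_continuous_connected; last exact: continuous_subspaceT.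
  by apply/connected_intervalP.
split; [exists 0 => // | exists 1 => //]; apply: realization_inj => v.
  by rewrite /= /coordinates /= /c clamp_le//; rewrite subr0 mul1r mul0r addr0.
by rewrite /= /coordinates /= /c clamp_ge//; rewrite subrr mul1r mul0r add0r.
Qed.

Lemma connected_joined : (forall x y : |X|, joined x y) -> connected [set: |X|].
Proof.
move=> j; have [->|/set0P[x _]] := eqVneq [set: |X|] set0; first exact: connected0.
have /choice[C CE] : forall y, exists C, [/\ connected C, C x & C y].
  by move=> y; have [C ? []] := j x y; exists C.
rewrite (_ : setT = \bigcup_(y in setT) C y).
  by apply: bigcup_connected => [|y _]; [exists x => y _|]; have [] := CE y.
by apply/seteqP; split => y // _; exists y => //; have [] := CE y.
Qed.

(* The points carried by the vertices of S form a clopen set. *)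
Lemma disconnected_realization (S : set T) (u v : T) :
  simplices X [fset u]%fset -> simplices X [fset v]%fset -> S u -> ~ S v ->
  (forall s x y, simplices X s -> x \in s -> y \in s -> S x -> S y) ->
  ~ connected [set: |X|].
Proof.
move=> Xu Xv Su Sv Ss cX.
pose B : set |X| := [set x | exists2 w, S w & coordinates x w != 0].
(* The vertices of a simplex are all in [S] or all outside, so [B] contains a closed simplex or
   misses it; this makes both [B] and its complement open. *)
have Bs s : simplices X s ->
    (forall x, closed_simplex s (coordinates x) -> B x) \/
    (forall x, closed_simplex s (coordinates x) -> ~ B x).
  move=> Xs; have [[w ws Sw]|wN] := pselect (exists2 w, w \in s & S w).
    left=> x /carrier_vertex[y ys xy]; exists y => //.
    exact: (Ss s w).
  right=> x [_ x0 _] [w Sw]; rewrite x0 ?eqxx//.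
  by apply/negP => ws; apply: wN; exists w.
have pt w : simplices X [fset w]%fset ->
    exists2 x : |X|, coordinates x w != 0 &
      closed_simplex [fset w]%fset (coordinates x).
  move=> Xw; have f : face X w w w by rewrite /face !fsetUid.
  exists (tri f (0, 0)); last by have := tri_in f (0, 0); rewrite !fsetUid.
  by rewrite coordinates_tri /barycenter /= eqxx clamp_le// subr0 min_l// subr0
    !mul0r !addr0 mulr1 oner_eq0.
have [x xu _] := pt u Xu; have [y yv [_ y0 _]] := pt v Xv.
have : B = setT.
  apply: cX.
  - by exists x; exists u.
  - exists B; last by rewrite setTI.
    apply: realization_open_carrier => s /Bs[] sB; [exists setT|exists set0] => //.
    + exact: openT.
    + by move=> z /sB.
    + exact: open0.
    + by move=> z /sB.
  - exists B; last by rewrite setTI.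
    rewrite -openC.
    apply: realization_open_carrier => s /Bs[] sB; [exists set0|exists setT] => //.
    + exact: open0.
    + by move=> z /sB Bz; split.
    + exact: openT.
    + by move=> z /sB.
move/seteqP => [_ /(_ y I)] [w Sw]; have [wv|wv] := eqVneq w v.
  by move: Sw; rewrite wv.
by rewrite y0 ?inE// eqxx.
Qed.

End Connectedness.

(** Consecutive vertices of a walk share an edge, and every point shares a simplex with some
    vertex. *)
Lemma connected_clique_complex {R : realType} {T : choiceType} (e : rel T) :
  (forall x y, exists p, path e x p /\ last x p = y) -> symmetric e ->
  connected [set: realization R (clique_complex e)].
Proof.
move=> conn se; set X := clique_complex e.
have Xv u : simplices X [fset u]%fset.
  split; first by apply/fset0Pn; exists u; rewrite inE.
  by move=> x y; rewrite !inE => /eqP -> /eqP ->; rewrite eqxx.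
have Xe u v : e u v -> simplices X [fset u; v]%fset.
  move=> uv; split; first by apply/fset0Pn; exists u; rewrite !inE eqxx.
  move=> x y; rewrite !inE => /orP[]/eqP -> /orP[]/eqP ->; rewrite ?eqxx//.
  by rewrite se.
have f u : face X u u u by rewrite /face !fsetUid.
pose vert u : realization R X := tri (f u) (0, 0).
have vertP u : closed_simplex [fset u]%fset (coordinates (vert u)).
  by have := tri_in (R := R) (f u) (0, 0); rewrite !fsetUid.
have jv u v : joined (vert u) (vert v).
  have [p []] := conn u v; elim: p u => [|w p IH] u /=.
    by move=> _ ->; apply: (joined_simplex (Xv v)).
  move=> /andP[uw wp] pv; apply: joined_trans (IH _ wp pv).
  apply: (joined_simplex (Xe _ _ uw)); apply: closed_simplexS (vertP _);
  by apply/fsubsetP => z; rewrite !inE => ->; rewrite ?orbT.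
have jx x : exists u, joined x (vert u) /\ joined (vert u) x.
  have [s Xs xs] := carrier x; have [u us _] := carrier_vertex xs.
  have us' : closed_simplex s (coordinates (vert u)).
    by apply: closed_simplexS (vertP u); rewrite fsub1set.
  by exists u; split; apply: (joined_simplex Xs).
apply: connected_joined => x y; have [u [xu _]] := jx x; have [v [_ vy]] := jx y.
exact: joined_trans xu (joined_trans (jv u v) vy).
Qed.

Lemma bijection_card_eq (A B : Type) (f : A -> B) :
  injective f -> (forall y, exists x, f x = y) -> [set: A] #= [set: B].
Proof.
move=> fi fs; have -> : [set: B] = f @` setT.
  by apply/seteqP; split=> y // _; have [x <-] := fs y; exists x.
by rewrite card_eq_sym; apply: inj_card_eq => x y _ _; exact: fi.
Qed.

Section GlobalHomotopies.
Context {R : realType} {X Y : topologicalType}.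

(** Time runs over the whole line, so that continuity is that of a map on a product; only the times
    0 and 1 are constrained. *)
Definition homotopicR (f g : X -> Y) := exists2 H : X * R -> Y, continuous H &
  (forall x, H (x, 0) = f x) /\ (forall x, H (x, 1) = g x).

Lemma homotopicR_homotopic f g : homotopicR f g -> homotopic R f g.
Proof. by move=> [H cH [H0 H1]]; exists H; split=> //; exact: continuous_subspaceT. Qed.

Lemma homotopicR_trans g f h : homotopicR f g -> homotopicR g h -> homotopicR f h.
Proof.
move=> [H cH [H0 H1]] [G cG [G0 G1]].
have c2 (c : R) : continuous (fun z : X * R => (z.1, 2 * z.2 - c)).
  apply: continuous_pair => z; first exact: cvg_fst.
  apply: cvgB; last exact: cvg_cst.
  by apply: cvgM; [exact: cvg_cst|exact: cvg_snd].
exists (fun z : X * R => if z.2 - 2^-1 <= 0 then H (z.1, 2 * z.2 - 0)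
                         else G (z.1, 2 * z.2 - 1)).
  apply: continuous_paste.
  - by move=> z; apply: cvgB; [exact: cvg_snd|exact: cvg_cst].
  - by move=> z; apply: (continuous_comp (c2 0 z)); exact: cH.
  - by move=> z; apply: (continuous_comp (c2 1 z)); exact: cG.
  - move=> [x t] /= /eqP; rewrite subr_eq0 => /eqP ->.
    by rewrite mulfV// subr0 subrr H1 G0.
split => x /=.
  by rewrite mulr0 subr0 sub0r oppr_le0 invr_ge0 ler0n H0.
rewrite mulr1 ifF; last by apply/negbTE; rewrite -ltNge; lra.
by rewrite (_ : 2 - 1 = 1) ?G1//; lra.
Qed.

End GlobalHomotopies.
Arguments homotopicR R {X Y} f g.

(** * Disjoint unions of edges *)

Section DisjointEdges.
Context {R : realType} {T : choiceType} {X : simplicial_complex T} (sigma : T -> T).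
Hypothesis sigmaK : involutive sigma.
Hypothesis sigma_neq : forall x, sigma x != x.
Hypothesis simplicesE : forall s : {fset T}, simplices X s <->
  s != fset0 /\ exists x, (s `<=` [fset x; sigma x])%fset.
Local Notation "|X|" := (realization R X).

(** [choose] returns the same element from any starting point satisfying the predicate, so both ends
    of an edge get the same representative. *)
Let edge_rep x := choose (fun y => (y == x) || (y == sigma x)) x.

Let edge_repP x : edge_rep x = x \/ edge_rep x = sigma x.
Proof.
have := @chooseP _ (fun y => (y == x) || (y == sigma x)) x; rewrite eqxx.
by move=> /(_ isT) /orP[] /eqP; [left|right].
Qed.

Let edge_rep_sigma x : edge_rep (sigma x) = edge_rep x.
Proof.
rewrite /edge_rep (@eq_choose _ _ (fun y => (y == x) || (y == sigma x))).
  by apply: choose_id; rewrite eqxx ?orbT.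
by move=> y; rewrite sigmaK orbC.
Qed.

Let edge_repK x : edge_rep (edge_rep x) = edge_rep x.
Proof. by have [e|e] := edge_repP x; rewrite {1}e ?edge_rep_sigma. Qed.

Let D : choiceType := {x : T | edge_rep x == x}.

Let rep x : D := exist (fun x => is_true (edge_rep x == x)) (edge_rep x)
  (introT eqP (edge_repK x)).

(** The boolean tells which end of the edge is meant; the two ends differ because [sigma] has no
    fixed point. *)
Lemma card_edge_reps : [set: D * bool] #= [set: T].
Proof.
apply: (@bijection_card_eq _ _
  (fun db : D * bool => if db.2 then val db.1 else sigma (val db.1)))
  => [[d b] [d' b']|x].
  have rd (c : D) : edge_rep (val c) = val c by exact/eqP/(valP c).
  have dd (u v : D) : val u <> sigma (val v).
    move=> uv; have := rd u; rewrite uv edge_rep_sigma rd => vv.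
    by have := sigma_neq (val v); rewrite -vv eqxx.
  case: b b' => -[] /= E.
  - by rewrite (val_inj E).
  - by case: (dd _ _ E).
  - by case: (dd d' d).
  - by rewrite (val_inj (can_inj sigmaK E)).
have [e|e] := edge_repP x.
  by exists (rep x, true).
by exists (rep x, false) => //=; rewrite e sigmaK.
Qed.

Lemma disjoint_edges_discrete : exists D : choiceType,
  homotopy_equivalent R |X| (discrete_topology D) /\ [set: D * bool] #= [set: T].
Proof.
exists D; split; last exact: card_edge_reps.
have f_ d : face X d d (sigma d).
  rewrite /face fsetUid; apply/simplicesE; split; last by exists d.
  by apply/fset0Pn; exists d; rewrite !inE eqxx.
have sP s : simplices X s -> exists d : D, (s `<=` [fset val d; sigma (val d)])%fset.
  move=> /simplicesE [_ [x sx]]; exists (rep x).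
  apply: fsubset_trans sx _; apply/fsubsetP => v; rewrite !inE /=.
  by have [->|->] := edge_repP x; rewrite ?sigmaK// orbC.
have f0P (x : |X|) : exists d : D,
    closed_simplex [fset val d; val d; sigma (val d)]%fset (coordinates x).
  have [s Xs xs] := carrier x; have [d sd] := sP s Xs; exists d.
  by apply: closed_simplexS xs; rewrite fsetUid.
pose f (x : |X|) : D := projT1 (cid (f0P x)).
have fP x : closed_simplex [fset val (f x); val (f x); sigma (val (f x))]%fset
    (coordinates x) by exact: projT2 (cid (f0P x)).
(* Any vertex with nonzero coordinate lies on both edges in question, and its [edge_rep] identifies
   each of them. *)
have fE s (d : D) x : (s `<=` [fset val d; sigma (val d)])%fset ->
    closed_simplex s (coordinates x) -> f x = d.
  move=> sd xs; have [v vs xv] := carrier_vertex xs.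
  have vf : v \in [fset val (f x); sigma (val (f x))]%fset.
    apply: contraNT xv => vf; have [_ x0 _] := fP x.
    by rewrite x0// fsetUid.
  move/fsubsetP : sd => /(_ v vs).
  have rv (e : D) : v \in [fset val e; sigma (val e)]%fset -> edge_rep v = val e.
    have /eqP re := valP e.
    by rewrite !inE => /orP[] /eqP ->; rewrite ?edge_rep_sigma.
  by move=> /rv vd; apply: val_inj; rewrite -vd -(rv _ vf).
exists f, (fun d => tri (f_ (val d)) (0, 0)); split.
- apply: continuous_realization => s /sP[d sd].
  exists (fun=> d); last by move=> x xs; rewrite (fE s d x sd xs).
  exact: cst_continuous.
- by apply/continuousP => W _; exact: discrete_open.
(* Scaling the coordinate at the other end moves from the representative vertex at time 0 to the
   point itself at time 1. *)
- apply: homotopicR_homotopic; exists (fun z : |X| * R =>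
    tri (f_ (val (f z.1))) (0, clamp z.2 * coordinates z.1 (sigma (val (f z.1))))).
    apply: continuous_realizationR => s /sP[d sd].
    exists (fun z : prod_topology (fun _ : T => R) * R =>
      tri (f_ (val d)) (0, clamp z.2 * z.1 (sigma (val d)))).
      have cc : continuous (fun z : prod_topology (fun _ : T => R) * R =>
          clamp z.2 * z.1 (sigma (val d))).
        apply: continuousM_fun.
          exact: (continuous_clamp (@continuous_snd _ _)).
        exact: (continuous_comp_fun (@continuous_fst _ _) (@coordinate_continuous _ _ _)).
      have c2 := continuous_pair (@cst_continuous _ _ (0 : R)) cc.
      by move=> z; apply: (continuous_comp (c2 z)); exact: continuous_tri.
    by move=> x t xs /=; rewrite (fE s d).
  split=> x /=; first by rewrite clamp_le// mul0r.
  by rewrite clamp_ge// mul1r; apply: seg_eq (fP x); rewrite eq_sym.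
- apply: homotopicR_homotopic; exists fst => [z|]; first exact: cvg_fst.
  split=> d //=; apply/esym/(@fE [fset val d; val d; sigma (val d)]%fset).
    by rewrite fsetUid.
  exact: tri_in.
Qed.

End DisjointEdges.

(** * A loop around the circle and its inverse *)

Section CircleParametrization.
Context {R : realType}.

(* The first summand of the second coordinate vanishes on [1/2, 1], the other *)
(* one on [0, 1/2], since Num.sqrt is 0 on negative numbers.                  *)
Definition loop_point (s : R) : R * R :=
  (`|4 * clamp s - 2| - 1,
   Num.sqrt (1 - (4 * clamp s - 1) ^+ 2) - Num.sqrt (1 - (4 * clamp s - 3) ^+ 2)).

Lemma loop_pointP s : circle_set (loop_point s).
Proof.
rewrite /circle_set /loop_point /=; set c := clamp s.
have := clamp_ge0 s; have := clamp_le1 s; rewrite -/c => c1 c0.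
have [c2|c2] := lerP (2 * c) 1.
  rewrite [Num.sqrt (1 - (4 * c - 3) ^+ 2)]ler0_sqrtr; last nra.
  rewrite subr0 sqr_sqrtr; last nra.
  by rewrite ler0_norm; [ring|lra].
rewrite [Num.sqrt (1 - (4 * c - 1) ^+ 2)]ler0_sqrtr; last nra.
rewrite sub0r sqrrN sqr_sqrtr; last nra.
by rewrite ger0_norm; [ring|lra].
Qed.

Definition loop (s : R) : circle R := SigSub (mem_set (loop_pointP s)).

Lemma continuous_loop : continuous loop.
Proof.
have ck k : continuous (fun s : R => 4 * clamp s - k).
  apply: continuousB_fun; last exact: cst_continuous.
  apply: continuousM_fun; first exact: cst_continuous.
  by apply: continuous_clamp => ?; exact: cvg_id.
have cs k : continuous (fun s : R => Num.sqrt (1 - (4 * clamp s - k) ^+ 2)).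
  apply: continuous_comp_fun; last exact: sqrt_continuous.
  apply: continuousB_fun; first exact: cst_continuous.
  by apply: continuousM_fun; exact: ck.
have cl : continuous loop_point.
  apply: continuous_pair; last exact: continuousB_fun.
  apply: continuousB_fun; last exact: cst_continuous.
  by apply: continuous_comp_fun; [exact: ck|exact: norm_continuous].
by apply/continuousP => U [V oV <-]; move/continuousP : cl; exact.
Qed.

Lemma loop0 : loop 0 = circle_base R.
Proof.
apply: val_inj; rewrite /= /loop_point clamp_le// mulr0 !sub0r normrN.
rewrite !sqrrN expr1n subrr sqrtr0 ler0_sqrtr; last lra.
by rewrite subrr ger0_norm; [congr pair; lra|lra].
Qed.

Lemma loop1 : loop 1 = circle_base R.
Proof.
apply: val_inj; rewrite /= /loop_point clamp_ge// mulr1.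
rewrite ler0_sqrtr; last lra.
rewrite ler0_sqrtr; last lra.
by rewrite ger0_norm; [congr pair; lra|lra].
Qed.

(** Not an angle in the usual sense: on each half circle it is affine in the first coordinate. The
    base point gets the value 1, and there alone the function jumps. *)
Definition angle (z : circle R) : R :=
  if (val z).2 <= 0 then (3 + (val z).1) / 4 else (1 - (val z).1) / 4.

Lemma circleP (z : circle R) : (val z).1 ^+ 2 + (val z).2 ^+ 2 = 1.
Proof. by have := valP z; rewrite inE. Qed.

Lemma angle_itv z : 0 <= angle z <= 1.
Proof. by have := circleP z; rewrite /angle; case: ifP => _ zP; apply/andP; split; nra. Qed.

Lemma loop_angle z : loop (angle z) = z.
Proof.
apply: val_inj; rewrite /= /loop_point clamp_id ?angle_itv//.
have := circleP z; rewrite /angle; case: z => [[x y] zP] /= xy.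
case: lerP => y0; congr pair.
- by rewrite ger0_norm; [lra|nra].
- rewrite ler0_sqrtr; last nra.
  rewrite (_ : 1 - _ = y ^+ 2); last by lra.
  by rewrite sqrtr_sqr ler0_norm//; lra.
- by rewrite ler0_norm; [lra|nra].
- rewrite [X in _ - X]ler0_sqrtr; last nra.
  rewrite (_ : 1 - _ = y ^+ 2); last by lra.
  by rewrite sqrtr_sqr gtr0_norm//; lra.
Qed.

(** [angle] inverts [loop] except at [s = 0], where it gives 1; a function with equal values at 0
    and 1 does not see the difference. *)
Lemma angle_loop (s : R) (A : Type) (phi : R -> A) : phi 0 = phi 1 ->
  0 <= s <= 1 -> phi (angle (loop s)) = phi s.
Proof.
move=> phi01 s01; have [->|s0] := eqVneq s 0.
  by rewrite loop0 /angle /= lexx (_ : (3 + 1) / 4 = 1) ?phi01//; lra.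
congr phi; rewrite /angle /= clamp_id//; case/andP: s01 => s0' s1.
have {s0 s0'}s0 : 0 < s by rewrite lt_neqAle eq_sym s0.
have [s2|s2] := ltrP (2 * s) 1.
  rewrite [Num.sqrt (1 - (4 * s - 3) ^+ 2)]ler0_sqrtr; last nra.
  rewrite subr0 leNgt sqrtr_gt0 ifF; last by apply/negbTE; rewrite negbK; nra.
  by rewrite ler0_norm; [field|lra].
rewrite [Num.sqrt (1 - (4 * s - 1) ^+ 2)]ler0_sqrtr; last nra.
by rewrite sub0r oppr_le0 sqrtr_ge0 ger0_norm; [field|lra].
Qed.

(** The two formulas for [angle] meet where the second coordinate is 0: at [(-1, 0)] both give 1/2,
    at the base point they give 1 and 0, which [phi] identifies. *)
Lemma continuous_angle (Y : topologicalType) (phi : R * R -> Y) :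
  continuous phi -> (forall t, phi (0, t) = phi (1, t)) ->
  continuous (fun z : circle R * R => phi (angle z.1, z.2)).
Proof.
move=> cphi phi01.
have cv : continuous (fun z : circle R * R => val z.1).
  apply: (continuous_comp_fun (@continuous_fst _ _)).
  exact: initial_continuous.
have c1 := continuous_comp_fun cv (@continuous_fst _ _).
have c2 := continuous_comp_fun cv (@continuous_snd _ _).
rewrite (_ : (fun z => _) = fun z : circle R * R => if (val z.1).2 <= 0
    then phi ((3 + (val z.1).1) / 4, z.2) else phi ((1 - (val z.1).1) / 4, z.2));
    last first.
  by apply/funext => z; rewrite /angle; case: ifP.
apply: continuous_paste => //.
- apply: continuous_comp_fun cphi; apply: continuous_pair; last exact: continuous_snd.
  apply: continuousM_fun; last exact: cst_continuous.
  by apply: continuousD_fun c1; exact: cst_continuous.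
- apply: continuous_comp_fun cphi; apply: continuous_pair; last exact: continuous_snd.
  apply: continuousM_fun; last exact: cst_continuous.
  by apply: continuousB_fun c1; exact: cst_continuous.
move=> [z t] /= z0; have /eqP := circleP z; rewrite z0 expr0n addr0 sqrf_eq1.
move=> /orP[] /eqP ->.
  by rewrite subrr mul0r (_ : (3 + 1) / 4 = 1) ?phi01//; lra.
by congr (phi (_, _)); lra.
Qed.

End CircleParametrization.

Section WedgeHomotopies.
Context {R : realType} {I : choiceType}.
Local Notation wedgeI := (wedge_of_circles R I).

Definition wedge_circle (i : I) : circle R -> wedgeI := @wedge_lift I _ (fun=> circle_base R) i.

Lemma continuous_wedge_circle i : continuous (wedge_circle i).
Proof. exact: (@wedge_lift_continuous I (fun=> circle R) (fun=> circle_base R) i). Qed.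

(** A family of moving loops with one common track of the base point descends to the wedge; openness
    in the wedge is tested circle by circle, with [open_tube] on each. *)
Lemma continuous_wedgeR (Y : topologicalType) (phi : I -> R * R -> Y) :
  (forall i, continuous (phi i)) -> (forall i t, phi i (0, t) = phi i (1, t)) ->
  (forall i j t, phi i (1, t) = phi j (1, t)) ->
  exists2 H : wedgeI * R -> Y, continuous H &
    forall i z t, H (wedge_circle i z, t) = phi i (angle z, t).
Proof.
move=> cphi phi01 phiij.
have angle1 : angle (circle_base R) = 1 by rewrite /angle /= lexx; lra.
pose f t i z := phi i (angle z, t).
have ft t i j : f t i (circle_base R) = f t j (circle_base R).
  by rewrite /f angle1.
exists (fun wt => wedge_fun (f wt.2) wt.1); last first.
  by move=> i z t; rewrite /wedge_circle wedge_lift_funE.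
have cf i := continuous_angle (cphi i) (phi01 i).
apply: continuous_prodR => [w|J W cJ oW].
  have [i _ [z _ <-]] : (\bigcup_i (@wedge_lift I _ (fun=> circle_base R) i) @` setT) w.
    by rewrite wedgeTE.
  rewrite (_ : (fun t => _) = fun t => phi i (angle z, t)); last first.
    by apply/funext => t; rewrite wedge_lift_funE.
  by apply: continuous_comp_fun (cphi i); apply: continuous_pair => ?;
    [exact: cvg_cst|exact: cvg_id].
apply/wedge_openP => i.
have := open_tube (cf i) cJ oW; congr open; apply/seteqP; split=> z /= + t Jt;
  by move=> /(_ t Jt); rewrite wedge_lift_funE.
Qed.

End WedgeHomotopies.

(** * Complexes of triangles *)

Section TriangleComplex.
Context {R : realType} {T : choiceType} {X : simplicial_complex T} {J : choiceType}.
Context (p a b : J -> T).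
Hypotheses (pa : forall j, p j != a j) (pb : forall j, p j != b j)
  (ab : forall j, a j != b j) (faceJ : forall j, face X (p j) (a j) (b j)).
Local Notation V j := [fset p j; a j; b j]%fset.
Hypothesis cover : forall s, simplices X s -> exists j, (s `<=` V j)%fset.
Hypothesis meet : forall i j u v, i != j -> u \in V i -> u \in V j ->
  v \in V i -> v \in V j -> u = v.
Hypothesis vertexX : forall x, face X x x x.
Local Notation "|X|" := (realization R X).
Local Notation PT := (prod_topology (fun _ : T => R)).

Definition vertex x : |X| := tri (vertexX x) (0, 0).

Lemma coordinates_vertex x v : coordinates (vertex x) v = (v == x)%:R.
Proof.
rewrite coordinates_tri /barycenter /= clamp_le// !subr0 min_l// subr0.
by rewrite !mul0r !addr0 mul1r.
Qed.

Lemma eq_vertex (s : {fset T}) (x : |X|) v : closed_simplex s (coordinates x) ->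
  (forall w, coordinates x w != 0 -> w = v) -> x = vertex v.
Proof.
move=> [_ x0 x1] xv; apply: realization_inj => w; rewrite coordinates_vertex.
have xN u : u != v -> coordinates x u = 0.
  by move=> uv; apply/eqP; apply: contraNT uv => /xv ->.
have [->|] := eqVneq w v; last exact: xN.
have vs : v \in s.
  apply: contraTT (oner_neq0 R) => vs; rewrite -x1 big_seq big1 ?eqxx// => u us.
  by apply: xN; apply: contraNneq vs => <-.
by rewrite -x1 (big_fsetD1 v vs) /= big_seq big1 ?addr0// => u;
  rewrite !inE => /andP[/xN].
Qed.

(** A point in two different triangles is a vertex by [meet], so agreement at the corners, recorded
    by [c], makes the choice of triangle irrelevant. *)
Lemma glue_triangles (Y : topologicalType) (F : J -> R * R * R -> Y) (c : T -> R -> Y) :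
  (forall j, continuous (F j)) ->
  (forall j t, [/\ F j (0, 0, t) = c (p j) t, F j (1, 0, t) = c (a j) t &
                   F j (0, 1, t) = c (b j) t]) ->
  exists2 H : |X| * R -> Y, continuous H &
    forall j x t, closed_simplex (V j) (coordinates x) ->
      H (x, t) = F j (coordinates x (a j), coordinates x (b j), t).
Proof.
move=> cF Fc.
have Fv j v t : v \in V j -> F j (coordinates (vertex v) (a j),
    coordinates (vertex v) (b j), t) = c v t.
  have [Fp Fa Fb] := Fc j t.
  rewrite !inE !coordinates_vertex -orbA => /or3P[] /eqP ->.
  - by rewrite !(eq_sym _ (p j)) (negPf (pa j)) (negPf (pb j)).
  - by rewrite eqxx eq_sym (negPf (ab j)).
  - by rewrite eqxx (negPf (ab j)).
have FE i j (x : |X|) t : closed_simplex (V i) (coordinates x) ->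
    closed_simplex (V j) (coordinates x) ->
    F i (coordinates x (a i), coordinates x (b i), t) =
    F j (coordinates x (a j), coordinates x (b j), t).
  move=> xi xj; have [->//|ij] := eqVneq i j.
  have [v vi xv] := carrier_vertex xi.
  have inV k w : closed_simplex (V k) (coordinates x) -> coordinates x w != 0 ->
      w \in V k.
    by move=> [_ x0 _]; apply: contraNT => /x0 ->.
  have xE : x = vertex v.
    by apply: (eq_vertex xi) => w xw; apply: (meet ij); exact: inV.
  by rewrite xE !Fv//; exact: inV xv.
have jP (x : |X|) : exists j, closed_simplex (V j) (coordinates x).
  have [s Xs xs] := carrier x; have [j sj] := cover Xs.
  by exists j; exact: closed_simplexS xs.
pose j x := projT1 (cid (jP x)).
have jxP x : closed_simplex (V (j x)) (coordinates x) by exact: projT2 (cid (jP x)).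
exists (fun z => F (j z.1) (coordinates z.1 (a (j z.1)), coordinates z.1 (b (j z.1)), z.2));
  last by move=> k x t xk /=; exact: FE.
apply: continuous_realizationR => s Xs; have [k sk] := cover Xs.
exists (fun z : PT * R => F k (z.1 (a k), z.1 (b k), z.2)); last first.
  by move=> x t xs /=; apply: FE => //; exact: closed_simplexS xs.
apply: continuous_comp_fun (cF k); apply: continuous_pair; last exact: continuous_snd.
by apply: continuous_pair;
  exact: (continuous_comp_fun (@continuous_fst _ _) (@coordinate_continuous _ _ _)).
Qed.

(** A leg is one of the two edges of a triangle at its apex [p j]; this is its far end. *)
Definition leg_end (l : J * bool) := if l.2 then a l.1 else b l.1.

Definition leg (l : J * bool) (s : R) : |X| :=
  tri (faceJ l.1) (if l.2 then (s, 0) else (0, s)).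

Lemma continuous_leg l : continuous (leg l).
Proof.
apply: continuous_comp_fun; last exact: continuous_tri.
by case: l.2; apply: continuous_pair => ?; (exact: cvg_id || exact: cvg_cst).
Qed.

Lemma leg0 l : leg l 0 = vertex (p l.1).
Proof. by rewrite /leg /vertex; case: l.2; exact: tri_vertex. Qed.

Lemma leg1 l : leg l 1 = vertex (leg_end l).
Proof.
by rewrite /leg /vertex /leg_end; case: l.2; [exact: tri_vertex2|exact: tri_vertex3].
Qed.

Lemma leg_le0 l s : s <= 0 -> leg l s = leg l 0.
Proof.
move=> s0; apply: realization_inj => v; rewrite /leg; case: l.2;
by rewrite !coordinates_tri /barycenter /= !clamp_le.
Qed.

Lemma leg_ge1 l s : 1 <= s -> leg l s = leg l 1.
Proof.
move=> s0; apply: realization_inj => v; rewrite /leg; case: l.2;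
by rewrite !coordinates_tri /barycenter /= !(clamp_ge (x := s))// !(clamp_ge (x := 1)).
Qed.

(* A triangle is folded onto its two legs at p, each rescaled so that the leg *)
(* parameter is 0 when the coordinate of the end point is at most 1/2.        *)
Definition fold_legs (Y : Type) (phi : J * bool -> R * R -> Y) j (z : R * R * R) :=
  if z.1.1 - 2^-1 <= 0
  then phi (j, false) (clamp (2 * Num.min z.1.2 (1 - z.1.1) - 1), z.2)
  else phi (j, true) (clamp (2 * z.1.1 - 1), z.2).

(** Maps on the legs that agree at the vertices extend over the triangles through [fold_legs]. The
    price is a reparametrization: the first half of each leg is sent to the value at the apex. *)
Lemma glue_legs (Y : topologicalType) (phi : J * bool -> R * R -> Y) (c : T -> R -> Y) :
  (forall l, continuous (phi l)) ->
  (forall l t, phi l (0, t) = c (p l.1) t) ->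
  (forall l t, phi l (1, t) = c (leg_end l) t) ->
  exists2 H : |X| * R -> Y, continuous H &
    [/\ forall j x t, closed_simplex (V j) (coordinates x) ->
          H (x, t) = fold_legs phi j (coordinates x (a j), coordinates x (b j), t),
        forall l s t, 0 <= s <= 1 -> H (leg l s, t) = phi l (clamp (2 * s - 1), t) &
        forall x t, H (vertex x, t) = c x t].
Proof.
move=> cphi phi0 phi1.
have cfold j : continuous (fold_legs phi j).
  have c1 : continuous (fun z : R * R * R => z.1.1).
    exact: continuous_comp_fun (@continuous_fst _ _) (@continuous_fst _ _).
  have c2 : continuous (fun z : R * R * R => z.1.2).
    exact: continuous_comp_fun (@continuous_fst _ _) (@continuous_snd _ _).
  have caff (f : R * R * R -> R) : continuous f ->
      continuous (fun z => clamp (2 * f z - 1)).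
    move=> cf; apply: continuous_clamp; apply: continuousB_fun (@cst_continuous _ _ _).
    by apply: continuousM_fun cf; exact: cst_continuous.
  apply: continuous_paste.
  - exact: continuousB_fun c1 (@cst_continuous _ _ _).
  - apply: continuous_comp_fun (cphi _); apply: continuous_pair (@continuous_snd _ _).
    apply: (caff (fun z : R * R * R => Num.min z.1.2 (1 - z.1.1))).
    apply: continuous_min_fun c2 _.
    by apply: continuousB_fun c1; exact: cst_continuous.
  - apply: continuous_comp_fun (cphi _); apply: continuous_pair (@continuous_snd _ _).
    exact: (caff (fun z : R * R * R => z.1.1)).
  - move=> [[x y] t] /= x2; rewrite !clamp_le ?phi0//; first lra.
    (* On the seam [x = 1/2], the other coordinate is cut down to at most 1/2, so both pieces are at
       the apex. *)
    have : Num.min y (1 - x) <= 1 - x by rewrite ge_min lexx orbT.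
    lra.
have Fc j t : [/\ fold_legs phi j (0, 0, t) = c (p j) t,
    fold_legs phi j (1, 0, t) = c (a j) t & fold_legs phi j (0, 1, t) = c (b j) t].
  rewrite /fold_legs /=; split.
  - rewrite ifT; last lra.
    by rewrite min_l ?clamp_le ?phi0//; lra.
  - rewrite ifF; last by apply/negbTE; rewrite -ltNge; lra.
    by rewrite clamp_ge ?phi1//; lra.
  - rewrite ifT; last lra.
    by rewrite min_l ?clamp_ge ?phi1//; lra.
have [H cH HE] := glue_triangles cfold Fc.
have faceV j (st : R * R) : closed_simplex (V j) (coordinates (tri (faceJ j) st)).
  exact: tri_in.
exists H => //; split=> [//|[j [|]] s t s01|x t].
- rewrite (HE j _ t (faceV j _)) /leg !coordinates_tri /barycenter /=.
  rewrite eqxx !(eq_sym _ (p j)) (negPf (pa j)) (negPf (pb j)).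
  rewrite (negPf (ab j)) (eq_sym (b j)) (negPf (ab j)) eqxx.
  rewrite (@clamp_le _ 0)// clamp_id// min_l; last lra.
  rewrite subr0 !mulr0 !mulr1 !add0r !addr0 /fold_legs /= min_l; last lra.
  case: ifPn => s2 //; rewrite !clamp_le ?phi0//; lra.
- rewrite (HE j _ t (faceV j _)) /leg !coordinates_tri /barycenter /=.
  rewrite eqxx !(eq_sym _ (p j)) (negPf (pa j)) (negPf (pb j)).
  rewrite (negPf (ab j)) (eq_sym (b j)) (negPf (ab j)) eqxx.
  rewrite (@clamp_le _ 0)// clamp_id// subr0 min_l; last lra.
  rewrite !mulr0 !mulr1 !add0r ?addr0 /fold_legs /= ifT; last lra.
  by rewrite subr0 min_l//; lra.
- have Xx : simplices X [fset x]%fset by have := vertexX x; rewrite /face !fsetUid.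
  have [j xj] := cover Xx; have {}xj : x \in V j.
    by move/fsubsetP : xj; apply; rewrite inE.
  rewrite (HE j); last first.
    by have := tri_in (R := R) (vertexX x) (0, 0); rewrite !fsetUid => /closed_simplexS;
      apply; rewrite fsub1set.
  rewrite !coordinates_vertex; have [Fp Fa Fb] := Fc j t.
  move: xj; rewrite !inE -orbA => /or3P[] /eqP ->.
  - by rewrite !(eq_sym _ (p j)) (negPf (pa j)) (negPf (pb j)).
  - by rewrite eqxx eq_sym (negPf (ab j)).
  - by rewrite eqxx (negPf (ab j)).
Qed.

End TriangleComplex.

(** * Collapsing the spanning tree of the folded complex *)

Section TriangleComplexHomotopy.
Context {R : realType} {T : choiceType} {X : simplicial_complex T} {J : choiceType}.
Context (p a b : J -> T).
Hypotheses (pa : forall j, p j != a j) (pb : forall j, p j != b j)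
  (ab : forall j, a j != b j) (faceJ : forall j, face X (p j) (a j) (b j)).
Local Notation V j := [fset p j; a j; b j]%fset.
Hypothesis cover : forall s, simplices X s -> exists j, (s `<=` V j)%fset.
Hypothesis meet : forall i j u v, i != j -> u \in V i -> u \in V j ->
  v \in V i -> v \in V j -> u = v.
Hypothesis vertexX : forall x, face X x x x.
Local Notation "|X|" := (realization R X).
Local Notation leg_end := (leg_end a b).
Local Notation leg := (@leg R _ _ _ _ _ _ faceJ).
Local Notation vertex := (@vertex R _ _ vertexX).

(* Descending from x along the leg [tree_leg x] ends in root: the legs        *)
(* [tree_leg x] form a spanning tree.                                         *)
Context (root : T) (depth : T -> nat) (N : nat) (tree_leg : T -> option (J * bool)).
Hypothesis depth_le : forall x, (depth x <= N)%N.
Hypothesis depth_root : depth root = 0%N.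
Hypothesis tree_leg_root : forall x, tree_leg x = None <-> x = root.
Hypothesis tree_leg_end : forall x l, tree_leg x = Some l -> leg_end l = x.
Hypothesis tree_leg_depth : forall x l, tree_leg x = Some l ->
  (depth (p l.1) < depth x)%N.

Definition parent x := if tree_leg x is Some l then p l.1 else root.

Let tree_path x s := if tree_leg x is Some l then leg l s else vertex root.

Let continuous_tree_path x : continuous (tree_path x).
Proof.
rewrite /tree_path; case: tree_leg => [l|]; [exact: continuous_leg|].
exact: cst_continuous.
Qed.

Let tree_path0 x : tree_path x 0 = vertex (parent x).
Proof. by rewrite /tree_path /parent; case: tree_leg => // l; rewrite leg0. Qed.

Let tree_path1 x : tree_path x 1 = vertex x.
Proof.
rewrite /tree_path; case E : (tree_leg x) => [l|].
  by rewrite (leg1 _ vertexX) (tree_leg_end E).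
by move/tree_leg_root : E => ->.
Qed.

Let tree_path_ge1 x s : 1 <= s -> tree_path x s = vertex x.
Proof.
move=> s1; rewrite -tree_path1 /tree_path; case: tree_leg => // l.
exact: leg_ge1.
Qed.

(** The path from [x] towards the root, one tree leg backwards per unit of time; [k] bounds the
    number of legs, after which the path rests. *)
Fixpoint descent k x (u : R) : |X| := if k is k'.+1 then
  if u - 1 <= 0 then tree_path x (1 - u) else descent k' (parent x) (u - 1)
  else vertex x.

Let descent_le0 k x u : u <= 0 -> descent k x u = vertex x.
Proof.
by case: k => //= k u0; rewrite ifT; [apply: tree_path_ge1|]; lra.
Qed.

Let continuous_descent k x : continuous (descent k x).
Proof.
elim: k x => [|k IH] x /=; first exact: cst_continuous.
have cid : continuous (fun u : R => u) by move=> ?; exact: cvg_id.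
apply: continuous_paste.
- exact: continuousB_fun cid (@cst_continuous _ _ _).
- apply: continuous_comp_fun (continuous_tree_path (x := x)).
  by apply: continuousB_fun (cid); exact: cst_continuous.
- apply: continuous_comp_fun (IH _).
  exact: continuousB_fun cid (@cst_continuous _ _ _).
- move=> u u1; rewrite (_ : 1 - u = 0); last lra.
  by rewrite u1 tree_path0 descent_le0.
Qed.

Let descentS k x u : u <= k%:R -> descent k.+1 x u = descent k x u.
Proof.
elim: k x u => [|k IH] x u uk.
  by rewrite descent_le0//= ; apply: descent_le0.
rewrite [LHS]/= [RHS]/=; case: ifPn => // u1; apply: IH.
by move: uk; rewrite -natr1; lra.
Qed.

(** Each unit of time lowers the depth by at least one, and only the root has depth 0. *)
Let descent_root k x u : (depth x <= k)%N -> (depth x)%:R <= u ->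
  descent k x u = vertex root.
Proof.
have depth0 y : depth y = 0%N -> y = root.
  case E : (tree_leg y) => [l|]; last by move/tree_leg_root : E.
  by have := tree_leg_depth E; lia.
elim: k x u => [|k IH] x u xk xu /=.
  by rewrite (depth0 x)//; lia.
have [u1|u1] := ifPn.
  have : tree_leg x = None \/ exists l, tree_leg x = Some l.
    by case: tree_leg => [l|]; [right; exists l|left].
  move=> [xN|[l xl]]; first by rewrite /tree_path xN.
  have d1 : (depth x <= 1)%N by rewrite -(ler_nat R); lra.
  have px := tree_leg_depth xl.
  have d1' : (1%:R : R) <= (depth x)%:R by rewrite ler_nat; lia.
  rewrite (_ : 1 - u = 0) ?tree_path0; last lra.
  by rewrite /parent xl (depth0 (p l.1))//; lia.
have : tree_leg x = None \/ exists l, tree_leg x = Some l.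
  by case: tree_leg => [l|]; [right; exists l|left].
move=> [xN|[l xl]].
  by rewrite /parent xN; apply: IH; rewrite depth_root// mulr0n; lra.
have px := tree_leg_depth xl.
rewrite /parent xl; apply: IH; first by lia.
have : ((depth (p l.1)).+1%:R : R) <= (depth x)%:R by rewrite ler_nat.
by rewrite -natr1; lra.
Qed.

Let I : choiceType := {l : J * bool | tree_leg (leg_end l) != Some l}.

(** The leg occupies the unit interval of a line whose two rays descend from its apex and from its
    far end. The whole line becomes a closed path at the root once both rays have length [N]. *)
Definition leg_line l (u : R) : |X| :=
  if u <= 0 then descent N (p l.1) (- u) else
  if u - 1 <= 0 then leg l u else descent N (leg_end l) (u - 1).

Let continuous_leg_line l : continuous (leg_line l).
Proof.
have cid : continuous (fun u : R => u) by move=> ?; exact: cvg_id.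
have cN : continuous (fun u : R => - u) by move=> u; apply: cvgN.
have c1 : continuous (fun u : R => u - 1).
  exact: continuousB_fun cid (@cst_continuous _ _ _).
apply: continuous_paste => //.
- exact: continuous_comp_fun cN (@continuous_descent _ _).
- apply: continuous_paste => //; first exact: continuous_leg.
    exact: continuous_comp_fun c1 (@continuous_descent _ _).
  move=> u u1; rewrite u1 descent_le0// (_ : u = 1) ?(leg1 _ vertexX)//; lra.
- move=> u ->; rewrite oppr0 descent_le0// ifT; last lra.
  by rewrite (leg0 _ vertexX).
Qed.

(* At time t the legs are stretched so that every vertex x has moved to       *)
(* [descent N x (N * t)]; at time 1 every vertex is at the root.              *)
Definition stretched_leg l (z : R * R) : |X| :=
  if tree_leg (leg_end l) == Some l
  then descent N.+1 (leg_end l) (N%:R * clamp z.2 + 1 - z.1)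
  else leg_line l ((1 + 2 * (N%:R * clamp z.2)) * z.1 - N%:R * clamp z.2).

Let continuous_stretched_leg l : continuous (stretched_leg l).
Proof.
have cs : continuous (fun z : R * R => z.1) by exact: continuous_fst.
have ct : continuous (fun z : R * R => N%:R * clamp z.2).
  apply: continuousM_fun; first exact: cst_continuous.
  by apply: continuous_clamp; exact: continuous_snd.
rewrite /stretched_leg; case: eqP => _.
  apply: continuous_comp_fun (@continuous_descent _ _).
  apply: continuousB_fun (cs); apply: continuousD_fun (ct) _; exact: cst_continuous.
apply: continuous_comp_fun (@continuous_leg_line l).
apply: continuousB_fun (ct); apply: continuousM_fun (cs).
apply: continuousD_fun; first exact: cst_continuous.
by apply: continuousM_fun (ct); exact: cst_continuous.
Qed.

Let Nclamp (t : R) : 0 <= N%:R * clamp t <= N%:R.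
Proof.
have := clamp_ge0 t; have := clamp_le1 t => t1 t0; rewrite mulr_ge0//=.
by rewrite ler_piMr.
Qed.

Let parent_leg_end l : tree_leg (leg_end l) = Some l -> parent (leg_end l) = p l.1.
Proof. by rewrite /parent => ->. Qed.

(** On a tree leg the apex is the parent of the end, so it lies one unit further along the descent
    from the end; this extra unit is why [N.+1] steps occur. On another leg the parameter 0 is sent
    to [- N t] on [leg_line], with [t] clamped. *)
Let stretched_leg0 l t : stretched_leg l (0, t) = descent N (p l.1) (N%:R * clamp t).
Proof.
have /andP[t0 tN] := Nclamp t; rewrite /stretched_leg /=; case: eqP => [tl|_].
  rewrite -(parent_leg_end tl) subr0; case: ifPn => t1; last by rewrite addrK.
  by rewrite (_ : N%:R * clamp t = 0) ?add0r ?subrr ?tree_path0 ?descent_le0//; lra.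
by rewrite /leg_line mulr0 sub0r ifT ?opprK//; lra.
Qed.

Let stretched_leg1 l t : stretched_leg l (1, t) = descent N (leg_end l) (N%:R * clamp t).
Proof.
have /andP[t0 tN] := Nclamp t; rewrite /stretched_leg; case: eqP => [tl|_].
  by rewrite [(_, _).2]/= [(_, _).1]/= addrK descentS.
rewrite /leg_line /= ifF; last by apply/negbTE; rewrite -ltNge; lra.
have [t1|t1] := ifPn; last by congr descent; lra.
rewrite (_ : N%:R * clamp t = 0); last lra.
by rewrite mulr0 addr0 mul1r subr0 (leg1 _ vertexX) descent_le0.
Qed.

Let stretched_leg_start l s : 0 <= s <= 1 -> stretched_leg l (s, 0) = leg l s.
Proof.
move=> /andP[s0 s1]; rewrite /stretched_leg /= clamp_le// mulr0 add0r.
case: eqP => [tl|_].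
  rewrite ifT; last lra.
  by rewrite /tree_path tl; congr leg; lra.
rewrite mulr0 addr0 mul1r subr0 /leg_line; have [s0'|_] := ifPn.
  by rewrite (_ : s = 0) ?oppr0 ?descent_le0 ?(leg0 _ vertexX)//; lra.
by rewrite ifT//; lra.
Qed.

Let tree_leg_stop l s : tree_leg (leg_end l) = Some l -> 0 <= s <= 1 ->
  stretched_leg l (s, 1) = vertex root.
Proof.
move=> tl s01; rewrite /stretched_leg tl eqxx; apply: descent_root.
  by apply: leq_trans (depth_le _) _.
have : ((depth (leg_end l))%:R : R) <= N%:R by rewrite ler_nat.
rewrite /= clamp_ge//; lra.
Qed.

Let descent_stop x : descent N x (N%:R * clamp 1) = vertex root.
Proof. by rewrite clamp_ge// mulr1 descent_root// ler_nat. Qed.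

(** Each of the two coordinates [c] moves linearly to the clamped value of [2 c - 1]. This fixes the
    values 0 and 1, hence the corners, and at the end at most one of the two coordinates is nonzero,
    so the point is on a leg. *)
Let fold_triangles : exists2 H : |X| * R -> |X|, continuous H &
  (forall x, H (x, 0) = x) /\ forall j x, closed_simplex (V j) (coordinates x) ->
    H (x, 1) = fold_legs (fun l z => leg l z.1) j
      (coordinates x (a j), coordinates x (b j), 1).
Proof.
pose d (c t : R) := (1 - clamp t) * c + clamp t * clamp (2 * c - 1).
have cd (Z : topologicalType) (f g : Z -> R) : continuous f -> continuous g ->
    continuous (fun z => d (f z) (g z)).
  move=> cf cg; have cg' := continuous_clamp cg.
  apply: continuousD_fun; apply: continuousM_fun => //.
    by apply: continuousB_fun (cg'); exact: cst_continuous.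
  apply: continuous_clamp; apply: continuousB_fun; last exact: cst_continuous.
  by apply: continuousM_fun (cf); exact: cst_continuous.
pose F j (z : R * R * R) : |X| := tri (faceJ j) (d z.1.1 z.2, d z.1.2 z.2).
have cF j : continuous (F j).
  apply: continuous_comp_fun (@continuous_tri _ _ _ _ _ _ _).
  by apply: continuous_pair; apply: cd; try exact: continuous_snd;
    apply: (continuous_comp_fun (@continuous_fst _ _));
    [exact: continuous_fst|exact: continuous_snd].
have d0 t : d 0 t = 0 by rewrite /d !mulr0 sub0r (@clamp_le _ (-1)) ?mulr0 ?addr0//; lra.
have d1 t : d 1 t = 1 by rewrite /d (_ : clamp (2 * 1 - 1) = 1); [lra|rewrite clamp_ge; lra].
have [j t|H cH HE] := @glue_triangles _ _ _ _ _ _ _ pa pb ab cover meet vertexX _ F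
    (fun x _ => vertex x) cF.
  rewrite /F /= !d0 !d1 /vertex; split.
  - exact: tri_vertex.
  - exact: tri_vertex2.
  - exact: tri_vertex3.
exists H => //; split=> [x|j x xj].
  have [s Xs xs] := carrier x; have [j sj] := cover Xs.
  have xj := closed_simplexS sj xs.
  rewrite (HE _ _ _ xj) /F /= /d clamp_le// subr0 !mul1r !mul0r !addr0.
  exact: tri_eq.
have [x0 _] := xj; rewrite fsetUC big_fsetU1 ?inE; last first.
  by rewrite negb_or eq_sym pb eq_sym ab.
rewrite big_fsetU1 ?inE// big_seq_fset1 => /= x1.
have [xp xa xb] := And3 (x0 (p j)) (x0 (a j)) (x0 (b j)).
rewrite (HE _ _ _ xj) /F /fold_legs /leg /= /d clamp_ge// subrr !mul0r !mul1r !add0r.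
case: ifPn => xa2; last by rewrite (@clamp_le _ (2 * coordinates x (b j) - 1))//; lra.
rewrite (@clamp_le _ (2 * coordinates x (a j) - 1)); last lra.
by rewrite min_l//; lra.
Qed.

(** The map [f] folds triangles onto legs, sends tree legs to the base point and wraps every other
    leg around its circle; [g] runs circle [i] from the root along the tree, across leg [i], and
    back. The stretched legs deform the folding to [g \o f], while [f \o g] only reparametrizes each
    circle. The circle [i0] supplies the base point. *)
Theorem triangle_complex_wedge (i0 : I) :
  homotopy_equivalent R |X| (wedge_of_circles R I).
Proof.
pose base : wedge_of_circles R I := wedge_circle i0 (circle_base R).
have baseE i : wedge_circle i (circle_base R) = base.
  exact: (@wedge_liftE I _ (fun=> circle_base R) i0 (circle_base R) i (circle_base R)).
(* [insub] tests whether [l] is a leg outside the tree. *)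
pose phif (l : J * bool) (z : R * R) : wedge_of_circles R I :=
  if insub l is Some i then wedge_circle i (loop z.1) else base.
have cphif l : continuous (phif l).
  rewrite /phif; case: insubP => [i _ _|_]; last exact: cst_continuous.
  apply: continuous_comp_fun; last exact: continuous_wedge_circle.
  by apply: continuous_comp_fun continuous_loop; exact: continuous_fst.
have phif0 l t : phif l (0, t) = base.
  by rewrite /phif; case: insubP => //= i _ _; rewrite loop0.
have phif1 l t : phif l (1, t) = base.
  by rewrite /phif; case: insubP => //= i _ _; rewrite loop1.
have phif_tree l z : tree_leg (leg_end l) = Some l -> phif l z = base.
  by move=> tl; rewrite /phif insubF// tl eqxx.
have [Hf cHf [HfE Hf_leg Hf_vertex]] :=
  glue_legs pa pb ab faceJ cover meet vertexX cphif (c := fun _ _ => base) phif0 phif1.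
pose psi (i : I) (z : R * R) := stretched_leg (val i) (z.1, 1).
have cpsi i : continuous (psi i).
  apply: continuous_comp_fun (@continuous_stretched_leg _).
  by apply: continuous_pair; [exact: continuous_fst|exact: cst_continuous].
have psi0 i t : psi i (0, t) = vertex root by rewrite /psi stretched_leg0 descent_stop.
have psi1 i t : psi i (1, t) = vertex root by rewrite /psi stretched_leg1 descent_stop.
have [Hg cHg HgE] := continuous_wedgeR cpsi
  (fun i t => etrans (psi0 i t) (esym (psi1 i t)))
  (fun i j t => etrans (psi1 i t) (esym (psi1 j t))).
have [H cH [HE _ _]] := glue_legs pa pb ab faceJ cover meet vertexX
  continuous_stretched_leg (c := fun x t => descent N x (N%:R * clamp t))
  stretched_leg0 stretched_leg1.
pose f x := Hf (x, 0); pose g w := Hg (w, 0).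
have at0 (Y Z : topologicalType) (h : Y * R -> Z) : continuous h ->
    continuous (fun y => h (y, 0)).
  move=> ch; apply: continuous_comp_fun ch; apply: continuous_pair.
    by move=> ?; exact: cvg_id.
  exact: cst_continuous.
(* A descent runs along tree legs only, which [f] sends to the base point. *)
have f_descent k x u : f (descent k x u) = base.
  elim: k x u => [|k IH] x u /=; first exact: Hf_vertex.
  case: ifP => // _; rewrite /tree_path.
  case E : (tree_leg x) => [l|]; last exact: Hf_vertex.
  have lt : tree_leg (leg_end l) = Some l by rewrite (tree_leg_end E).
  have [u1|u1] := lerP (1 - u) 0.
    by rewrite leg_le0// (leg0 _ vertexX) /f Hf_vertex.
  have [u2|u2] := lerP 1 (1 - u).
    by rewrite leg_ge1// (leg1 _ vertexX) /f Hf_vertex.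
  rewrite /f Hf_leg ?phif_tree//; lra.
exists f, g; split; [exact: at0|exact: at0| |]; apply: homotopicR_homotopic.
- have [H1 cH1 [H10 H11]] := fold_triangles.
  (* At time 1 a stretched leg is the image under [g] of the circle traced by [f], so the homotopy
     [H] ends at [g \o f]. *)
  have gphi l s : 0 <= s <= 1 -> stretched_leg l (s, 1) = g (phif l (s, 0)).
    move=> s01; rewrite /phif; case: insubP => [i _ iE|].
      rewrite /g HgE /= (@angle_loop _ s _ (fun s => psi i (s, 0)))//.
        by rewrite /psi iE.
      by rewrite psi0 psi1.
    rewrite negbK => /eqP tl; rewrite tree_leg_stop// /g HgE /=.
    by rewrite -loop1 (@angle_loop _ 1 _ (fun s => psi i0 (s, 0))) ?psi0 ?psi1
      ?ler01 ?lexx.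
  have r_gf : homotopicR R (fun x => H1 (x, 1)) (g \o f).
    exists H => //; split=> x; have [s Xs xs] := carrier x;
      have [j sj] := cover Xs; have xj := closed_simplexS sj xs; rewrite (HE _ _ _ xj).
      by rewrite (H11 _ _ xj) /fold_legs /=; case: ifP => _;
        rewrite stretched_leg_start// clamp_ge0 clamp_le1.
    rewrite /= /f (HfE _ _ _ xj).
    by rewrite /fold_legs /=; case: ifP => _; rewrite gphi// clamp_ge0 clamp_le1.
  have id_r : homotopicR R idfun (fun x => H1 (x, 1)) by exists H1.
  have [G cG [G0 G1]] := homotopicR_trans id_r r_gf.
  (* The required homotopy goes from [g \o f] to the identity: time is reversed. *)
  exists (fun z => G (z.1, 1 - z.2)).
    apply: continuous_comp_fun cG; apply: continuous_pair (@continuous_fst _ _) _.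
    by apply: continuousB_fun (@continuous_snd _ _); exact: cst_continuous.
  by split=> x /=; rewrite ?subrr ?subr0.
(* The leg is the middle unit of a path of length [1 + 2 N], and [f] leaves the base point only on
   its second half. So [k] is the parameter reached on the circle, and it is interpolated with the
   identity. *)
- pose k (s : R) := clamp (2 * ((1 + 2 * N%:R) * s - N%:R) - 1).
  pose phi i (z : R * R) : wedge_of_circles R I :=
    wedge_circle i (loop ((1 - clamp z.2) * k z.1 + clamp z.2 * z.1)).
  have N0 : (0 : R) <= N%:R by [].
  have phi0 i t : phi i (0, t) = base.
    have k0 : k 0 = 0 by rewrite /k mulr0 clamp_le//; lra.
    by rewrite /phi /= k0 !mulr0 addr0 loop0.
  have phi1 i t : phi i (1, t) = base.
    have k1 : k 1 = 1 by rewrite /k mulr1 clamp_ge//; lra.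
    by rewrite /phi /= k1 !mulr1 subrK loop1.
  have cphi i : continuous (phi i).
    apply: continuous_comp_fun; last exact: continuous_wedge_circle.
    apply: continuous_comp_fun continuous_loop.
    have cs : continuous (fun z : R * R => z.1) by exact: continuous_fst.
    have ct : continuous (fun z : R * R => clamp z.2).
      by apply: continuous_clamp; exact: continuous_snd.
    apply: continuousD_fun; apply: continuousM_fun => //.
      by apply: continuousB_fun (ct); exact: cst_continuous.
    apply: continuous_clamp; apply: continuousB_fun; last exact: cst_continuous.
    apply: continuousM_fun; first exact: cst_continuous.
    apply: continuousB_fun; last exact: cst_continuous.
    by apply: continuousM_fun (cs); exact: cst_continuous.
  have [G cG GE] := continuous_wedgeR cphi
    (fun i t => etrans (phi0 i t) (esym (phi1 i t)))
    (fun i j t => etrans (phi1 i t) (esym (phi1 j t))).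
  have wedgeP (w : wedge_of_circles R I) : exists i z, w = wedge_circle i z.
    have : (\bigcup_i (@wedge_lift I _ (fun=> circle_base R) i) @` setT) w.
      by rewrite wedgeTE.
    by move=> [i _ [z _ <-]]; exists i, z.
  have f_line i u : f (leg_line (val i) u) = wedge_circle i (loop (clamp (2 * u - 1))).
    rewrite /leg_line; case: ifPn => u0.
      by rewrite f_descent clamp_le ?loop0//; lra.
    case: ifPn => u1; last by rewrite f_descent clamp_ge ?loop1//; lra.
    rewrite /f Hf_leg; last lra.
    by rewrite /phif valK.
  exists G => //; split=> w; have [i [z ->]] := wedgeP w; rewrite GE /phi /=.
    rewrite (@clamp_le _ 0)// subr0 mul1r mul0r addr0 /g HgE /psi /stretched_leg.
    by rewrite (negPf (valP i)) f_line /= (@clamp_ge _ 1)// mulr1.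
  by rewrite (@clamp_ge _ 1)// subrr mul0r add0r mul1r loop_angle.
Qed.

End TriangleComplexHomotopy.

(** * Cardinals and graphs of triangles *)

Section FiniteCardinals.

Lemma card_eq_bijection (A B : Type) : [set: A] #= [set: B] ->
  exists f : A -> B, bijective f.
Proof.
move=> /card_bijP[f [g fK gK]].
have inT (C : Type) (c : C) : c \in [set: C] by rewrite inE.
exists (fun x => val (f (SigSub (inT A x)))), (fun y => val (g (SigSub (inT B y)))).
  by move=> x; rewrite [X in g X](_ : _ = f (SigSub (inT A x))) ?fK//; apply: val_inj.
by move=> y; rewrite [X in f X](_ : _ = g (SigSub (inT B y))) ?gK//; apply: val_inj.
Qed.

Lemma bijective_card_eq (A B : Type) (f : A -> B) :
  bijective f -> [set: A] #= [set: B].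
Proof.
move=> [g fK gK]; apply: (bijection_card_eq (f := f)); first exact: can_inj fK.
by move=> y; exists (g y); rewrite gK.
Qed.

Lemma card_finType (F : finType) : [set: F] #= `I_#|F|.
Proof.
apply: (card_eq_trans (bijective_card_eq (enum_rank_bij F))).
by rewrite card_eq_sym; exact: card_II.
Qed.

Lemma card_ord_bijection (A : Type) n : [set: A] #= `I_n ->
  exists f : 'I_n -> A, bijective f.
Proof.
move=> An; apply: card_eq_bijection; rewrite card_eq_sym.
exact: card_eq_trans An card_II.
Qed.

Lemma card_fin_model (A : Type) (F : finType) (f : F -> A) n :
  bijective f -> #|F| = n -> [set: A] #= `I_n.
Proof.
move=> bf <-; rewrite -(card_eql (bijective_card_eq bf)); exact: card_finType.
Qed.

Lemma card_eq_uniq (A : Type) m n : [set: A] #= `I_m -> [set: A] #= `I_n -> m = n.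
Proof.
by move=> Am An; apply/card_eq_II; apply: card_eq_trans An; rewrite card_eq_sym.
Qed.

Lemma card_eq_prod (A B : Type) m n : [set: A] #= `I_m -> [set: B] #= `I_n ->
  [set: A * B] #= `I_(m * n)%N.
Proof.
move=> /card_ord_bijection[f [f' fK f'K]] /card_ord_bijection[g [g' gK g'K]].
apply: (@card_fin_model _ ('I_m * 'I_n)%type (fun ij => (f ij.1, g ij.2))).
  by exists (fun xy => (f' xy.1, g' xy.2)) => -[x y] /=; rewrite ?fK ?gK ?f'K ?g'K.
by rewrite card_prod !card_ord.
Qed.

Lemma card_eq_sum (A B : Type) m n : [set: A] #= `I_m -> [set: B] #= `I_n ->
  [set: A + B] #= `I_(m + n)%N.
Proof.
move=> /card_ord_bijection[f [f' fK f'K]] /card_ord_bijection[g [g' gK g'K]].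
apply: (@card_fin_model _ ('I_m + 'I_n)%type
    (fun i => match i with inl i => inl (f i) | inr j => inr (g j) end)).
  exists (fun i => match i with inl x => inl (f' x) | inr y => inr (g' y) end).
    by case=> x /=; rewrite ?fK ?gK.
  by case=> x /=; rewrite ?f'K ?g'K.
by rewrite card_sum !card_ord.
Qed.

Lemma card_eq_sig (A B : Type) (P : A -> B -> bool) m n : [set: A] #= `I_m ->
  (forall x, [set: {y | P x y}] #= `I_n) ->
  [set: {xy : A * B | P xy.1 xy.2}] #= `I_(m * n)%N.
Proof.
move=> Am Pn.
have fP x : exists f : {y | P x y} -> 'I_n, bijective f.
  by apply: card_eq_bijection; exact: card_eq_trans (Pn x) card_II.
pose f x := projT1 (cid (fP x)).
have bf x : bijective (f x) by exact: projT2 (cid (fP x)).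
apply: card_eq_trans (card_eq_prod Am (card_esym card_II : [set: 'I_n] #= `I_n)).
apply: (@bijection_card_eq _ _ (fun z : {xy : A * B | P xy.1 xy.2} =>
  ((val z).1, f (val z).1 (exist _ (val z).2 (valP z))))).
  move=> [[x y] /= xy] [[x' y'] /= xy'] [xx']; move: xy'; rewrite -{}xx' => xy'.
  have [g fK _] := bf x => /(can_inj fK) [yy']; move: xy'; rewrite -yy' => xy'.
  by apply: val_inj.
move=> [x i]; have [g _ gK] := bf x.
exists (exist (fun xy => P xy.1 xy.2) (x, val (g i)) (valP (g i))) => /=.
congr pair; rewrite -[RHS]gK; congr (f x _); exact: val_inj.
Qed.

Lemma card_eq_injection (A B : Type) (f : A -> B) n : injective f ->
  [set: B] #= `I_n -> exists m, [set: A] #= `I_m.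
Proof.
move=> fi Bn; apply/finite_setP; apply: (@card_le_finite _ _ _ [set: B]).
  by rewrite -(card_le_eql (inj_card_eq (in2W fi))); apply: subset_card_le.
by apply/finite_setP; exists n.
Qed.

Lemma card_eq_prod_inv (A : Type) (F : finType) n : (0 < #|F|)%N -> [set: A * F] #= `I_n ->
  exists2 m, [set: A] #= `I_m & (m * #|F| = n)%N.
Proof.
move=> /card_gt0P[i _] AFn.
have [m Am] := card_eq_injection (f := fun x : A => (x, i)) (fun x y => fun E => congr1 fst E) AFn.
by exists m => //; apply: card_eq_uniq AFn; apply: card_eq_prod Am _; exact: card_finType.
Qed.

Lemma fsbig_fin_model (A : choiceType) (D : set A) (F : finType) (f : F -> A) (h : A -> int) :
  (forall i, D (f i)) -> injective f -> (forall x, D x -> exists i, f i = x) ->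
  \sum_(x \in D) h x = \sum_(i : F) h (f i).
Proof.
move=> fD fi fs; rewrite (@reindex_fsbig _ _ _ _ _ f [set: F]); last first.
  by split=> [i _|i j _ _|x /fs[i <-]]; [exact: fD|exact: fi|exists i].
rewrite (fsbigE (index_enum F)) ?index_enum_uniq//; last first.
  by move=> i _; rewrite mem_index_enum.
by apply: eq_bigl => i; apply: mem_set.
Qed.

End FiniteCardinals.

(** * Graphs in which every edge lies in exactly one triangle *)

Section GraphOfTriangles.
Context {T : choiceType} (e : rel T).
Hypotheses (e_sym : symmetric e) (e_irr : irreflexive e).
Hypothesis third : forall x y, e x y ->
  exists z, [/\ e x z, e y z & forall w, e x w -> e y w -> w = z].
Hypothesis neighbor : forall x, exists y, e x y.
Hypothesis branch : forall x y, e x y -> exists y', [/\ e x y', y' != y & ~~ e y y'].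
Context (root far : T) (N : nat).
Hypothesis far_distance : graph_distance e root far N.
Hypothesis N_gt0 : (0 < N)%N.
Hypothesis radius : forall x, exists2 k, walk e root x k & (k <= N)%N.

Let edge_neq x y : e x y -> x != y.
Proof. by apply: contraTneq => ->; rewrite e_irr. Qed.

Let walk_exists x : exists k, `[< walk e root x k >].
Proof. by have [k ? _] := radius x; exists k; apply/asboolP. Qed.

Let depth x := ex_minn (walk_exists x).

Let depth_walk x : walk e root x (depth x).
Proof. by rewrite /depth; case: ex_minnP => k /asboolP. Qed.

Let depth_min x k : walk e root x k -> (depth x <= k)%N.
Proof. by move=> xk; rewrite /depth; case: ex_minnP => m _; apply; apply/asboolP. Qed.

Let depth_le x : (depth x <= N)%N.
Proof. by have [k /depth_min + ?] := radius x; move/leq_trans; apply. Qed.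

Let depth_root : depth root = 0%N.
Proof. by apply/eqP; rewrite -leqn0; apply: depth_min; exists [::]. Qed.

Let depth_step x : x != root -> exists2 y, e y x & (depth y < depth x)%N.
Proof.
move=> xr; have [p [pp px ps]] := depth_walk x.
case/lastP: p => [|p y] in pp px ps *; first by rewrite -px eqxx in xr.
move: pp px ps; rewrite rcons_path last_rcons size_rcons => /andP[pp py] <- <-.
exists (last root p) => //; rewrite ltnS; apply: depth_min; by exists p.
Qed.

Let depth_far x : (depth x <= depth far)%N.
Proof.
have [_ Nmin] := far_distance; apply: leq_trans (depth_le x) _.
by apply: Nmin; exact: depth_walk.
Qed.

Let far_neq_root : far != root.
Proof.
apply: contraTneq N_gt0 => fr; have [_ Nmin] := far_distance.
by rewrite -leqNgt; apply: Nmin; rewrite fr; exists [::].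
Qed.

(** A boolean predicate, so that the triangles form a [choiceType]. *)
Let triangle (s : {fset T}) := `[< exists x y z,
  [/\ e x y, e x z, e y z & s = [fset x; y; z]%fset] >].

Let triangle_edge s u v : triangle s -> u \in s -> v \in s -> u != v ->
  e u v /\ exists w, [/\ e u w, e v w & s = [fset u; v; w]%fset].
Proof.
move=> /asboolP[x [y [z [xy xz yz ->]]]].
have perm x' y' z' : [fset x; y; z]%fset =i [fset x'; y'; z']%fset ->
    [fset x; y; z]%fset = [fset x'; y'; z']%fset by move/fsetP.
rewrite !inE -!orbA => /or3P[] /eqP -> /or3P[] /eqP ->; rewrite ?eqxx// => _;
  (split; first by [|rewrite e_sym]).
- by exists z; split.
- exists y; split; try (by []); try (by rewrite e_sym).
  by apply: perm => t; rewrite !inE; case: (t == x); case: (t == y); case: (t == z).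
- exists z; split => //.
  by apply: perm => t; rewrite !inE; case: (t == x); case: (t == y); case: (t == z).
- exists x; split; try (by []); try (by rewrite e_sym).
  by apply: perm => t; rewrite !inE; case: (t == x); case: (t == y); case: (t == z).
- exists y; split; try (by []); try (by rewrite e_sym).
  by apply: perm => t; rewrite !inE; case: (t == x); case: (t == y); case: (t == z).
- exists x; split; try (by []); try (by rewrite e_sym).
  by apply: perm => t; rewrite !inE; case: (t == x); case: (t == y); case: (t == z).
Qed.

Let triangle_uniq s t u v : triangle s -> triangle t -> u != v ->
  u \in s -> v \in s -> u \in t -> v \in t -> s = t.
Proof.
move=> ts tt uv us vs ut vt.
have [euv [w [uw vw ->]]] := triangle_edge ts us vs uv.
have [_ [w' [uw' vw' ->]]] := triangle_edge tt ut vt uv.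
have [z [_ _ zE]] := third euv.
by rewrite (zE w)// (zE w').
Qed.

Let J : choiceType := {s : {fset T} | triangle s}.

Let mkJ s (t : triangle s) : J := exist (fun s => is_true (triangle s)) s t.

(** The corners are ordered so that one of least depth comes at the front and serves as apex; the
    depth is the distance from the root. *)
Let cornersP (j : J) : exists c : T * T * T, let: (x, y, z) := c in
  [/\ [/\ e x y, e x z & e y z], val j = [fset x; y; z]%fset &
      (depth x <= depth y)%N /\ (depth x <= depth z)%N].
Proof.
have /asboolP[x [y [z [xy xz yz jE]]]] := valP j; rewrite jE.
have [dxy|dxy] := leqP (depth x) (depth y).
  have [dxz|dxz] := leqP (depth x) (depth z); first by exists (x, y, z).
  exists (z, x, y); split; [by split; rewrite // e_sym| |by split; lia].
  by apply/fsetP => t; rewrite !inE; case: (t == x); case: (t == y); case: (t == z).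
have [dyz|dyz] := leqP (depth y) (depth z).
  exists (y, x, z); split; [by split; rewrite // e_sym| |by split; lia].
  by apply/fsetP => t; rewrite !inE; case: (t == x); case: (t == y); case: (t == z).
exists (z, x, y); split; [by split; rewrite // e_sym| |by split; lia].
by apply/fsetP => t; rewrite !inE; case: (t == x); case: (t == y); case: (t == z).
Qed.

Let corners j := projT1 (cid (cornersP j)).
Let p j := (corners j).1.1.
Let a j := (corners j).1.2.
Let b j := (corners j).2.

Let corners_spec j : [/\ [/\ e (p j) (a j), e (p j) (b j) & e (a j) (b j)],
  val j = [fset p j; a j; b j]%fset &
  (depth (p j) <= depth (a j))%N /\ (depth (p j) <= depth (b j))%N].
Proof.
rewrite /p /a /b /corners; have := projT2 (cid (cornersP j)).
by case: (projT1 _) => [[]].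
Qed.

Let pa j : p j != a j. Proof. by have [[? _ _] _ _] := corners_spec j; exact: edge_neq. Qed.
Let pb j : p j != b j. Proof. by have [[_ ? _] _ _] := corners_spec j; exact: edge_neq. Qed.
Let ab j : a j != b j. Proof. by have [[_ _ ?] _ _] := corners_spec j; exact: edge_neq. Qed.

Let valE j : val j = [fset p j; a j; b j]%fset.
Proof. by have [] := corners_spec j. Qed.

Let triangle_on x y : e x y -> exists2 j : J, x \in val j & y \in val j.
Proof.
move=> xy; have [z [xz yz _]] := third xy.
have t : triangle [fset x; y; z]%fset by apply/asboolP; exists x, y, z.
by exists (mkJ t); rewrite !inE eqxx ?orbT.
Qed.

Let cover s : clique e s -> exists j, (s `<=` [fset p j; a j; b j])%fset.
Proof.
move=> [/fset0Pn[x xs] es].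
have [[y ys yx]|yN] := pselect (exists2 y, y \in s & y != x).
  have xy : e x y by apply: es => //; rewrite eq_sym.
  have [z [xz yz zE]] := third xy.
  have t : triangle [fset x; y; z]%fset by apply/asboolP; exists x, y, z.
  exists (mkJ t); rewrite -valE; apply/fsubsetP => w ws; rewrite !inE.
  have [//|wx] := eqVneq w x; have [//|wy] := eqVneq w y.
  by apply/eqP/zE; apply: es => //; rewrite eq_sym.
have [y xy] := neighbor x; have [j xj _] := triangle_on xy; exists j.
rewrite -valE; apply/fsubsetP => w ws; have [->//|wx] := eqVneq w x.
by case: yN; exists w.
Qed.

Let meet i j u v : i != j -> u \in [fset p i; a i; b i]%fset ->
  u \in [fset p j; a j; b j]%fset -> v \in [fset p i; a i; b i]%fset ->
  v \in [fset p j; a j; b j]%fset -> u = v.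
Proof.
rewrite -!valE => ij ui uj vi vj; apply/eqP; apply: contraNT ij => uv.
apply/eqP/val_inj; exact: (triangle_uniq (valP i) (valP j) uv).
Qed.

Let vertex_clique x : clique e [fset x]%fset.
Proof.
split; first by apply/fset0Pn; exists x; rewrite inE.
by move=> u v; rewrite !inE => /eqP -> /eqP ->; rewrite eqxx.
Qed.

Let vertexX x : face (clique_complex e) x x x.
Proof. by rewrite /face !fsetUid; exact: vertex_clique. Qed.

Let faceJ j : face (clique_complex e) (p j) (a j) (b j).
Proof.
split; first by rewrite -valE; apply/fset0Pn; exists (p j); rewrite valE !inE eqxx.
by rewrite -valE => u v uj vj uv; have [] := triangle_edge (valP j) uj vj uv.
Qed.

(** A vertex [x] other than the root has a neighbour closer to the root. In a triangle on this edge
    the apex is closer still or equally close, so it is not [x], and the leg ending at [x] has an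
    apex of smaller depth. *)
Let tree_legP x : exists o : option (J * bool), (o = None <-> x = root) /\
  forall l, o = Some l -> leg_end a b l = x /\ (depth (p l.1) < depth x)%N.
Proof.
have [->|xr] := eqVneq x root; first by exists None; split.
have [y yx dyx] := depth_step xr; have [j yj xj] := triangle_on yx.
have dpx : (depth (p j) < depth x)%N.
  have [_ _ [dpa dpb]] := corners_spec j; apply: leq_ltn_trans dyx.
  by move: yj; rewrite valE !inE -orbA => /or3P[] /eqP ->.
exists (Some (j, x == a j)); split.
  by split=> // xr'; rewrite xr' eqxx in xr.
move=> _ [<-]; split=> //; rewrite /leg_end /=; case: eqP => [//|xa].
move: xj; rewrite valE !inE -orbA => /or3P[] /eqP xE //.
by move: dpx; rewrite xE ltnn.
Qed.

Let tree_leg x := projT1 (cid (tree_legP x)).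

Let tree_leg_root x : tree_leg x = None <-> x = root.
Proof. by have [] := projT2 (cid (tree_legP x)). Qed.

Let tree_leg_end x l : tree_leg x = Some l -> leg_end a b l = x.
Proof. by have [_ +] := projT2 (cid (tree_legP x)) => /[apply] -[]. Qed.

Let tree_leg_depth x l : tree_leg x = Some l -> (depth (p l.1) < depth x)%N.
Proof. by have [_ +] := projT2 (cid (tree_legP x)) => /[apply] -[]. Qed.

Let I : choiceType := {l : J * bool | tree_leg (leg_end a b l) != Some l}.

Let mkI l (lN : tree_leg (leg_end a b l) != Some l) : I :=
  exist (fun l => is_true (tree_leg (leg_end a b l) != Some l)) l lN.

(* Of the triangles at a vertex at maximal depth only one can contribute legs *)
(* of the tree.                                                               *)
Let extra_leg : exists i : I, True.
Proof.
have [E|[[j0 b0] E]] : tree_leg far = None \/ exists l, tree_leg far = Some l.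
- by case: (tree_leg far) => [l|]; [right; exists l|left].
- by move/tree_leg_root : E => E; move: far_neq_root; rewrite E eqxx.
have [y [yj0 fy]] : exists y, y \in val j0 /\ e far y.
  have [[epa epb _] _ _] := corners_spec j0; exists (p j0); rewrite valE !inE eqxx.
  split=> //; have <- := tree_leg_end E; rewrite /leg_end /=.
  by case: b0 {E}; rewrite e_sym.
have fj0 : far \in val j0.
  by have <- := tree_leg_end E; rewrite valE !inE /leg_end /=; case: b0 {E};
    rewrite eqxx ?orbT.
have [y' [fy' y'y y'Ny]] := branch fy.
have [j1 fj1 y'j1] := triangle_on fy'.
have j10 : j1 != j0.
  apply: contraNneq y'Ny => j10; rewrite j10 in y'j1.
  by have [|yy' _] := triangle_edge (valP j0) yj0 y'j1; first by rewrite eq_sym.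
have far_leg c : leg_end a b (j1, c) = far -> exists i : I, True.
  move=> cf; have lN : tree_leg (leg_end a b (j1, c)) != Some (j1, c).
    by rewrite cf E; apply: contra j10 => /eqP[->].
  by exists (mkI lN).
(* If [far] is the apex of the new triangle [j1], a tree leg of [j1] would end deeper than [far].
   Otherwise a leg of [j1] ends at [far], whose tree leg is in [j0]. *)
move: fj1; rewrite valE !inE -orbA => /or3P[] /eqP fE.
- have lN : tree_leg (leg_end a b (j1, true)) != Some (j1, true).
    apply/eqP => /tree_leg_depth /=; rewrite -fE ltnNge.
    by rewrite depth_far.
  by exists (mkI lN).
- exact: (far_leg true).
- exact: (far_leg false).
Qed.

Let corner j (o : option bool) :=
  match o with None => p j | Some true => a j | Some false => b j end.

Let corner_inj j : injective (corner j).
Proof.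
have := pa j; have := pb j; have := ab j.
by move=> + + + [[]|] [[]|] //= E; rewrite E ?eqxx.
Qed.

Let cornerP (j : J) x : x \in val j -> exists o, corner j o = x.
Proof.
rewrite valE !inE -orbA => /or3P[] /eqP ->;
by [exists None|exists (Some true)|exists (Some false)].
Qed.

Let corner_in (j : J) o : corner j o \in val j.
Proof. by rewrite valE !inE; case: o => [[]|] /=; rewrite eqxx ?orbT. Qed.

(** Enumerates the two corners different from [o]; a corner and a boolean thus index the six ordered
    edges of a triangle. *)
Let other (o : option bool) (c : bool) := match o with
  None => Some c | Some c' => if c then None else Some (~~ c') end.

Let other_neq o c : o != other o c.
Proof. by case: o c => [[]|] []. Qed.

Let other_inj o : injective (other o).
Proof. by case: o => [[]|] [] []. Qed.

Let otherP o o' : o != o' -> exists c, other o c = o'.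
Proof.
by case: o o' => [[]|] [[]|] //= _; by [exists true|exists false].
Qed.

(** Every ordered edge lies in a unique triangle, and every triangle has six of them. *)
Lemma card_flags n : [set: {xy : T * T | e xy.1 xy.2}] #= `I_n ->
  exists2 k, [set: J] #= `I_k & (6 * k = n)%N.
Proof.
move=> en; have [k Jk kn] : exists2 k, [set: J] #= `I_k &
    (k * #|{: option bool * bool}| = n)%N.
  apply: card_eq_prod_inv; first by rewrite card_prod card_option card_bool.
  apply: card_eq_trans en.
  have eo j o c : e (corner j o) (corner j (other o c)).
    have [] // := triangle_edge (valP j) (corner_in j o) (corner_in j (other o c)).
    by rewrite (inj_eq (@corner_inj j)) other_neq.
  apply: (@bijection_card_eq _ _ (fun z : J * (option bool * bool) =>
    exist (fun xy => is_true (e xy.1 xy.2))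
      (corner z.1 z.2.1, corner z.1 (other z.2.1 z.2.2)) (eo z.1 z.2.1 z.2.2))).
    move=> [i [k1 c]] [j [k2 c']] /(congr1 val) /= [E1 E2].
    have ij : i = j.
      apply/val_inj/(@triangle_uniq _ _ (corner i k1) (corner i (other k1 c))).
      - exact: valP.
      - exact: valP.
      - by rewrite (inj_eq (@corner_inj i)) other_neq.
      - exact: corner_in.
      - exact: corner_in.
      - by rewrite E1 corner_in.
      - by rewrite E2 corner_in.
    move: E1 E2; rewrite -{}ij => /corner_inj <- /corner_inj/other_inj <-; by [].
  move=> [[x y] /= xy]; have [j xj yj] := triangle_on xy.
  have [ko ox] := cornerP xj; have [ko' oy] := cornerP yj.
  have [c oc] : exists c, other ko c = ko'.
    by apply: otherP; apply: contraTneq (edge_neq xy) => oo; rewrite -ox -oy oo eqxx.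
  by exists (j, (ko, c)); apply: val_inj; rewrite /= oc ox oy.
by exists k => //; rewrite -kn card_prod card_option card_bool mulnC.
Qed.

Let card_corners (j : J) : #|` val j| = 3%N.
Proof.
rewrite valE fsetUC cardfsU1 cardfs2 !inE negb_or eq_sym pb eq_sym ab.
by rewrite pa.
Qed.

(** Tree legs correspond to the vertices other than the root through their far ends. Letting [unit]
    stand for the root gives a bijection from [I + T] to all legs plus one point. *)
Lemma card_non_tree_legs v k : [set: T] #= `I_v -> [set: J] #= `I_k ->
  exists2 m, [set: I] #= `I_m & (m + v = 2 * k + 1)%N.
Proof.
move=> Tv Jk.
have B2 : [set: bool] #= `I_2 by rewrite -card_bool; exact: card_finType.
have U1 : [set: unit] #= `I_1 by rewrite -card_unit; exact: card_finType.
have [m Im] := card_eq_injection (@val_inj _ _ I) (card_eq_prod Jk B2); exists m => //.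
rewrite mulnC; apply: (@card_eq_uniq (J * bool + unit)); last first.
  exact: card_eq_sum (card_eq_prod Jk B2) U1.
apply: card_eq_trans (card_eq_sum Im Tv); rewrite card_eq_sym.
apply: (@bijection_card_eq _ _ (fun z : I + T => match z with
  | inl i => inl (val i) : J * bool + unit
  | inr x => if tree_leg x is Some l then inl l else inr tt end)).
  move=> [i|x] [i'|x'] /=.
  - by move=> [ii']; rewrite (val_inj ii').
  - case E : (tree_leg x') => [l|]// [il]; have := valP i.
    by rewrite /= il (tree_leg_end E) E eqxx.
  - case E : (tree_leg x) => [l|]// [il]; have := valP i'.
    by rewrite /= -il (tree_leg_end E) E eqxx.
  - case E : (tree_leg x) => [l|]; case E' : (tree_leg x') => [l'|] //.
      by move=> [ll']; rewrite -(tree_leg_end E) ll' (tree_leg_end E').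
    by move/tree_leg_root : E => ->; move/tree_leg_root : E' => ->.
move=> [l|[]]; last by exists (inr root); case E : (tree_leg root) => [l|]//;
  have /tree_leg_root := erefl root; rewrite E.
have [E|E] := boolP (tree_leg (leg_end a b l) == Some l).
  by exists (inr (leg_end a b l)); rewrite (eqP E).
by exists (inl (mkI E)).
Qed.

(** There are one empty face, [v] vertices, [3 k] edges and [k] triangles, contributing -1, v, -3k
    and k. *)
Lemma euler_triangles v k : [set: T] #= `I_v -> [set: J] #= `I_k ->
  reduced_euler (clique_complex e) = v%:Z - 2 * k%:Z - 1.
Proof.
move=> /card_ord_bijection[f bf] /card_ord_bijection[g bg].
(* An edge is indexed by its only triangle and the corner removed from it. *)
pose h (z : unit + 'I_v + ('I_k * option bool) + 'I_k) : {fset T} := match z with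
  | inl (inl (inl _)) => fset0
  | inl (inl (inr i)) => [fset f i]%fset
  | inl (inr (i, o)) => (val (g i) `\ corner (g i) o)%fset
  | inr i => val (g i) end.
have h_card z : #|` h z| = match z with inl (inl (inl _)) => 0%N
    | inl (inl (inr _)) => 1%N | inl (inr _) => 2%N | inr _ => 3%N end.
  case: z => [[[[]|i]|[i k1]]|i] /=; rewrite ?cardfs0 ?cardfs1 ?card_corners//.
  have := cardfsD1 (corner (g i) k1) (val (g i)).
  by rewrite card_corners corner_in add1n => -[<-].
have two (s : {fset T}) : (1 < #|` s|)%N -> exists x y, [/\ x \in s, y \in s & x != y].
  move=> s1; have /fset0Pn[x xs] : s != fset0 by rewrite -cardfs_gt0; lia.
  have /fset0Pn[y] : (s `\ x)%fset != fset0.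
    by rewrite -cardfs_gt0; have := cardfsD1 x s; rewrite xs; lia.
  by rewrite !inE => /andP[yx ys]; exists x, y; rewrite eq_sym.
have hin z i : (h z `<=` val (g i))%fset -> (1 < #|` h z|)%N ->
    match z with inl (inr (i', _)) => i' = i | inr i' => i' = i | _ => True end.
  move=> /fsubsetP hs /two[x [y [xh yh xy]]].
  have key i' : (h z `<=` val (g i'))%fset -> i' = i.
    move=> /fsubsetP hs'; apply: (bij_inj bg); apply: val_inj.
    apply: (@triangle_uniq _ _ x y); rewrite ?(valP (g _))//;
    by [apply: hs'|apply: hs].
  by case: z hs xh yh key => [[//|[i' k1]]|i'] _ _ _ key; apply: key => //=;
    exact: fsubD1set.
rewrite /reduced_euler (@fsbig_fin_model _ _ _ h); first last.
- move=> s [->|es]; first by exists (inl (inl (inl tt))).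
  have [s0 es'] := es; have [j sj] := cover es; rewrite -valE in sj.
  have [f' _ fK] := bf; have [g' _ gK] := bg.
  have s3 : (#|` s| <= 3)%N by rewrite -(card_corners j); exact: fsubset_leq_card.
  have [s1|s1] := eqVneq #|` s| 1%N.
    have /cardfs1P[x ->] : #|` s| == 1%N by rewrite s1.
    by exists (inl (inl (inr (f' x)))); rewrite /= fK.
  have [s2|s2] := eqVneq #|` s| 3%N.
    exists (inr (g' j)); rewrite /= gK; apply/esym/eqP.
    by rewrite eqEfcard sj card_corners s2.
  have : #|` (val j `\` s)%fset| == 1%N.
    have s0' : (0 < #|` s|)%N by rewrite cardfs_gt0.
    have := cardfsID s (val j); rewrite (fsetIidPr sj) card_corners.
    by move: s1 s2 s3 s0'; lia.
  case/cardfs1P => x jsx; have xj : x \in val j.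
    by have : x \in (val j `\` s)%fset by [rewrite jsx inE]; rewrite inE => /andP[].
  have [ko ox] := cornerP xj; exists (inl (inr (g' j, ko))); rewrite /= gK ox.
  by rewrite -jsx fsetDDr fsetDv fset0U; apply/fsetIidPr.
- move=> z z' E; have cz := h_card z; have cz' := h_card z'; rewrite E cz' in cz.
  have hin' i := @hin z' i; have hz' := h_card z'.
  case: z E cz => [[[[]|i]|[i k1]]|i]; case: z' cz' hin' hz'
    => [[[[]|i']|[i' k2]]|i'] //= cz' hin' hz' E _.
  + by move/fsetP: E => /(_ (f i)); rewrite !inE eqxx => /esym/eqP/(bij_inj bf) ->.
  + have ii : i' = i by apply: hin'; rewrite ?hz'// -E; exact: fsubD1set.
    subst i'; congr (inl (inr (_, _))); apply: (@corner_inj (g i)).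
    have /fsetP/(_ (corner (g i) k2)) := E; rewrite !inE eqxx corner_in /= andbT.
    by move=> /negbFE/eqP ->.
  + by congr inr; symmetry; apply: hin'; rewrite ?hz' ?E.
- case=> [[[[]|i]|[i k1]]|i] /=; [by left|right..].
  + exact: vertex_clique.
  + split; first by rewrite -cardfs_gt0 (h_card (inl (inr (i, k1)))).
    move=> x y; rewrite !inE => /andP[_ xi] /andP[_ yi] xy.
    by have [] := triangle_edge (valP (g i)) xi yi xy.
  + by split; [rewrite -cardfs_gt0 card_corners|move=> x y xi yi xy;
      have [] := triangle_edge (valP (g i)) xi yi xy].
rewrite (eq_bigr (fun z => (-1) ^+ (match z with inl (inl (inl _)) => 0%N
    | inl (inl (inr _)) => 1%N | inl (inr _) => 2%N | inr _ => 3%N end).+1));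
  last by move=> z _; rewrite h_card.
rewrite !big_sumType /= !sumr_const card_prod !card_ord card_option card_bool card_unit.
rewrite -signr_odd /= expr1 -[(-1) ^+ 2]signr_odd -[(-1) ^+ 3]signr_odd.
rewrite -[(-1) ^+ 4]signr_odd /= expr0 expr1 !mulNrn; lia.
Qed.

Theorem graph_of_triangles_wedge (R : realType) : exists I : choiceType,
  homotopy_equivalent R (realization R (clique_complex e)) (wedge_of_circles R I) /\
  forall v n, [set: T] #= `I_v -> [set: {xy : T * T | e xy.1 xy.2}] #= `I_n ->
    exists2 m, [set: I] #= `I_m & exists2 k, (6 * k = n)%N &
      (m + v = 2 * k + 1)%N /\
      reduced_euler (clique_complex e) = v%:Z - 2 * k%:Z - 1.
Proof.
exists I; have [i0 _] := extra_leg; split.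
  exact: (triangle_complex_wedge pa pb ab faceJ cover meet vertexX depth_le
    depth_root tree_leg_root tree_leg_end tree_leg_depth i0).
move=> v n Tv /card_flags[k Jk kn]; have [m Im mv] := card_non_tree_legs Tv Jk.
by exists m => //; exists k => //; split => //; exact: euler_triangles.
Qed.

End GraphOfTriangles.

(** * Hyperbolic planes and the orthogonality graph *)

Section HyperbolicPlanes.
Context {K : fieldType} {V : vectType K} (Psi : {skew_symmetric V}).
Hypothesis alt : Defs.alternating Psi.
Local Notation "''[' u , v ]" := (Psi u v) : ring_scope.
Local Notation orthov := (orthov Psi).

Lemma formC u v : '[u, v] = - '[v, u].
Proof. by rewrite hermC expr1 mulN1r. Qed.

Lemma formDl u v w : '[u + v, w] = '[u, w] + '[v, w]. Proof. exact: linearDl. Qed.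
Lemma formDr u v w : '[w, u + v] = '[w, u] + '[w, v]. Proof. exact: linearDr. Qed.
Lemma formZl a u v : '[a *: u, v] = a * '[u, v]. Proof. exact: linearZl_LR. Qed.
Lemma formZr a u v : '[v, a *: u] = a * '[v, u]. Proof. exact: linearZr_LR. Qed.
Lemma formNl u v : '[- u, v] = - '[u, v]. Proof. exact: linearNl. Qed.
Lemma formNr u v : '[v, - u] = - '[v, u]. Proof. exact: linearNr. Qed.
Lemma form0l v : '[0, v] = 0. Proof. exact: linear0l. Qed.
Lemma form0r v : '[v, 0] = 0. Proof. exact: linear0r. Qed.

Definition formE := (formDl, formDr, formZl, formZr, formNl, formNr, form0l, form0r).

Definition plane e f : {vspace V} := (<[e]> + <[f]>)%VS.

Lemma plane_l e f : e \in plane e f.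
Proof. by apply: (subvP (addvSl _ _)); exact: memv_line. Qed.

Lemma plane_r e f : f \in plane e f.
Proof. by apply: (subvP (addvSr _ _)); exact: memv_line. Qed.

Lemma plane_sub e f (U : {vspace V}) : (plane e f <= U)%VS = (e \in U) && (f \in U).
Proof. by rewrite subv_add. Qed.

Lemma mem_orthov_plane e f v :
  (v \in orthov (plane e f)) = ('[v, e] == 0) && ('[v, f] == 0).
Proof. by rewrite memvE orthovD !orthov11. Qed.

Lemma orthov_form (U W : {vspace V}) u v :
  (U <= orthov W)%VS -> u \in U -> v \in W -> '[u, v] = 0.
Proof. by move/orthovP; apply. Qed.

(** When ['[e, f] = 1], this is the projection to the plane along its orthogonal. *)
Definition plane_proj e f v := '[v, f] *: e + '[e, v] *: f.

Lemma plane_proj_in e f v : plane_proj e f v \in plane e f.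
Proof. by rewrite memv_add// memvZ// memv_line. Qed.

Lemma form_plane_proj e f v : '[e, f] = 1 ->
  '[plane_proj e f v, e] = '[v, e] /\ '[plane_proj e f v, f] = '[v, f].
Proof.
move=> ef; rewrite /plane_proj !formE !alt ef (formC f e) ef (formC e v).
by split; ring.
Qed.

Lemma sub_plane_proj e f v : '[e, f] = 1 ->
  v - plane_proj e f v \in orthov (plane e f).
Proof.
move=> ef; have [] := form_plane_proj v ef; move: (plane_proj e f v) => w we wf.
by rewrite mem_orthov_plane !formE we wf !subrr eqxx.
Qed.

Lemma mem_plane e f v : '[e, f] = 1 -> v \in plane e f -> v = plane_proj e f v.
Proof.
move=> ef /memv_addP[_ /vlineP[a ->] [_ /vlineP[b ->] ->]].
by rewrite /plane_proj !formE !alt ef; congr (_ *: _ + _ *: _); ring.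
Qed.

Lemma plane_nondegenerate e f : '[e, f] = 1 -> nondegenerate_on Psi (plane e f).
Proof.
move=> ef; rewrite /nondegenerate_on -subv0; apply/subvP => v.
rewrite memv_cap mem_orthov_plane => /and3P[vP /eqP ve /eqP vf].
by rewrite (mem_plane ef vP) /plane_proj vf (formC e v) ve oppr0 !scale0r addr0 mem0v.
Qed.

Lemma form_neq0 e f : '[e, f] = 1 -> (e != 0) * (f != 0).
Proof.
move=> ef; split; apply: contraTneq isT => z; move: ef; rewrite z !formE => /eqP;
by rewrite eq_sym oner_eq0.
Qed.

Lemma dim_plane e f : '[e, f] = 1 -> \dim (plane e f) = 2.
Proof.
move=> ef; have [e0 f0] := form_neq0 ef.
rewrite /plane dimv_disjoint_sum ?dim_vline ?e0 ?f0//.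
apply/eqP; rewrite -subv0; apply/subvP => v; rewrite memv_cap.
move=> /andP[/vlineP[a ->]] /vlineP[b /(congr1 (fun v => '[v, f]))].
by rewrite !formE alt ef mulr1 mulr0 => ->; rewrite scale0r mem0v.
Qed.

Lemma frame_vertex_plane e f : '[e, f] = 1 ->
  (\dim (plane e f) == 2) && nondegenerate_on Psi (plane e f).
Proof. by move=> ef; rewrite dim_plane// eqxx plane_nondegenerate. Qed.

Definition plane_vertex e f (ef : '[e, f] = 1) : frame_vertex Psi :=
  exist (fun U => is_true ((\dim U == 2) && nondegenerate_on Psi U)) _
    (frame_vertex_plane ef).

Lemma hyperbolic_pair (Y : {vspace V}) : ~~ (Y <= orthov Y)%VS ->
  exists e f, [/\ e \in Y, f \in Y & '[e, f] = 1].
Proof.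
move=> /subvPn[e eY /mem_orthovPn[f fY ef]].
exists e, ('[e, f]^-1 *: f); split => //; first exact: memvZ.
by rewrite !formE mulVf.
Qed.

Lemma eq_plane e f (U : {vspace V}) : '[e, f] = 1 -> \dim U = 2%N ->
  e \in U -> f \in U -> U = plane e f.
Proof.
move=> ef U2 eU fU; apply/esym/eqP; rewrite eqEdim dim_plane// U2 leqnn andbT.
by rewrite plane_sub eU.
Qed.

Lemma vertexP (U : frame_vertex Psi) : exists e f, '[e, f] = 1 /\ val U = plane e f.
Proof.
have /andP[/eqP U2 /eqP Un] := valP U.
have [|e [f [eU fU ef]]] := @hyperbolic_pair (val U).
  by apply/negP => /capv_idPl; rewrite Un => U0; move: U2; rewrite -U0 dimv0.
by exists e, f; split => //; exact: eq_plane.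
Qed.

(** Each vector of a basis of [U] imposes one linear condition, which lowers the dimension by at
    most one, whether or not the form is degenerate. *)
Lemma dim_orthov_cap (W U : {vspace V}) :
  (\dim W <= \dim (W :&: orthov U) + \dim U)%N.
Proof.
have key (X : seq V) : (\dim W <= \dim (W :&: orthov <<X>>) + size X)%N.
  elim: X => [|x X IH]; first by rewrite span_nil orthov0 capvf addn0.
  have -> : (orthov <<x :: X>> = orthov <<X>> :&: orthov <[x]>)%VS.
    apply/eqP; rewrite eqEsubv; apply/andP; split.
      by have := subvv (orthov <<x :: X>>); rewrite {2}span_cons orthovD subv_cap andbC.
    by rewrite span_cons orthovD capvSr capvSl.
  have := leq_dim_orthov1 Psi x (W :&: orthov <<X>>); rewrite capvA /=.
  by move: IH; lia.
by have := key (vbasis U); rewrite size_tuple (span_basis (vbasisP U)).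
Qed.

Lemma dim_orthov (U : {vspace V}) : (\dim {:V} <= \dim (orthov U) + \dim U)%N.
Proof. by have := dim_orthov_cap fullv U; rewrite capfv. Qed.

(** A substitute for nondegeneracy of [Q] that makes sense beside a radical and is preserved when an
    orthogonal hyperbolic plane is added. *)
Definition splits (Q : {vspace V}) := ({:V} <= Q + orthov Q)%VS.

Lemma splits0 : splits 0.
Proof. by rewrite /splits orthov0 addvSr. Qed.

Lemma splits_plane (Q : {vspace V}) e f : '[e, f] = 1 -> splits Q ->
  (plane e f <= orthov Q)%VS -> splits (plane e f + Q).
Proof.
move=> ef sQ PQ; apply/subvP => v _; have /(subvP sQ) := memvf v.
move=> /memv_addP[q qQ [w wQ ->]].
have [pP wP] := (plane_proj_in e f w, sub_plane_proj w ef).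
rewrite (_ : q + w = (plane_proj e f w + q) + (w - plane_proj e f w)); last first.
  by rewrite [plane_proj _ _ _ + q]addrC -addrA [plane_proj _ _ _ + _]addrC subrK.
apply: memv_add; first exact: memv_add.
rewrite memvE orthovD; apply/andP; split; first by rewrite -memvE.
by rewrite -memvE memvB// (subvP PQ).
Qed.

(** A vector orthogonal to both [Q] and [orthov Q] is orthogonal to their sum, which is the whole
    space. *)
Lemma orthov_radical (Q : {vspace V}) : splits Q ->
  (orthov Q <= orthov (orthov Q))%VS -> (orthov Q <= orthov fullv)%VS.
Proof.
move=> sQ QQ; rewrite orthov_sym; apply: subv_trans sQ _.
by rewrite subv_add orthov_sym subvv.
Qed.

(* The orthogonal of Q is too large to be contained in the radical. *)
Lemma orthov_hyperbolic_pair r (Q : {vspace V}) : \dim (orthov fullv) = r ->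
  splits Q -> (\dim Q + r < \dim {:V})%N ->
  exists e f, [/\ e \in orthov Q, f \in orthov Q & '[e, f] = 1].
Proof.
move=> rad sQ Qr; apply: hyperbolic_pair; apply/negP => /(orthov_radical sQ)/dimvS.
by rewrite rad; have := dim_orthov Q; move: Qr; lia.
Qed.

Lemma not_radical (v : V) : v \notin orthov fullv -> exists w, '[v, w] = 1.
Proof.
move=> /mem_orthovPn[w _ vw]; exists ('[v, w]^-1 *: w).
by rewrite !formE mulVf.
Qed.

Lemma edgeP (U W : frame_vertex Psi) : reflect {in val U & val W, forall u w, '[u, w] = 0}
  (orthogonality_graph Psi U W).
Proof. exact: orthovP. Qed.

Lemma edge_sym : symmetric (orthogonality_graph Psi).
Proof. by move=> U W; rewrite /orthogonality_graph orthov_sym. Qed.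

Lemma edge_irr : irreflexive (orthogonality_graph Psi).
Proof.
move=> U; apply/negbTE/negP => /capv_idPl; have /andP[/eqP U2 /eqP ->] := valP U.
by move=> U0; move: U2; rewrite -U0 dimv0.
Qed.

Lemma walk3 r (U W : frame_vertex Psi) : \dim (orthov fullv) = r ->
  (6 + r <= \dim {:V})%N -> walk (orthogonality_graph Psi) U W 3.
Proof.
move=> rad D6; have [e [f [ef UE]]] := vertexP U; have [g [h [gh WE]]] := vertexP W.
(* The sum has dimension at most 4, so its orthogonal has dimension at least [2 + r], more than the
   radical. *)
have : ~~ (orthov (val U + val W) <= orthov fullv)%VS.
  apply/negP => /dimvS; rewrite rad; have := dim_orthov (val U + val W).
  have := dimv_add_leqif (val U) (val W); rewrite UE WE !dim_plane//.
  by move=> []; move: D6; lia.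
move=> /subvPn[u uS uR]; have [z uz] := not_radical uR.
have /andP[uU uW] : (u \in orthov (val U)) && (u \in orthov (val W)).
  by move: uS; rewrite !memvE orthovD.
(* The path is U, <u, z1>, X, W with X orthogonal to <u, z2> + W, which contains z1. *)
pose z1 := z - plane_proj e f z; pose z2 := z1 - plane_proj g h z1.
have uz1 : '[u, z1] = 1.
  rewrite /z1 formDr formNr uz (mem_orthovP uU) ?subr0// UE; exact: plane_proj_in.
have uz2 : '[u, z2] = 1.
  rewrite /z2 formDr formNr uz1 (mem_orthovP uW) ?subr0// WE; exact: plane_proj_in.
have z1U : z1 \in orthov (val U) by rewrite UE; exact: sub_plane_proj.
have z2W : z2 \in orthov (val W) by rewrite WE; exact: sub_plane_proj.
have sQ : splits (plane u z2 + (val W + 0)).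
  apply: splits_plane => //; last first.
    by rewrite orthovD orthov0 subvf andbT plane_sub uW.
  by rewrite WE; apply: splits_plane => //; [exact: splits0|rewrite orthov0 subvf].
rewrite addv0 in sQ.
have [|x [y [xQ yQ xy]]] := orthov_hyperbolic_pair rad sQ.
  have [] := dimv_add_leqif (plane u z2) (val W); rewrite WE !dim_plane//.
  by move: D6; lia.
move: xQ yQ; rewrite !(memvE _ (orthov _)) !orthovD -!memvE => /andP[xu xW] /andP[yu yW].
exists [:: plane_vertex uz1; plane_vertex xy; W]; split => //=.
rewrite /orthogonality_graph /= andbT; apply/and3P; split.
- by rewrite orthov_sym plane_sub uU.
- have z1E : z1 = z2 + plane_proj g h z1 by rewrite /z2 addrNK.
  have P1 : (plane u z1 <= plane u z2 + val W)%VS.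
    rewrite plane_sub (subvP (addvSl _ _) _ (plane_l _ _)) /= z1E memv_add//.
      exact: plane_r.
    by rewrite WE; exact: plane_proj_in.
  apply: subv_trans P1 _; rewrite orthov_sym plane_sub !(memvE _ (orthov _)) !orthovD.
  by rewrite -!memvE xu xW yu.
- by rewrite plane_sub xW.
Qed.

End HyperbolicPlanes.

Lemma has_diameter_of_walks (T : eqType) (e : rel T) d :
  (forall x y, exists2 k, walk e x y k & (k <= d)%N) ->
  (exists x y, forall k, walk e x y k -> (d <= k)%N) -> has_diameter e d.
Proof.
move=> le_d [x0 [y0 ge_d]].
have dist x y : exists2 k, graph_distance e x y k & (k <= d)%N.
  have [k xyk kd] := le_d x y.
  have ex : exists k, `[< walk e x y k >] by exists k; apply/asboolP.
  case: (ex_minnP ex) => m /asboolP xym mmin; exists m.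
    by split=> // j xyj; apply: mmin; apply/asboolP.
  by apply: leq_trans kd; apply: mmin; apply/asboolP.
split=> //; exists x0, y0; have [k xyk kd] := dist x0 y0.
by have [/ge_d dk _] := xyk; rewrite (_ : d = k)//; apply/eqP; rewrite eqn_leq dk.
Qed.

Lemma walk_small (T : eqType) (e : rel T) x y k : walk e x y k ->
  [/\ k = 0%N -> x = y, k = 1%N -> e x y & k = 2%N -> exists z, e x z /\ e z y].
Proof.
move=> [p [pp <- <-]]; split; case: p pp => [|z [|t []]] //=.
  by rewrite andbT.
by rewrite andbT => /andP[]; exists z.
Qed.

(** * Components, diameters and triangles of the orthogonality graph *)

Section FrameGraph.
Context {K : fieldType} {V : vectType K} (Psi : {skew_symmetric V}).
Hypothesis alt : Defs.alternating Psi.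
Local Notation "''[' u , v ]" := (Psi u v) : ring_scope.
Local Notation orthov := (orthov Psi).
Local Notation plane := (@plane K V).
Local Notation graph := (orthogonality_graph Psi).

Lemma splits_plane1 e f : '[e, f] = 1 -> splits Psi (plane e f).
Proof.
move=> ef; rewrite -[plane e f]addv0; apply: splits_plane => //; first exact: splits0.
by rewrite orthov0 subvf.
Qed.

Lemma two_hyperbolic_pairs r : \dim (orthov fullv) = r -> (4 + r <= \dim {:V})%N ->
  exists e f e' f', [/\ '[e, f] = 1, '[e', f'] = 1,
    e' \in orthov (plane e f) & f' \in orthov (plane e f)].
Proof.
move=> rad D4.
have [|e [f [_ _ ef]]] := orthov_hyperbolic_pair rad (splits0 Psi).
  by rewrite dimv0; lia.
have sP := splits_plane1 ef.
have [|e' [f' [eP fP ef']]] := orthov_hyperbolic_pair rad sP.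
  by rewrite (dim_plane alt ef); lia.
by exists e, f, e', f'.
Qed.

Lemma splits_edge (U W : frame_vertex Psi) : graph U W -> splits Psi (val U + val W)%VS.
Proof.
have [e [f [ef UE]]] := vertexP alt U; have [g [h [gh WE]]] := vertexP alt W.
rewrite /orthogonality_graph UE WE => UW.
by apply: splits_plane => //; exact: splits_plane1.
Qed.

Lemma vertex_dim (U : frame_vertex Psi) : \dim (val U) = 2%N.
Proof. by have /andP[/eqP] := valP U. Qed.

Lemma vertex_cap (U : frame_vertex Psi) : (val U :&: orthov (val U) = 0)%VS.
Proof. by have /andP[_ /eqP] := valP U. Qed.

Lemma edge_cap (U W : frame_vertex Psi) : graph U W -> (val U :&: val W = 0)%VS.
Proof.
move=> UW; apply/eqP; rewrite -subv0 -(vertex_cap W) subv_cap capvSr/=.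
exact: subv_trans (capvSl _ _) UW.
Qed.

Lemma dim_edge (U W : frame_vertex Psi) : graph U W -> \dim (val U + val W)%VS = 4%N.
Proof. by move=> /edge_cap UW; rewrite dimv_disjoint_sum// !vertex_dim. Qed.

(* With radical of codimension 4, the components are visible modulo the       *)
(* radical: each consists of the lifts of a plane and of its orthogonal.      *)
Lemma disconnected_rank4 (R : realType) r : \dim (orthov fullv) = r ->
  \dim {:V} = (4 + r)%N -> ~ connected [set: realization R (frame_complex Psi)].
Proof.
move=> rad D4; have D4' : (4 + r <= \dim {:V})%N by rewrite D4.
have [e [f [e' [f' [ef ef' eP fP]]]]] := two_hyperbolic_pairs rad D4'.
have ef1 : '[e, f + e'] = 1.
  move: eP; rewrite mem_orthov_plane => /andP[/eqP e'e _].
  by rewrite formDr ef (formC _ e e') e'e oppr0 addr0.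
(* [U1] avoids the component of [U0]: pairing [f + e'] with [f'] shows that it is not in [U0] plus
   the radical, and ['[e, f] = 1] that the planes are not orthogonal. *)
pose U0 := plane_vertex alt ef; pose U1 := plane_vertex alt ef1.
pose S : set (frame_vertex Psi) :=
  [set U | (val U <= val U0 + orthov fullv)%VS || graph U U0].
have vX (U : frame_vertex Psi) : simplices (frame_complex Psi) [fset U]%fset.
  split; first by apply/fset0Pn; exists U; rewrite inE.
  by move=> x y; rewrite !inE => /eqP -> /eqP ->; rewrite eqxx.
have Rperp (U : {vspace V}) : (orthov fullv <= orthov U)%VS.
  by rewrite orthov_sym; apply: subv_trans (subvf U) _; rewrite orthov_sym.
apply: (@disconnected_realization _ _ _ S U0 U1) => //.
- by rewrite /S /= addvSl.
- rewrite /S /= => /orP[|/edgeP UU].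
    rewrite plane_sub => /andP[_] /memv_addP[u uU [w wR /(congr1 (fun v => '[v, f']))]].
    rewrite formDl ef' formDl.
    have -> : '[f, f'] = 0.
      by move: fP; rewrite mem_orthov_plane => /andP[_ /eqP ff]; rewrite formC ff oppr0.
    have -> : '[u, f'] = 0.
      by rewrite formC; have/mem_orthovP -> := fP; rewrite ?oppr0.
    rewrite (mem_orthovP wR) ?memvf// !addr0 add0r => /eqP.
    by rewrite oner_eq0.
  have := UU e f (plane_l _ _) (plane_r _ _); rewrite ef => /eqP.
  by rewrite oner_eq0.
move=> s x y [_ es] xs ys; have [->//|xy] := eqVneq x y.
have {es} xy : graph x y by exact: es.
(* If [x] lies in [U0] plus the radical, then by dimension the two have the same sum with the
   radical, so what is orthogonal to [x] is orthogonal to [U0]. *)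
rewrite /S /= => /orP[xU|xU]; apply/orP; [right|left].
  have cap0 : (val x :&: orthov fullv = 0)%VS.
    by apply/eqP; rewrite -subv0 -(vertex_cap x) capvS.
  have capU0 : (val U0 :&: orthov fullv = 0)%VS.
    by apply/eqP; rewrite -subv0 -(vertex_cap U0) capvS.
  have xRE : (val x + orthov fullv = val U0 + orthov fullv)%VS.
    apply/eqP; rewrite eqEdim subv_add xU addvSr/=.
    by rewrite (dimv_disjoint_sum cap0) (dimv_disjoint_sum capU0) !vertex_dim.
  rewrite /orthogonality_graph orthov_sym.
  apply: (subv_trans (addvSl (val U0) (orthov fullv))).
  by rewrite -xRE subv_add (xy : (val x <= orthov (val y))%VS) Rperp.
(* If [x] is orthogonal to [U0], only the radical is orthogonal to both. A vector orthogonal to [x],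
   minus its projection to [U0], is therefore radical. *)
have YR : (orthov (val x + val U0) = orthov fullv)%VS.
  apply/esym/eqP; rewrite eqEdim Rperp/= rad.
  have YQ : ((val x + val U0) :&: orthov (val x + val U0) = 0)%VS.
    apply/eqP; rewrite -subv0; apply/subvP => v; rewrite memv_cap => /andP[vQ vY].
    have vR : v \in orthov fullv.
      rewrite memvE orthov_sym; apply: subv_trans (splits_edge xU) _.
      rewrite subv_add orthov_sym -memvE vY orthov_sym/=.
      apply/orthovP => a b /vlineP[k ->] bY; rewrite formZl.
      by rewrite formC (mem_orthovP bY)// oppr0 mulr0.
    have [u ux [w wU vE]] := memv_addP vQ.
    have ux' : u \in orthov (val x).
      rewrite (_ : u = v - w); last by rewrite vE addrK.
      rewrite memvB// ?(subvP (Rperp _) _ vR)//.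
      by move: wU; rewrite !memvE => /subv_trans; apply; rewrite orthov_sym.
    have wU' : w \in orthov (val U0).
      rewrite (_ : w = v - u); last by rewrite vE addrC addKr.
      rewrite memvB// ?(subvP (Rperp _) _ vR)//.
      by move: ux; rewrite !memvE => /subv_trans; apply.
    rewrite vE memvD//.
    - by rewrite -(vertex_cap x) memv_cap ux.
    - by rewrite -(vertex_cap U0) memv_cap wU.
  have := dimvS (subvf ((val x + val U0) + orthov (val x + val U0))%VS).
  by rewrite (dimv_disjoint_sum YQ) (dim_edge xU) D4 leq_add2l.
apply/subvP => w wy; have [g [h [gh xE]]] := vertexP alt x.
pose w1 := w - plane_proj Psi e f w.
have w1U : w1 \in orthov (val U0) by exact: sub_plane_proj.
have w1x : w1 \in orthov (val x).
  rewrite memvB//.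
    by move: wy; rewrite !memvE => /subv_trans; apply; rewrite orthov_sym.
  have := plane_proj_in Psi e f w; rewrite !memvE => /subv_trans; apply.
  by rewrite orthov_sym.
rewrite (_ : w = plane_proj Psi e f w + w1); last by rewrite /w1 addrC subrK.
apply: memv_add; first exact: plane_proj_in.
by rewrite -YR memvE orthovD -!memvE w1x.
Qed.

Hypothesis rad0 : \dim (orthov fullv) = 0%N.

Lemma radical0 : (orthov fullv = 0)%VS.
Proof. by apply/eqP; rewrite -dimv_eq0 rad0. Qed.

(** A vector of [U] orthogonal to a complement of [orthov U] is orthogonal to everything, hence
    zero; so the dimension of [U] is at most that of the complement. *)
Lemma dim_orthov_eq (U : {vspace V}) : (\dim (orthov U) + \dim U = \dim {:V})%N.
Proof.
have := dim_orthov_cap Psi U (orthov U)^C%VS; have := dim_orthov Psi U.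
rewrite dimv_compl; have := dimvS (subvf (orthov U)).
suff -> : (U :&: orthov (orthov U)^C = 0)%VS by rewrite dimv0; lia.
apply/eqP; rewrite -subv0 -radical0; apply/subvP => v; rewrite memv_cap => /andP[vU vC].
rewrite -(addv_complf (orthov U)) memvE orthovD -!memvE vC andbT.
by rewrite memvE orthov_sym; apply/orthovP => a b aU /vlineP[k ->];
  rewrite formZr (mem_orthovP aU)// mulr0.
Qed.

Lemma orthov_orthov (U : {vspace V}) : orthov (orthov U) = U.
Proof.
apply/esym/eqP; rewrite eqEdim orthov_sym subvv/=.
by have := dim_orthov_eq U; have := dim_orthov_eq (orthov U); lia.
Qed.

(** Without a hyperbolic pair, the orthogonal [Y] of [U + W] would lie in [U + W] by biduality while
    meeting [U] trivially; then [U + W] would have dimension at least 5. *)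
Lemma common_neighbor (U W : frame_vertex Psi) : (8 <= \dim {:V})%N ->
  exists X, graph U X /\ graph X W.
Proof.
move=> D8; pose Y := orthov (val U + val W).
have [|e [f [eY fY ef]]] := @hyperbolic_pair _ _ Psi Y.
  apply/negP; rewrite orthov_orthov => YQ.
  have UY : (val U :&: Y = 0)%VS.
    apply/eqP; rewrite -subv0 -(vertex_cap U) capvS// /Y orthov_sym.
    by apply: subv_trans (addvSl (val U) (val W)) _; rewrite orthov_sym.
  have := dimvS (_ : (val U + Y <= val U + val W)%VS); rewrite subv_add addvSl YQ.
  move=> /(_ isT); rewrite dimv_disjoint_sum//.
  have [] := dimv_add_leqif (val U) (val W); have := dim_orthov_eq (val U + val W).
  by rewrite -/Y !vertex_dim; lia.
move: eY fY; rewrite /Y !(memvE _ (orthov _)) !orthovD -!memvE.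
move=> /andP[eU eW] /andP[fU fW]; exists (plane_vertex alt ef).
by rewrite edge_sym /orthogonality_graph /= !plane_sub eU eW fU fW.
Qed.

(** The planes on [e, f] and on [e, f + e'] are distinct and share [e], which pairs to 1 with
    [f + e']: they are not orthogonal. *)
Lemma frame_diameter2 : (8 <= \dim {:V})%N -> has_diameter graph 2.
Proof.
move=> D8; apply: has_diameter_of_walks => [U W|].
  have [X [UX XW]] := common_neighbor U W D8.
  by exists 2%N => //; exists [:: X; W]; rewrite /= UX XW.
have [|e [f [e' [f' [ef ef' eP fP]]]]] := two_hyperbolic_pairs rad0; first by lia.
move: eP fP; rewrite !mem_orthov_plane => /andP[/eqP e'e /eqP e'f].
move=> /andP[/eqP f'e /eqP f'f].
have ef1 : '[e, f + e'] = 1 by rewrite formDr ef (formC _ e e') e'e oppr0 addr0.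
exists (plane_vertex alt ef), (plane_vertex alt ef1) => -[|[|//]] /walk_small[E0 E1 _].
  have /(congr1 val) /= E := E0 erefl.
  have : f + e' \in plane e f by rewrite E; exact: plane_r.
  move=> /(mem_plane alt ef)/(congr1 (fun v => '[v, f'])); rewrite /plane_proj !formE.
  rewrite ef' (formC _ e f') (formC _ f f') f'e f'f oppr0 !mulr0 !addr0 add0r => /eqP.
  by rewrite oner_eq0.
have /edgeP/(_ e (f + e') (plane_l _ _) (plane_r _ _)) := E1 erefl.
by rewrite ef1 => /eqP; rewrite oner_eq0.
Qed.

Lemma connected_frame_complex (R : realType) r : \dim (orthov fullv) = r ->
  (6 + r <= \dim {:V})%N -> connected [set: realization R (frame_complex Psi)].
Proof.
move=> rad D6; apply: connected_clique_complex; last exact: edge_sym.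
by move=> U W; have [p [pp pW _]] := walk3 alt U W rad D6; exists p.
Qed.

Section Rank6.
Hypothesis D6 : \dim {:V} = 6%N.

(** In dimension 6 the orthogonal of [U + W] is a plane; common neighbours lie in it and so equal
    it. *)
Lemma third_vertex (U W : frame_vertex Psi) : graph U W ->
  exists X, [/\ graph U X, graph W X & forall Z, graph U Z -> graph W Z -> Z = X].
Proof.
move=> UW; have [|e [f [eQ fQ ef]]] := orthov_hyperbolic_pair rad0 (splits_edge UW).
  by rewrite dim_edge// D6.
pose X := plane_vertex alt ef.
have Q2 : \dim (orthov (val U + val W)) = 2%N.
  by have := dim_orthov_eq (val U + val W)%VS; rewrite dim_edge// D6; lia.
have XE Z : graph U Z -> graph W Z -> val Z = orthov (val U + val W).
  rewrite ![graph _ Z]edge_sym /orthogonality_graph => UZ WZ; apply/eqP.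
  by rewrite eqEdim orthovD UZ WZ vertex_dim Q2.
have XQ : (plane e f <= orthov (val U + val W))%VS by rewrite plane_sub eQ.
move: XQ; rewrite orthovD => /andP[XU XW].
exists X; split; [by rewrite edge_sym|by rewrite edge_sym|].
by move=> Z UZ WZ; apply: val_inj; rewrite (XE Z)// (XE X)// edge_sym.
Qed.

Lemma frame_neighbor (U : frame_vertex Psi) : exists W, graph U W.
Proof.
have [e [f [ef UE]]] := vertexP alt U.
have [|e' [f' [eP fP ef']]] := orthov_hyperbolic_pair rad0 (splits_plane1 ef).
  by rewrite (dim_plane alt ef) D6.
by exists (plane_vertex alt ef'); rewrite edge_sym /orthogonality_graph UE /= plane_sub eP.
Qed.

(** Shifting one basis vector of [W] by a vector [g] of the third vertex keeps the plane orthogonal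
    to [U], moves it off [W], and leaves it with [e] in common with [W], to which it is thus not
    orthogonal. *)
Lemma frame_branch (U W : frame_vertex Psi) : graph U W ->
  exists W', [/\ graph U W', W' != W & ~~ graph W W'].
Proof.
move=> UW; have [X [UX WX _]] := third_vertex UW.
have [e [f [ef WE]]] := vertexP alt W; have [g [h [gh XE]]] := vertexP alt X.
have fe z : z \in val W -> '[z, g] = 0 /\ '[z, h] = 0.
  move=> zW; split; apply: (orthov_form WX) => //; rewrite XE;
  by [exact: plane_l|exact: plane_r].
have [eg eh] : '[e, g] = 0 /\ '[e, h] = 0 by apply: fe; rewrite WE plane_l.
have eW1 : '[e, f + g] = 1 by rewrite formDr ef eg addr0.
exists (plane_vertex alt eW1); split.
- have /andP[eU fU] : (e \in orthov (val U)) && (f \in orthov (val U)).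
    by move: UW; rewrite edge_sym /orthogonality_graph WE plane_sub.
  have /andP[gU _] : (g \in orthov (val U)) && (h \in orthov (val U)).
    by move: UX; rewrite edge_sym /orthogonality_graph XE plane_sub.
  by rewrite edge_sym /orthogonality_graph /= plane_sub eU memvD.
- apply/eqP => /(congr1 val) /= E.
  have : f + g \in val W by rewrite /= -E; exact: plane_r.
  move=> /fe[_]; rewrite formDl gh.
  have [_ ->] : '[f, g] = 0 /\ '[f, h] = 0 by apply: fe; rewrite WE plane_r.
  by rewrite add0r => /eqP; rewrite oner_eq0.
- apply/negP => /edgeP/(_ e (f + g)); rewrite eW1 WE => E.
  by have /eqP := E (plane_l _ _) (plane_r _ _); rewrite oner_eq0.
Qed.

(** For [U] on [e, f] and [W] on [e + e', f + a], the intersection is zero and [e'] lies in [U + W]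
    while being orthogonal to it. A common neighbour would have to be the orthogonal of [U + W],
    which is degenerate because of [e']. *)
Lemma frame_far : exists U W : frame_vertex Psi,
  forall k, walk graph U W k -> (3 <= k)%N.
Proof.
have [|e [f [e' [f' [ef ef' eP fP]]]]] := two_hyperbolic_pairs rad0; first by rewrite D6.
have sQ : splits Psi (plane e' f' + plane e f).
  by apply: splits_plane; rewrite ?plane_sub ?eP//; exact: splits_plane1.
have [|a [b [aQ bQ ab]]] := orthov_hyperbolic_pair rad0 sQ.
  have [] := dimv_add_leqif (plane e' f') (plane e f).
  by rewrite !(dim_plane alt)// D6; lia.
move: aQ; rewrite memvE orthovD -!memvE !mem_orthov_plane.
move=> /andP[/andP[/eqP ae' /eqP af'] /andP[/eqP ae /eqP af]].
move: eP fP; rewrite !mem_orthov_plane.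
move=> /andP[/eqP e'e /eqP e'f].
move=> /andP[/eqP f'e /eqP f'f].
have ef1 : '[e + e', f + a] = 1.
  by rewrite !formE ef e'f (formC _ e a) ae (formC _ e' a) ae' oppr0 !addr0.
pose U := plane_vertex alt ef; pose W := plane_vertex alt ef1.
have capUW : (val U :&: val W = 0)%VS.
  apply/eqP; rewrite -subv0; apply/subvP => v; rewrite memv_cap => /andP[].
  move=> /(mem_plane alt ef) vU /(mem_plane alt ef1); rewrite {1}vU /plane_proj.
  set s := '[v, f + a]; set t := '[e + e', v] => E.
  have s0 : s = 0.
    move/(congr1 (fun v => '[v, f'])) : (E); rewrite !formE ef' (formC _ e f') f'e.
    rewrite (formC _ f f') f'f af'.
    by rewrite !(oppr0, mulr0, mulr1, addr0, add0r) => <-.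
  have t0 : t = 0.
    move/(congr1 (fun v => '[v, b])) : (E); move: bQ; rewrite memvE orthovD -!memvE.
    rewrite !mem_orthov_plane => /andP[/andP[/eqP be' /eqP bf'] /andP[/eqP be /eqP bf]].
    rewrite !formE ab (formC _ e b) (formC _ f b) be bf (formC _ e' b) be'.
    by rewrite !(oppr0, mulr0, mulr1, addr0, add0r) => <-.
  by rewrite vU /plane_proj E s0 t0 !scale0r addr0 mem0v.
have dimUW : \dim (val U + val W) = 4%N by rewrite dimv_disjoint_sum// !vertex_dim.
exists U, W => -[|[|[|//]]] /walk_small[E0 E1 E2].
- have UW := E0 erefl; move: capUW; rewrite -UW capvv => U0.
  by have := vertex_dim U; rewrite U0 dimv0.
- have /edgeP/(_ e (f + a) (plane_l _ _) (plane_r _ _)) := E1 erefl.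
  by rewrite formDr ef (formC _ e a) ae oppr0 addr0 => /eqP; rewrite oner_eq0.
- have [X [UX XW]] := E2 erefl.
  have XE : val X = orthov (val U + val W).
    rewrite edge_sym in UX; apply/eqP; rewrite eqEdim orthovD vertex_dim.
    rewrite (UX : (val X <= orthov (val U))%VS) (XW : (val X <= orthov (val W))%VS).
    have := dim_orthov_eq (val U + val W)%VS; rewrite dimUW D6.
    by move=> E; rewrite -(leq_add2r 4) E.
  have e'X : e' \in val X.
    rewrite XE memvE orthovD -!memvE !mem_orthov_plane e'e e'f !formE e'e e'f alt.
    by rewrite (formC _ e' a) ae' oppr0 addr0 eqxx.
  have e'S : e' \in (val U + val W)%VS.
    rewrite -[e'](addKr e) memv_add// ?plane_l// memvN; exact: plane_l.
  have : e' \in (val X :&: orthov (val X))%VS.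
    by rewrite memv_cap e'X XE orthov_orthov.
  by rewrite vertex_cap memv0 (negPf (form_neq0 ef').1).
Qed.

Lemma frame_diameter3 : has_diameter graph 3.
Proof.
apply: has_diameter_of_walks frame_far => U W; exists 3%N => //.
by apply: (walk3 alt U W rad0); rewrite D6.
Qed.

End Rank6.

(** * Dimension 4: the orthogonal as an involution on vertices *)

Section Rank4.
Hypothesis D4 : \dim {:V} = 4%N.

Lemma orthov_vertex_subproof (U : frame_vertex Psi) :
  (\dim (orthov (val U)) == 2) && nondegenerate_on Psi (orthov (val U)).
Proof.
have := dim_orthov_eq (val U); rewrite vertex_dim D4 => E.
rewrite (_ : \dim _ = 2%N) ?eqxx; last by lia.
by rewrite /nondegenerate_on orthov_orthov capvC vertex_cap eqxx.
Qed.

Definition orthov_vertex U : frame_vertex Psi :=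
  exist (fun U => is_true ((\dim U == 2) && nondegenerate_on Psi U)) _
    (orthov_vertex_subproof U).

Lemma orthov_vertexK : involutive orthov_vertex.
Proof. by move=> U; apply: val_inj; rewrite /= orthov_orthov. Qed.

Lemma edge_orthov_vertex (U W : frame_vertex Psi) : graph U W = (W == orthov_vertex U).
Proof.
apply/idP/eqP => [UW|->]; last by rewrite edge_sym /orthogonality_graph /= subvv.
apply: val_inj; apply/eqP; rewrite eqEdim /= -orthov_sym; apply/andP; split => //.
by have /andP[/eqP ->] := orthov_vertex_subproof U; rewrite vertex_dim.
Qed.

Lemma orthov_vertex_neq U : orthov_vertex U != U.
Proof. by rewrite eq_sym -edge_orthov_vertex edge_irr. Qed.

Lemma frame_complex_rank4 (s : {fset frame_vertex Psi}) :
  simplices (frame_complex Psi) s <->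
  s != fset0 /\ exists U, (s `<=` [fset U; orthov_vertex U])%fset.
Proof.
split=> [[s0 es]|[s0 [U sU]]].
  split=> //; have /fset0Pn[U Us] := s0; exists U; apply/fsubsetP => W Ws.
  rewrite in_fset2; case: (eqVneq W U) => [_|WU]; first exact: isT.
  rewrite orFb -edge_orthov_vertex; apply: es; [exact: Us|exact: Ws|].
  by rewrite eq_sym.
split; first exact: s0.
move=> X Y /(fsubsetP sU) + /(fsubsetP sU); rewrite !in_fset2.
move=> /orP[] /eqP -> /orP[] /eqP ->; rewrite edge_orthov_vertex ?eqxx//.
by rewrite orthov_vertexK eqxx.
Qed.

End Rank4.

End FrameGraph.

(** * Counting hyperbolic planes *)

Section CountingPlanes.
Context {K : fieldType} {V : vectType K} (Psi : {skew_symmetric V}).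
Hypothesis alt : Defs.alternating Psi.
Local Notation "''[' u , v ]" := (Psi u v) : ring_scope.
Local Notation orthov := (orthov Psi).
Local Notation plane := (@plane K V).
Local Notation formC := (formC Psi).
Local Notation formE := (formE Psi).

Definition vectors_in (Y : {vspace V}) := {v : V | v \in Y}.
Definition planes_in (Y : {vspace V}) := {U : frame_vertex Psi | (val U <= Y)%VS}.

Lemma card_vectors_in_plane e f (Y : {vspace V}) : '[e, f] = 1 ->
  (Y <= orthov (plane e f))%VS ->
  [set: (K * K) * vectors_in Y] #= [set: vectors_in (plane e f + Y)%VS].
Proof.
move=> ef Yef.
have hP (z : K * K * vectors_in Y) :
    (z.1.1 *: e + z.1.2 *: f) + val z.2 \in (plane e f + Y)%VS.
  by rewrite memv_add ?(valP z.2)// memv_add// memvZ// memv_line.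
have Yperp y : y \in Y -> '[y, e] = 0 /\ '[y, f] = 0.
  by move=> /(subvP Yef); rewrite mem_orthov_plane => /andP[/eqP -> /eqP ->].
apply: (@bijection_card_eq _ _ (fun z => exist (fun v => is_true (v \in (plane e f + Y)%VS))
  _ (hP z))).
  move=> [[a b] y] [[a' b'] y'] /(congr1 val) /= E.
  have [ye yf] := Yperp _ (valP y); have [ye' yf'] := Yperp _ (valP y').
  have Ea : a = a'.
    have := congr1 (fun v => '[v, f]) E; rewrite !formE ef alt.
    by move: yf yf' => /= -> ->; rewrite !(mulr0, mulr1, addr0).
  have Eb : b = b'.
    have := congr1 (fun v => '[e, v]) E; rewrite !formE ef alt (formC e (sval y)).
    rewrite (formC e (sval y')); move: ye ye' => /= -> ->.
    by rewrite !(mulr0, mulr1, addr0, add0r, oppr0).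
  congr (_, _, _) => //; apply: val_inj => /=; move: E; rewrite Ea Eb.
  exact: addrI.
move=> [v vP]; have [_ /memv_addP[_ /vlineP[a ->] [_ /vlineP[b ->] ->]] [y yY vE]] :=
  memv_addP vP.
by exists (a, b, exist _ y yY); apply: val_inj; rewrite /= -vE.
Qed.

(** * Hyperbolic planes in the orthogonal sum of a hyperbolic plane and [Y] *)

Section Recursion.
Context (e f : V) (Y : {vspace V}).
Hypotheses (ef : '[e, f] = 1) (Y_perp : (Y <= orthov (plane e f))%VS)
  (Y_nondeg : nondegenerate_on Psi Y).
Local Notation Z := (plane e f + Y)%VS.

Let Ye y : y \in Y -> '[y, e] = 0.
Proof. by move=> /(subvP Y_perp); rewrite mem_orthov_plane => /andP[/eqP]. Qed.

Let Yf y : y \in Y -> '[y, f] = 0.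
Proof. by move=> /(subvP Y_perp); rewrite mem_orthov_plane => /andP[_ /eqP]. Qed.

Let eY y : y \in Y -> '[e, y] = 0.
Proof. by move=> yY; rewrite formC Ye ?oppr0. Qed.

(** The convention that the dual of 0 is 0 makes [lam] vanish there, so that one formula for
    [pair_r] covers both normalizations. *)
Let dualP v0 : exists z, (v0 \in Y -> v0 != 0 -> '[v0, z] = 1) /\
  (v0 = 0 -> z = 0).
Proof.
have [->|v00] := eqVneq v0 0.
  by exists 0; split=> // _; rewrite eqxx.
have [v0Y|v0Y] := boolP (v0 \in Y); last by exists 0; split.
have : v0 \notin orthov Y.
  apply: contra v00 => v0p; have : v0 \in (Y :&: orthov Y)%VS by rewrite memv_cap v0Y.
  by rewrite (eqP Y_nondeg) memv0.
move=> /mem_orthovPn[z zY v0z]; exists ('[v0, z]^-1 *: z).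
split; first by rewrite !formE mulVf.
by move=> v0E; rewrite v0E eqxx in v00.
Qed.

Let dual v0 := projT1 (cid (dualP v0)).

Let form_dual v0 : v0 \in Y -> v0 != 0 -> '[v0, dual v0] = 1.
Proof. by have [] := projT2 (cid (dualP v0)). Qed.

Let dual0 : dual 0 = 0.
Proof. by have [_ /(_ erefl)] := projT2 (cid (dualP 0)). Qed.

Let lam v0 y := '[y, dual v0].
(** A plane not orthogonal to [e] meets the orthogonal of [e] in a line, spanned by [pair_l];
    [pair_r] completes it and pairs to 1 with [e]. The coefficient of [e] in [pair_l] is forced by
    requiring a hyperbolic pair. *)
Let pair_l v0 y := (1 - '[v0, y]) *: e + v0.
Let pair_r v0 y := f + lam v0 y *: e + (y - lam v0 y *: v0).

(* Modulo multiples of [pair_l v0 y], the vector [pair_r v0 y] is normalized  *)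
(* by the functional [lam v0] on its Y-part when v0 != 0, and by its          *)
(* e-coordinate when v0 = 0.                                                  *)
Let pair_form v0 y : v0 \in Y -> y \in Y -> '[pair_l v0 y, pair_r v0 y] = 1.
Proof.
move=> v0Y yY; rewrite /pair_l /pair_r !formE !alt ef Ye// Yf// !eY//.
by ring.
Qed.

Let pair_in v0 y : v0 \in Y -> y \in Y ->
  (plane (pair_l v0 y) (pair_r v0 y) <= Z)%VS.
Proof.
move=> v0Y yY; rewrite plane_sub /pair_l /pair_r; apply/andP; split.
  by rewrite memv_add// memvZ// plane_l.
apply: memv_add; last by rewrite memvB// memvZ.
by rewrite memvD ?plane_r// memvZ// plane_l.
Qed.

Let big_plane (z : vectors_in Y * vectors_in Y) : planes_in Z :=
  exist (fun U : frame_vertex Psi => is_true (val U <= Z)%VS)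
    (plane_vertex alt (pair_form (valP z.1) (valP z.2)))
    (pair_in (valP z.1) (valP z.2)).

Let lift_form c d x y : x \in Y -> y \in Y -> '[x, y] = 1 ->
  '[x + c *: e, y + d *: e] = 1.
Proof. by move=> xY yY xy; rewrite !formE xy alt eY// Ye//; ring. Qed.

(** A hyperbolic basis chosen for every plane; the two scalars of a lift are relative to it. *)
Let basis_of_plane (U : frame_vertex Psi) : V * V :=
  let h := cid (vertexP alt U) in (projT1 h, projT1 (cid (projT2 h))).

Let basis_of_planeP (U : frame_vertex Psi) :
  '[(basis_of_plane U).1, (basis_of_plane U).2] = 1 /\
  val U = plane (basis_of_plane U).1 (basis_of_plane U).2.
Proof. exact: projT2 (cid (projT2 (cid (vertexP alt U)))). Qed.

Let basis_of_plane_in (U : planes_in Y) :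
  ((basis_of_plane (val U)).1 \in Y) /\ ((basis_of_plane (val U)).2 \in Y).
Proof.
have [_ UE] := basis_of_planeP (val U); have := valP U.
by rewrite UE plane_sub => /andP[].
Qed.

(** A plane orthogonal to [e] projects isomorphically to a plane of [Y]; it is recovered by adding
    multiples of [e] to the basis vectors. *)
Let lift_vertex (z : K * K * planes_in Y) : frame_vertex Psi :=
  plane_vertex alt (lift_form z.1.1 z.1.2 (basis_of_plane_in z.2).1
    (basis_of_plane_in z.2).2 (basis_of_planeP (val z.2)).1).

Let lift_in z : (val (lift_vertex z) <= Z)%VS.
Proof.
case: z => [[c d] U]; have [xY yY] := basis_of_plane_in U.
by rewrite plane_sub /= ![_ + _ *: e]addrC !memv_add// memvZ// plane_l.
Qed.

Let small_plane z : planes_in Z :=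
  exist (fun U : frame_vertex Psi => is_true (val U <= Z)%VS) (lift_vertex z) (lift_in z).

Let form_small z v : v \in val (lift_vertex z) -> '[e, v] = 0.
Proof.
case: z => [[c d] U]; have [xY yY] := basis_of_plane_in U.
move=> /memv_addP[_ /vlineP[a ->] [_ /vlineP[b ->] ->]].
by rewrite /= !formE alt !eY//; ring.
Qed.

Let form_big v0 y : v0 \in Y -> y \in Y -> '[e, pair_r v0 y] = 1.
Proof. by move=> v0Y yY; rewrite /pair_r !formE ef alt !eY//; ring. Qed.

Let form_big_l v0 y : v0 \in Y -> '[e, pair_l v0 y] = 0.
Proof. by move=> v0Y; rewrite /pair_l !formE alt !eY//; ring. Qed.

Let pair_plane_inj v y v' y' : v \in Y -> y \in Y -> v' \in Y -> y' \in Y ->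
  plane (pair_l v y) (pair_r v y) = plane (pair_l v' y') (pair_r v' y') ->
  v = v' /\ y = y'.
Proof.
move=> vY yY vY' yY' E.
have pf := pair_form vY yY.
have : pair_l v' y' \in plane (pair_l v y) (pair_r v y) by rewrite E plane_l.
have : pair_r v' y' \in plane (pair_l v y) (pair_r v y) by rewrite E plane_r.
move=> /memv_addP[_ /vlineP[g ->] [_ /vlineP[d ->] Er]].
move=> /memv_addP[_ /vlineP[a ->] [_ /vlineP[b ->] El]].
have b0 : b = 0.
  have := congr1 (fun v => '[e, v]) El.
  rewrite /= form_big_l// formDr !formZr form_big_l// form_big//.
  by rewrite mulr0 mulr1 add0r => <-.
have d1 : d = 1.
  have := congr1 (fun v => '[e, v]) Er.
  rewrite /= (form_big vY')// formDr !formZr form_big_l// form_big//.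
  by rewrite mulr0 mulr1 add0r => <-.
have a1 : a = 1.
  have := pair_form vY' yY'; rewrite El Er b0 d1 scale0r scale1r addr0 formZl formDr.
  by rewrite formZr alt pf mulr0 add0r mulr1.
move: El Er; rewrite a1 b0 d1 !scale1r scale0r addr0 => El Er.
have split0 s s' w w' : w \in Y -> w' \in Y -> s *: e + w = s' *: e + w' ->
    s = s' /\ w = w'.
  move=> wY wY' sw; have ss : s = s'.
    have := congr1 (fun v => '[v, f]) sw; rewrite !formE ef !Yf//.
    by rewrite !(mulr1, addr0).
  by split=> //; move: sw; rewrite ss => /addrI.
have [_ vv] := split0 _ _ _ _ vY' vY El.
move: vv El Er => ->; rewrite /pair_r => _ Er.
have lY w : w \in Y -> w - lam v w *: v \in Y by move=> wY; rewrite memvB// memvZ.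
have {}Er : lam v y' *: e + (y' - lam v y' *: v) =
    (lam v y + g * (1 - '[v, y])) *: e + (g *: v + (y - lam v y *: v)).
  apply: (addrI f); rewrite addrA Er /pair_l scalerDr scalerA scalerDl.
  by rewrite [LHS](AC (2 * (2 * 1)) (3 * ((4 * 1) * (2 * 5)))).
have [l1 l2] := split0 _ _ _ _ (lY _ yY') (memvD (memvZ g vY) (lY _ yY)) Er.
(* The normalization removes the freedom in [g]: for [v = 0] the coefficients of [e] are compared,
   otherwise both [Y]-parts are killed by pairing with [dual v]. *)
have g0 : g = 0.
  have [v0|v0] := eqVneq v 0.
    move: l1; rewrite /lam v0 dual0 !formE => /eqP.
    by rewrite subr0 mulr1 add0r eq_sym => /eqP.
  have := congr1 (fun w => '[w, dual v]) l2; rewrite !formE form_dual// /lam.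
  by rewrite !mulr1 !subrr addr0 => <-.
split=> //; move: l1 l2; rewrite g0 mul0r addr0 scale0r add0r => -> /addIr.
by [].
Qed.

Let big_plane_inj : injective big_plane.
Proof.
move=> [v y] [v' y'] /(congr1 val)/(congr1 val) /= E.
have [vv yy] := pair_plane_inj (valP v) (valP y) (valP v') (valP y') E.
by rewrite (val_inj vv) (val_inj yy).
Qed.

Let lift_plane_inj x y x' y' c d c' d' :
  x \in Y -> y \in Y -> x' \in Y -> y' \in Y -> '[x, y] = 1 -> '[x', y'] = 1 ->
  plane (x + c *: e) (y + d *: e) = plane (x' + c' *: e) (y' + d' *: e) ->
  plane x y = plane x' y' /\ (x = x' -> y = y' -> c = c' /\ d = d').
Proof.
move=> xY yY xY' yY' xy xy' E.
have split0 s s' w w' : w \in Y -> w' \in Y -> w + s *: e = w' + s' *: e ->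
    s = s' /\ w = w'.
  move=> wY wY' sw; have ss : s = s'.
    have := congr1 (fun v => '[v, f]) sw; rewrite !formE ef !Yf//.
    by rewrite !(mulr1, add0r).
  by split=> //; move: sw; rewrite ss => /addIr.
have comb w s : w \in Y -> w + s *: e \in plane (x + c *: e) (y + d *: e) ->
    exists a b, w = a *: x + b *: y /\ s = a * c + b * d.
  move=> wY /memv_addP[_ /vlineP[a ->] [_ /vlineP[b ->]]].
  rewrite !scalerDr !scalerA addrACA -scalerDl.
  move=> wE; have xyY : a *: x + b *: y \in Y by rewrite memvD ?memvZ.
  by have [sE' wE'] := split0 _ _ _ _ wY xyY wE; exists a, b.
have [a [b [x'E c'E]]] : exists a b, x' = a *: x + b *: y /\ c' = a * c + b * d.
  by apply: comb => //; rewrite E; exact: plane_l.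
have [a2 [b2 [y'E d'E]]] : exists a b, y' = a *: x + b *: y /\ d' = a * c + b * d.
  by apply: comb => //; rewrite E; exact: plane_r.
split.
  apply: (eq_plane alt xy'); first exact: dim_plane xy.
    by rewrite x'E memvD ?memvZ ?plane_l ?plane_r.
  by rewrite y'E memvD ?memvZ ?plane_l ?plane_r.
move=> xx yy; rewrite -xx in x'E; rewrite -yy in y'E.
have a1 : a = 1.
  have := congr1 (fun v => '[v, y]) x'E; rewrite !formE alt xy.
  by rewrite mulr0 mulr1 addr0 => <-.
have b0 : b = 0.
  have := congr1 (fun v => '[x, v]) x'E; rewrite !formE alt xy.
  by rewrite mulr0 mulr1 add0r => <-.
have a20 : a2 = 0.
  have := congr1 (fun v => '[v, y]) y'E; rewrite !formE alt xy.
  by rewrite mulr0 mulr1 addr0 => <-.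
have b21 : b2 = 1.
  have := congr1 (fun v => '[x, v]) y'E; rewrite !formE alt xy.
  by rewrite mulr0 mulr1 add0r => <-.
by rewrite c'E d'E a1 b0 a20 b21 !mul1r !mul0r addr0 add0r.
Qed.

Let small_plane_inj : injective small_plane.
Proof.
move=> [[c d] U] [[c' d'] U'] E.
have {}E : val (lift_vertex (c, d, U)) = val (lift_vertex (c', d', U')).
  exact: (congr1 (fun W : planes_in Z => val (val W)) E).
have [xY yY] := basis_of_plane_in U; have [xY' yY'] := basis_of_plane_in U'.
have [xy UE] := basis_of_planeP (val U); have [xy' UE'] := basis_of_planeP (val U').
have [UU cd] := lift_plane_inj xY yY xY' yY' xy xy' E.
have {}UU : U = U' by apply/val_inj/val_inj; rewrite UE UE'.
by subst U'; have [/= -> ->] := cd erefl erefl.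
Qed.

Let plane_shift v w g : '[v, w] = 1 -> plane v (w + g *: v) = plane v w.
Proof.
move=> vw; have vw' : '[v, w + g *: v] = 1 by rewrite !formE vw alt mulr0 addr0.
apply/esym/(eq_plane alt vw'); first exact: dim_plane vw.
  exact: plane_l.
by rewrite memvD ?plane_r// memvZ// plane_l.
Qed.

Let plane_surj (U : planes_in Z) :
  (exists z, big_plane z = U) \/ (exists z, small_plane z = U).
Proof.
have [x [y [xy UE]]] := vertexP alt (val U).
have decomp u : u \in val (val U) -> exists a b u0,
    [/\ u0 \in Y, u = a *: e + b *: f + u0 & '[e, u] = b].
  move=> /(subvP (valP U)) /memv_addP[_ /memv_addP[_ /vlineP[a ->] [_ /vlineP[b ->] ->]]].
  move=> [u0 u0Y ->]; exists a, b, u0; split => //.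
  by rewrite !formE alt ef eY//; ring.
(* The two families are separated by whether the plane is orthogonal to [e]. *)
have [[w0 [w0U ew0]]|eN] := pselect (exists w, w \in val (val U) /\ '[e, w] != 0); last first.
  right.
  have e0 u : u \in val (val U) -> '[e, u] = 0.
    by move=> uU; apply/eqP; apply: contrapT => /negP eu; apply: eN; exists u.
  have [xU yU] : x \in val (val U) /\ y \in val (val U).
    by rewrite UE plane_l plane_r.
  have [a [b0 [x0 [x0Y xE exb]]]] := decomp _ xU.
  have [b [b1 [y0 [y0Y yE eyb]]]] := decomp _ yU.
  move: xE yE; rewrite -exb -eyb !e0// !scale0r !addr0 => xE yE.
  have xy0 : '[x0, y0] = 1.
    by move: xy; rewrite xE yE !formE alt eY// Ye// !mulr0 !add0r.
  have U0P : (plane x0 y0 <= Y)%VS by rewrite plane_sub x0Y.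
  pose U0 : planes_in Y := exist (fun U : frame_vertex Psi => is_true (val U <= Y)%VS)
    (plane_vertex alt xy0) U0P.
  have [xY1 yY1] := basis_of_plane_in U0; have [xy1 U0E] := basis_of_planeP (val U0).
  have lift w : w \in plane x0 y0 -> exists c, w + c *: e \in val (val U).
    move=> /memv_addP[_ /vlineP[p ->] [_ /vlineP[q ->] ->]]; exists (p * a + q * b).
    rewrite scalerDl addrACA -!scalerA -!scalerDr [x0 + _]addrC [y0 + _]addrC -xE -yE.
    by rewrite memvD ?memvZ.
  have lift2 x1 y1 : plane x0 y0 = plane x1 y1 ->
      (exists c, x1 + c *: e \in val (val U)) /\ (exists d, y1 + d *: e \in val (val U)).
    by move=> E; split; apply: lift; rewrite E ?plane_l ?plane_r.
  have [[c cU] [d dU]] := lift2 _ _ U0E.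
  exists (c, d, U0); apply/val_inj/val_inj/esym/(eq_plane alt).
  - exact: (lift_form c d xY1 yY1 xy1).
  - exact: vertex_dim.
  - exact: cU.
  - exact: dU.
left; pose w := '[e, w0]^-1 *: w0.
have wU : w \in val (val U) by rewrite memvZ.
have ew : '[e, w] = 1 by rewrite /w !formE mulVf.
clearbody w.
have : w \notin orthov (val (val U)).
  apply: contraTN ew0 => wp; have : w \in (val (val U) :&: orthov (val (val U)))%VS.
    by rewrite memv_cap wU.
  rewrite vertex_cap memv0 => /eqP w00; move: ew; rewrite w00 !formE => /eqP.
  by rewrite eq_sym oner_eq0.
move=> /mem_orthovPn[v1 v1U wv1].
pose v2 := '[v1, w]^-1 *: v1; have v1w : '[v1, w] != 0 by rewrite formC oppr_eq0.
have v2U : v2 \in val (val U) by rewrite memvZ.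
have v2w : '[v2, w] = 1 by rewrite /v2 formZl mulVf.
clearbody v2; pose v := v2 - '[e, v2] *: w.
have vU : v \in val (val U) by rewrite memvB// memvZ.
have ev : '[e, v] = 0 by rewrite /v formDr formNr formZr ew mulr1 subrr.
have vw : '[v, w] = 1 by rewrite /v formDl formNl formZl alt v2w mulr0 subr0.
clearbody v.
have [a [b [v0 [v0Y vE]]]] := decomp _ vU; rewrite ev => b0.
have [t [s [w1 [w1Y wE]]]] := decomp _ wU; rewrite ew => s1.
move: vE wE; rewrite -b0 -s1 scale0r scale1r addr0 => vE wE.
have aE : a = 1 - '[v0, w1].
  move: vw; rewrite vE wE !formE !alt ef Yf// Ye// !eY// => E.
  by rewrite -E; ring.
(* A multiple of [v] is added to [w] to reach the normal form: [g = - t] cancels the coefficient of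
   [e] when [v0 = 0], and otherwise [g] makes the [Y]-part vanish against [dual v0]. The vector [y]
   then restores the coefficient of [e] as a multiple of [v0]. *)
have [g gP] : exists g, exists y, [/\ y \in Y, lam v0 y = t + g * a,
    y - lam v0 y *: v0 = w1 + g *: v0 & '[v0, y] = '[v0, w1]].
  have [v00|v00] := eqVneq v0 0.
    exists (- t), w1; move: aE; rewrite v00 !formE subr0 => ->.
    by rewrite /lam dual0 formE mulr1 subrr !scaler0 subr0 addr0.
  exists (- '[w1, dual v0]); set g := - _.
  exists (w1 + g *: v0 + (t + g * a) *: v0).
  have lamE : lam v0 (w1 + g *: v0 + (t + g * a) *: v0) = t + g * a.
    by rewrite /lam !formE form_dual// /g; ring.
  split.
  - by rewrite !memvD ?memvZ.
  - exact: lamE.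
  - by rewrite lamE addrK.
  - by rewrite !formE alt; ring.
have [y1 [y1Y lE yE vy]] := gP.
exists (exist _ v0 v0Y, exist _ y1 y1Y); apply/val_inj/val_inj => /=.
have -> : pair_l v0 y1 = v by rewrite /pair_l vy -aE vE.
have -> : pair_r v0 y1 = w + g *: v.
  rewrite /pair_r yE lE wE vE scalerDr scalerA scalerDl.
  by rewrite [RHS](AC (3 * 2) ((2 * (1 * 4)) * (3 * 5))).
by rewrite plane_shift//; apply/esym/(eq_plane alt vw) => //; exact: vertex_dim.
Qed.

(** The families are disjoint since [pair_r] pairs to 1 with [e], while lifts are orthogonal to [e];
    [plane_surj] shows that they exhaust all planes. *)
Lemma card_planes_in : [set: vectors_in Y * vectors_in Y + K * K * planes_in Y] #=
  [set: planes_in Z].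
Proof.
apply: (@bijection_card_eq _ _ (fun z => match z with
  | inl z => big_plane z | inr z => small_plane z end)).
  have bs z z' : big_plane z <> small_plane z'.
    move=> /(congr1 val)/(congr1 val) E.
    have : pair_r (val z.1) (val z.2) \in val (lift_vertex z').
      have /= <- := E; exact: plane_r.
    move=> /form_small; rewrite form_big ?(valP z.1) ?(valP z.2)// => /eqP.
    by rewrite oner_eq0.
  move=> [z|z] [z'|z'].
  - by move=> /big_plane_inj ->.
  - by move/bs.
  - by move/esym/bs.
  - by move=> /small_plane_inj ->.
move=> U; have [[z zU]|[z zU]] := plane_surj U; first by exists (inl z).
by exists (inr z).
Qed.

End Recursion.
End CountingPlanes.

Lemma card_eqM (A A' B B' : Type) : [set: A] #= [set: A'] -> [set: B] #= [set: B'] ->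
  [set: A * B] #= [set: A' * B'].
Proof.
move=> /card_eq_bijection[f [f' fK f'K]] /card_eq_bijection[g [g' gK g'K]].
apply: (@bijective_card_eq _ _ (fun z => (f z.1, g z.2))).
by exists (fun z => (f' z.1, g' z.2)) => -[x y] /=; rewrite ?fK ?gK ?f'K ?g'K.
Qed.

Lemma card_eqA (A A' B B' : Type) : [set: A] #= [set: A'] -> [set: B] #= [set: B'] ->
  [set: A + B] #= [set: A' + B'].
Proof.
move=> /card_eq_bijection[f [f' fK f'K]] /card_eq_bijection[g [g' gK g'K]].
apply: (@bijective_card_eq _ _ (fun z => match z with inl x => inl (f x) | inr y => inr (g y) end)).
exists (fun z => match z with inl x => inl (f' x) | inr y => inr (g' y) end).
  by case=> x; rewrite ?fK ?gK.
by case=> x; rewrite ?f'K ?g'K.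
Qed.

(** * Numbers of vertices, neighbours and flags *)

Section FrameCardinals.
Context {K : fieldType} {V : vectType K} (Psi : {skew_symmetric V}).
Hypothesis alt : Defs.alternating Psi.
Local Notation "''[' u , v ]" := (Psi u v) : ring_scope.
Local Notation orthov := (orthov Psi).
Local Notation plane := (@plane K V).
Local Notation graph := (orthogonality_graph Psi).

Lemma card_vectors_plane e f : '[e, f] = 1 ->
  [set: vectors_in (plane e f)] #= [set: K * K].
Proof.
move=> ef; rewrite card_eq_sym; have := card_vectors_in_plane alt ef (sub0v (orthov (plane e f))).
rewrite addv0 => /(card_eq_trans _); apply.
apply: (@bijection_card_eq _ _ (fun z : K * K =>
  (z, exist (fun v => is_true (v \in 0%VS)) 0 (mem0v 0%VS)))).
  by move=> x y [].
move=> [z [v v0]]; exists z; congr pair; apply: val_inj => /=.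
by apply/esym/eqP; rewrite -memv0.
Qed.

(** The recursion with a plane for [Y], which has as many vectors as [K * K] and contains one plane:
    that plane accounts for [None]. *)
Lemma card_planes_rank4 e f e' f' : '[e, f] = 1 -> '[e', f'] = 1 ->
  (plane e' f' <= orthov (plane e f))%VS ->
  [set: planes_in Psi (plane e f + plane e' f')%VS] #= [set: (K * K) * option (K * K)].
Proof.
move=> ef ef' P'P; rewrite card_eq_sym.
apply: card_eq_trans (card_planes_in alt ef P'P (plane_nondegenerate alt ef')).
have cY := card_vectors_plane ef'.
have cP : [set: planes_in Psi (plane e' f')] #= [set: unit].
  apply: (@bijection_card_eq _ _ (fun=> tt)) => [U W _|[]]; last first.
    by exists (exist (fun U : frame_vertex Psi => is_true (val U <= plane e' f')%VS)
      (plane_vertex alt ef') (subvv _)).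
  have E (U0 : planes_in Psi (plane e' f')) : val (val U0) = plane e' f'.
    by apply/eqP; rewrite eqEdim (valP U0) (dim_plane alt ef') vertex_dim.
  by apply/val_inj/val_inj; rewrite !E.
rewrite card_eq_sym.
apply: (card_eq_trans (card_eqA (card_eqM cY cY) (card_eqM (card_eqxx _) cP))).
apply: (@bijective_card_eq _ _ (fun z : K * K * (K * K) + K * K * unit => match z with
  | inl (x, y) => (x, Some y) | inr (x, _) => (x, None) end)).
exists (fun z => match z with (x, Some y) => inl (x, y) | (x, None) => inr (x, tt) end).
  by case=> [[x y]|[x []]].
by case=> x [y|].
Qed.

Hypothesis rad0 : \dim (orthov fullv) = 0%N.

Lemma splits_nondegenerate (Q : {vspace V}) : splits Psi Q -> nondegenerate_on Psi Q.
Proof.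
move=> sQ; rewrite /nondegenerate_on -subv0 -(radical0 rad0); apply/subvP => v.
rewrite memv_cap => /andP[vQ vP]; rewrite memvE orthov_sym.
apply: subv_trans sQ _; rewrite subv_add orthov_sym -memvE vP orthov_sym /=.
rewrite -memvE; apply/mem_orthovP => w wP.
by rewrite formC (mem_orthovP wP) ?oppr0.
Qed.

Lemma card_planes_full : [set: planes_in Psi fullv] #= [set: frame_vertex Psi].
Proof.
apply: (@bijection_card_eq _ _ (fun U : planes_in Psi fullv => val U)) => [|U].
  exact: val_inj.
by exists (exist (fun U : frame_vertex Psi => is_true (val U <= fullv)%VS) U (subvf _)).
Qed.

Lemma card_frame_vertex_rank4 : \dim {:V} = 4%N ->
  [set: frame_vertex Psi] #= [set: (K * K) * option (K * K)].
Proof.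
move=> D4; have [|e [f [e' [f' [ef ef' eP fP]]]]] := two_hyperbolic_pairs alt rad0.
  by rewrite D4.
have P'P : (plane e' f' <= orthov (plane e f))%VS by rewrite plane_sub eP.
rewrite -(card_eql card_planes_full).
suff <- : (plane e f + plane e' f')%VS = fullv by exact: card_planes_rank4.
apply/eqP; rewrite eqEdim subvf D4.
by have := dim_edge (P'P : graph (plane_vertex alt ef') (plane_vertex alt ef));
  rewrite addvC => /= ->.
Qed.

Section Finite.
Context (q : nat).
Hypothesis Kq : [set: K] #= `I_q.

Let card_rank4 : [set: (K * K) * option (K * K)] #= `I_((q * q) * (q * q + 1)).
Proof.
have K2 := card_eq_prod Kq Kq; apply: (card_eq_prod K2).
have U1 : [set: unit] #= `I_1 by rewrite -card_unit; exact: card_finType.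
apply: card_eq_trans (card_eq_sum K2 U1).
apply: (@bijective_card_eq _ _ (fun z : option (K * K) => match z with
  | Some x => inl x | None => inr tt end)).
by exists (fun z => match z with inl x => Some x | inr _ => None end) => [[]|[?|[]]].
Qed.

Lemma card_frame_vertex_rank4_fin : \dim {:V} = 4%N ->
  [set: frame_vertex Psi] #= `I_((q * q) * (q * q + 1)).
Proof. by move=> D4; exact: card_eq_trans (card_frame_vertex_rank4 D4) card_rank4. Qed.

Hypothesis D6 : \dim {:V} = 6%N.

Let triple e f : '[e, f] = 1 -> exists e1 f1 e2 f2, [/\ '[e1, f1] = 1, '[e2, f2] = 1,
  (plane e2 f2 <= orthov (plane e1 f1))%VS,
  orthov (plane e f) = (plane e1 f1 + plane e2 f2)%VS &
  (plane e f + (plane e1 f1 + plane e2 f2))%VS = fullv].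
Proof.
move=> ef; have sP := splits_plane1 alt ef.
have [|e1 [f1 [e1P f1P ef1]]] := orthov_hyperbolic_pair rad0 sP.
  by rewrite (dim_plane alt ef) D6.
have P1P : (plane e1 f1 <= orthov (plane e f))%VS by rewrite plane_sub e1P.
pose U := plane_vertex alt ef; pose U1 := plane_vertex alt ef1.
have UU1 : graph U1 U by [].
have [|e2 [f2 [e2P f2P ef2]]] := orthov_hyperbolic_pair rad0 (splits_edge alt UU1).
  by rewrite dim_edge// D6.
have : (plane e2 f2 <= orthov (plane e1 f1 + plane e f))%VS by rewrite plane_sub e2P.
rewrite orthovD => /andP[P21 P2].
have UU2 : graph (plane_vertex alt ef2) U1 by [].
have D12 : \dim (plane e1 f1 + plane e2 f2) = 4%N by rewrite addvC; exact: dim_edge UU2.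
have E : orthov (plane e f) = (plane e1 f1 + plane e2 f2)%VS.
  apply/esym/eqP; rewrite eqEdim subv_add P1P P2/= D12.
  by have := dim_orthov_eq rad0 (plane e f); rewrite (dim_plane alt ef) D6; lia.
exists e1, f1, e2, f2; split => //.
apply/eqP; rewrite eqEdim subvf D6 dimv_disjoint_sum ?(dim_plane alt ef) ?D12//.
by rewrite -E; exact: (vertex_cap U).
Qed.

(** The neighbours of [U] are the hyperbolic planes of its orthogonal, a sum of two orthogonal
    hyperbolic planes. *)
Lemma card_neighbors (U : frame_vertex Psi) :
  [set: {W | graph U W}] #= `I_((q * q) * (q * q + 1)).
Proof.
have [e [f [ef UE]]] := vertexP alt U; have [e1 [f1 [e2 [f2 [ef1 ef2 P21 E _]]]]] := triple ef.
apply: (card_eq_trans _ card_rank4); apply: (card_eq_trans _ (card_planes_rank4 ef1 ef2 P21)).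
have h (z : {W | graph U W}) : (val (val z) <= plane e1 f1 + plane e2 f2)%VS.
  by rewrite -E -UE; have := valP z; rewrite edge_sym.
apply: (@bijection_card_eq _ _ (fun z : {W | graph U W} =>
  exist (fun W : frame_vertex Psi => is_true (val W <= plane e1 f1 + plane e2 f2)%VS)
    (val z) (h z))).
  by move=> z z' /(congr1 val) /= zz; apply: val_inj.
move=> [W WP]; have UW : graph U W.
  by rewrite edge_sym /orthogonality_graph UE E.
by exists (exist (fun W => is_true (graph U W)) W UW); apply: val_inj.
Qed.

(** The recursion with [Y] of dimension 4, which has q^4 vectors and q^4 + q^2 planes: the sum is
    q^8 + q^6 + q^4. *)
Lemma card_frame_vertex_rank6 : [set: frame_vertex Psi] #=
  `I_((q * q) * (q * q) * ((q * q) * (q * q)) + (q * q) * ((q * q) * (q * q + 1))).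
Proof.
have [|e [f [_ _ ef]]] := orthov_hyperbolic_pair rad0 (splits0 Psi).
  by rewrite dimv0 D6.
have [e1 [f1 [e2 [f2 [ef1 ef2 P21 E Efull]]]]] := triple ef.
have YP : (plane e1 f1 + plane e2 f2 <= orthov (plane e f))%VS by rewrite E.
have Yn : nondegenerate_on Psi (plane e1 f1 + plane e2 f2)%VS.
  apply: splits_nondegenerate; rewrite addvC.
  exact: (@splits_edge _ _ _ alt (plane_vertex alt ef2) (plane_vertex alt ef1)).
rewrite -(card_eql card_planes_full) -Efull.
rewrite -(card_eql (card_planes_in alt ef YP Yn)).
have K2 := card_eq_prod Kq Kq.
have cY : [set: vectors_in (plane e1 f1 + plane e2 f2)%VS] #= `I_((q * q) * (q * q)).
  rewrite -(card_eql (card_vectors_in_plane alt ef1 P21)).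
  apply: (card_eq_prod K2); exact: card_eq_trans (card_vectors_plane ef2) K2.
apply: card_eq_sum; first exact: card_eq_prod.
apply: (card_eq_prod K2); exact: card_eq_trans (card_planes_rank4 ef1 ef2 P21) card_rank4.
Qed.

Lemma card_flags_rank6 : [set: {UW : frame_vertex Psi * frame_vertex Psi | graph UW.1 UW.2}] #=
  `I_(((q * q) * (q * q) * ((q * q) * (q * q)) + (q * q) * ((q * q) * (q * q + 1))) *
      ((q * q) * (q * q + 1))).
Proof. exact: card_eq_sig card_frame_vertex_rank6 card_neighbors. Qed.

End Finite.
End FrameCardinals.

(** * The homotopy types and connectedness of frame complexes *)

Lemma frame_complex_connected (R : realType) (K : fieldType) (n r : nat)
    (V : vectType K) (Psi : {skew_symmetric V}) : (2 <= n)%N ->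
  degenerate_symplectic r Psi -> \dim (fullv : {vspace V}) = (2 * n + r)%N ->
  connected [set: realization R (frame_complex Psi)] <-> (3 <= n)%N.
Proof.
move=> n2 [alt rad] dimV; split=> [cX|n3].
  rewrite ltn_neqAle n2 andbT; apply/eqP => n2E.
  have D4 : \dim {:V} = (4 + r)%N by rewrite dimV -n2E.
  exact: (disconnected_rank4 alt rad D4 cX).
by apply: (connected_frame_complex alt rad); rewrite dimV; lia.
Qed.

(** Every component has two vertices, so [D * bool] is equinumerous with the vertices. If [D] is
    finite, so is the vertex set, into which [K] embeds. *)
Lemma frame_complex_rank4_components (R : realType) (K : fieldType) (V : vectType K)
    (Psi : {skew_symmetric V}) : symplectic Psi -> \dim (fullv : {vspace V}) = 4%N ->
  exists D : choiceType,
    [/\ homotopy_equivalent R (realization R (frame_complex Psi)) (discrete_topology D),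
        [set: (D * bool)%type] #= [set: ((K * K) * option (K * K))%type],
        forall q : nat, [set: K] #= `I_q ->
          [set: D] #= `I_((q ^ 2 * (q ^ 2 + 1)) %/ 2)%N &
        infinite_set [set: K] -> infinite_set [set: D]].
Proof.
move=> [alt rad] D4.
have [D [DX cD]] := disjoint_edges_discrete (R := R) (orthov_vertexK rad D4)
  (orthov_vertex_neq rad D4) (frame_complex_rank4 rad D4).
have cDK := card_eq_trans cD (card_frame_vertex_rank4 alt rad D4).
exists D; split => // [q Kq|Kinf].
  have Vq := card_frame_vertex_rank4_fin alt rad Kq D4.
  have [m Dm mq] : exists2 m, [set: D] #= `I_m & (m * #|{: bool}| = q * q * (q * q + 1))%N.
    by apply: card_eq_prod_inv; [rewrite card_bool|exact: card_eq_trans cD Vq].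
  by rewrite !expnS expn0 muln1 -mq card_bool mulnK.
apply: contra_not Kinf => /finite_setP[m Dm]; apply/finite_setP.
have B2 : [set: bool] #= `I_2 by rewrite -card_bool; exact: card_finType.
have KD : [set: (K * K) * option (K * K)] #= `I_(m * 2).
  by rewrite -(card_eql cDK); exact: card_eq_prod.
by apply: (card_eq_injection (f := fun x : K => ((x, x), None)) _ KD) => x y [].
Qed.

(** The number of circles is 2k + 1 - v with v = q^8 + q^6 + q^4 and 6k = v(q^4 + q^2), that is,
    v(q^4 + q^2)/3 + 1 - v, computed in the rationals because of the division by 3. *)
Lemma frame_complex_rank6_wedge (R : realType) (K : fieldType) (V : vectType K)
    (Psi : {skew_symmetric V}) : symplectic Psi -> \dim (fullv : {vspace V}) = 6%N ->
  exists I : choiceType,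
    homotopy_equivalent R (realization R (frame_complex Psi)) (wedge_of_circles R I) /\
    forall q : nat, [set: K] #= `I_q ->
      exists2 m : nat, [set: I] #= `I_m &
        m%:Z = - reduced_euler (frame_complex Psi) /\
        m%:R = 1 / 3 * (q%:R ^+ 12 + 2 * q%:R ^+ 10 - q%:R ^+ 8
                 - 2 * q%:R ^+ 6 - 3 * q%:R ^+ 4 + 3) :> rat.
Proof.
move=> [alt rad] D6.
have [le3 [root [far dist3]]] := frame_diameter3 alt rad D6.
have rad3 U : exists2 k, walk (orthogonality_graph Psi) root U k & (k <= 3)%N.
  by have [k [? _] ?] := le3 root U; exists k.
have [I [IX Icard]] := graph_of_triangles_wedge (edge_sym (Psi := Psi)) (edge_irr (Psi := Psi))
  (third_vertex alt rad D6) (frame_neighbor alt rad D6) (frame_branch alt rad D6)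
  dist3 isT rad3 R.
exists I; split => // q Kq.
have [m Im [k kE [mE eE]]] :=
  Icard _ _ (card_frame_vertex_rank6 alt rad Kq D6) (card_flags_rank6 alt rad Kq D6).
exists m => //; split; first by rewrite /frame_complex eE; move: mE; lia.
move: kE mE => /(congr1 (fun i : nat => i%:R : rat)) + /(congr1 (fun i : nat => i%:R : rat)).
rewrite !(natrD, natrM) => kE mE.
have -> : (m%:R : rat) = 2%:R * k%:R + 1%:R - (q%:R * q%:R * (q%:R * q%:R) *
    (q%:R * q%:R * (q%:R * q%:R)) + q%:R * q%:R * (q%:R * q%:R * (q%:R * q%:R + 1%:R))).
  by rewrite -mE addrK.
have -> : (2%:R * k%:R : rat) = (6%:R * k%:R) / 3%:R by field.
by rewrite kE; field.
Qed.

Theorem theorem6p1 (R : realType) (K : fieldType) (n : nat) (n_ge2 : (2 <= n)%N) :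
  (forall (V : vectType K) (Psi : {skew_symmetric V}),
     symplectic Psi -> \dim (fullv : {vspace V}) = (2 * n)%N ->
     [/\ connected [set: realization R (frame_complex Psi)] <-> (3 <= n)%N,
         n = 2%N ->
           exists D : choiceType,
             [/\ homotopy_equivalent R (realization R (frame_complex Psi))
                   (discrete_topology D),
                 [set: (D * bool)%type] #= [set: ((K * K) * option (K * K))%type],
                 forall q : nat, [set: K] #= `I_q ->
                   [set: D] #= `I_((q ^ 2 * (q ^ 2 + 1)) %/ 2)%N &
                 infinite_set [set: K] -> infinite_set [set: D]],
         n = 3%N ->
           has_diameter (orthogonality_graph Psi) 3 /\
           exists I : choiceType,
             homotopy_equivalent R (realization R (frame_complex Psi))
               (wedge_of_circles R I) /\
             forall q : nat, [set: K] #= `I_q ->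
               exists2 m : nat, [set: I] #= `I_m &
                 m%:Z = - reduced_euler (frame_complex Psi) /\
                 m%:R = 1 / 3 * (q%:R ^+ 12 + 2 * q%:R ^+ 10 - q%:R ^+ 8
                          - 2 * q%:R ^+ 6 - 3 * q%:R ^+ 4 + 3) :> rat &
         (4 <= n)%N -> has_diameter (orthogonality_graph Psi) 2]) /\
  (forall (r : nat) (V' : vectType K) (Psi' : {skew_symmetric V'}),
     degenerate_symplectic r Psi' ->
     \dim (fullv : {vspace V'}) = (2 * n + r)%N ->
     connected [set: realization R (frame_complex Psi')] <-> (3 <= n)%N).
Proof.
split=> [V Psi symp dimV|r V' Psi' symp dimV]; last exact: frame_complex_connected dimV.
split=> [|n2|n3|n4].
- by apply: (@frame_complex_connected R K n 0) => //; rewrite addn0.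
- by apply: frame_complex_rank4_components => //; rewrite dimV n2.
- have D6 : \dim (fullv : {vspace V}) = 6%N by rewrite dimV n3.
  split; last exact: frame_complex_rank6_wedge.
  by have [alt rad] := symp; exact: frame_diameter3.
- by have [alt rad] := symp; apply: frame_diameter2 => //; rewrite dimV; lia.
Qed.
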